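(* Let $p,q$ be coprime integers with $q\ne0$, let $r>3$ be an integer and $\gamma=\pi/r$. The quantum invariants of $M_{p/q}$ are given by $$\tau_r(M_{p/q})=\frac{\beta(r)r^2}4\sum_{n\in\mathbb{Z}/|q|\mathbb{Z}}\int_{C_r^1}\cot(\pi rx)\left(\int_{C_r^2}\tan(\pi ry)f_{n,r}(x,y)\,dy\right)dx,$$ where $$\beta(r)=\frac{i\,\mathrm{sign}(q)}{r\sqrt{|q|}}e^{-\frac{3\pi i}4\mathrm{sign}(pq)}\exp\left(\frac{\pi i}{2r}\left[3\,\mathrm{sign}(pq)-\frac pq+S\left(\frac pq\right)\right]\right),$$ $$f_{n,r}(x,y)=\sin\left(\frac\pi q(x-2nd)\right)e^{2\pi ir\left(\frac{dn^2}q+\frac p{4q}x^2-\frac nqx-xy\right)}\frac{S_\gamma(-\pi+2\pi(x-y))}{S_\gamma(-\pi+2\pi(x+y))},$$ $C_r^1$ is a closed curve in $\Omega_r$ such that the poles $\{k/r\mid k=1,2,\dots,r-1\}$ of $x\mapsto\cot(\pi rx)$ lie inside $C_r^1$ and the poles $0$ and $1$ lie outside $C_r^1$, and $C_r^2$ is a closed curve in $\Omega_r$ such that the poles $\{(m+1/2)/r\mid m=0,1,\dots,r-1\}$ of $y\mapsto\tan(\pi ry)$ lie inside $C_r^2$. Both curves are oriented in the anti-clockwise direction.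
   Context: $\Omega_r=\{w\in\mathbb{C}\mid-\frac1{4r}<\mathrm{Re}(w)<1+\frac1{4r}\}$. $d$ is an integer with $pd\equiv1\pmod q$. $S(p/q)=12\,\mathrm{sign}(q)\,s(p,|q|)$ is the Dedekind symbol ($s$ the Dedekind sum). Faddeev's quantum dilogarithm: for $\gamma\in]0,1[$ and $|\mathrm{Re}(\zeta)|<\pi+\gamma$, $$S_\gamma(\zeta)=\exp\left(\frac14\int_{C_R}\frac{e^{\zeta z}}{\sinh(\pi z)\sinh(\gamma z)z}\,dz\right),$$ where $C_R$ is the contour $]-\infty,-R]+\Upsilon_R+[R,\infty[$, $\Upsilon_R(t)=Re^{\sqrt{-1}(\pi-t)}$, $t\in[0,\pi]$, $R\in]0,1[$. It is extended to a meromorphic function on $\mathbb{C}$ by the functional equation $(1+e^{\sqrt{-1}\zeta})S_\gamma(\zeta+\gamma)=S_\gamma(\zeta-\gamma)$. $M_{p/q}$ is the closed oriented 3-manifold obtained by Dehn surgery on $S^3$ along the figure 8 knot $K$ with coefficient $p/q$. $\tau_r$ is the Reshetikhin–Turaev invariant associated to $\mathfrak{sl}_2(\mathbb{C})$ at the root of unity $\xi=e^{2\pi i/r}$ in Turaev's normalization $\tau_r(S^3)=\sqrt{2/r}\,\sin(\pi/r)$; by the surgery formula it is $$\tau_r(M_{p/q})=a(r)\sum_{n\in\mathbb{Z}/|q|\mathbb{Z}}e^{2\pi ir\frac{dn^2}q}\sum_{k=1}^{r-1}\sin\left(\tfrac\pi q\left[2nd-\tfrac kr\right]\right)e^{\frac{\pi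 ir}{2q}\left[p(\frac kr)^2-4n\frac kr\right]}\frac{\sin(\pi k/r)}{\sin(\pi/r)}J_K'(k),$$ with $J'_K(k)=\sum_{m=0}^{k-1}\xi^{-mk}\prod_{l=1}^m(1-\xi^{k-l})(1-\xi^{k+l})$ and $a(r)=-\frac{2\,\mathrm{sign}(q)}{r\sqrt{|q|}}\sin(\frac\pi r)e^{-\frac{3\pi i}4\mathrm{sign}(pq)}\exp\left(\frac{\pi i}{2r}\left[3\,\mathrm{sign}(pq)-\frac pq+S(\frac pq)\right]\right)$. *)

(* Defs.v *)
(* Stdlib reals with Coquelicot: complex numbers [C], integrals [RInt]. *)
From Stdlib Require Export Reals ZArith.
From Coquelicot Require Export Coquelicot.
Open Scope R_scope.

(* * Elementary complex functions *)

Definition Cexp (z : C) : C :=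
  (exp (Re z) * cos (Im z), exp (Re z) * sin (Im z)).
Definition Csin (z : C) : C := ((Cexp (Ci * z) - Cexp (- (Ci * z))) / (2 * Ci))%C.
Definition Ccos (z : C) : C := ((Cexp (Ci * z) + Cexp (- (Ci * z))) / 2)%C.
Definition Ctan (z : C) : C := (Csin z / Ccos z)%C.
Definition Ccot (z : C) : C := (Ccos z / Csin z)%C.
Definition Csinh (z : C) : C := ((Cexp z - Cexp (- z)) / 2)%C.

Definition Csum (a : nat -> C) (m n : nat) : C :=
  sum_n_m (G := C_AbelianMonoid) a m n.

(* [Cprod a m] is the product of [a l] for [1 <= l <= m]. *)
Fixpoint Cprod (a : nat -> C) (m : nat) : C :=
  match m with
  | O => RtoC 1
  | S m' => (Cprod a m' * a m)%C
  end.

(* * Curves and contour integrals *)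

Definition path_deriv (c : R -> C) (t : R) : C :=
  (Derive (fun s => Re (c s)) t, Derive (fun s => Im (c s)) t).

Definition contour_int (f : C -> C) (c : R -> C) (a b : R) : C :=
  RInt (V := C_R_CompleteNormedModule)
    (fun t => (f (c t) * path_deriv c t)%C) a b.

Definition C1_real (f : R -> R) : Prop :=
  forall t, ex_derive f t /\ continuous (Derive f) t.

(* Every function that is C^1 on a segment, one-sided derivatives included,
   extends to a C^1 function on R; this expresses C^1 on [s i, s (i+1)]. *)
Definition piecewise_C1 (c : R -> C) : Prop :=
  exists (n : nat) (s : nat -> R),
    s O = 0 /\ s n = 1 /\
    forall i, (i < n)%nat ->
      s i < s (S i) /\
      exists g : R -> C,
        C1_real (fun t => Re (g t)) /\ C1_real (fun t => Im (g t)) /\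
        forall t, s i <= t <= s (S i) -> c t = g t.

(* Closed curves are parametrized by [0, 1]; values of [c] outside [0, 1] are
   irrelevant. *)
Definition closed_curve (c : R -> C) : Prop := piecewise_C1 c /\ c 0 = c 1.

Definition on_curve (c : R -> C) (z : C) : Prop :=
  exists t, 0 <= t <= 1 /\ c t = z.

(* [z] and [w] lie in the same component of the complement of the curve; the
   complement is open, so its components are its path components. *)
Definition same_component (c : R -> C) (z w : C) : Prop :=
  exists u : R -> C,
    u 0 = z /\ u 1 = w /\
    forall t, 0 <= t <= 1 -> continuous u t /\ ~ on_curve c (u t).

Definition inside (c : R -> C) (z : C) : Prop :=
  ~ on_curve c z /\ exists M : R, forall w, same_component c z w -> Cmod w <= M.

Definition outside (c : R -> C) (z : C) : Prop :=
  ~ on_curve c z /\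
  forall M : R, exists w, same_component c z w /\ M < Cmod w.

Definition winding_number (c : R -> C) (z : C) : C :=
  (/ (2 * PI * Ci) * contour_int (fun w => / (w - z)) c 0 1)%C.

(* A simple closed curve run anticlockwise satisfies this; simplicity is not
   imposed in addition. *)
Definition anticlockwise (c : R -> C) : Prop :=
  forall z, inside c z -> winding_number c z = RtoC 1.

(* * Faddeev's quantum dilogarithm *)

Definition faddeev_integrand (gam : R) (zeta z : C) : C :=
  (Cexp (zeta * z) / (Csinh (PI * z) * Csinh (gam * z) * z))%C.

Definition Upsilon (rho t : R) : C := (rho * Cexp (Ci * (PI - t)))%C.

(* Integral over ]-oo, -rho] + Upsilon_rho + [rho, +oo[. *)
Definition faddeev_integral (rho gam : R) (zeta : C) : C :=
  (RInt_gen (V := C_R_CompleteNormedModule)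
     (fun x => faddeev_integrand gam zeta (RtoC x))
     (Rbar_locally m_infty) (at_point (- rho)%R)
   + contour_int (faddeev_integrand gam zeta) (Upsilon rho) 0 PI
   + RInt_gen (V := C_R_CompleteNormedModule)
       (fun x => faddeev_integrand gam zeta (RtoC x))
       (at_point rho) (Rbar_locally p_infty))%C.

(* The value in the strip |Re zeta| < PI + gam. *)
Definition S_strip (rho gam : R) (zeta : C) : C :=
  Cexp (/ 4 * faddeev_integral rho gam zeta)%C.

(* [(1 + e^(i w)) S (w + gam) = S (w - gam)], used with [w = zeta - gam] to the
   right of the strip and [w = zeta + gam] to its left, at most [n] times. *)
Fixpoint S_extend (rho gam : R) (n : nat) (zeta : C) : C :=
  match n with
  | O => S_strip rho gam zeta
  | S n' =>
      if Rle_dec (PI + gam) (Re zeta) then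
        (S_extend rho gam n' (zeta - 2 * gam)
         / (1 + Cexp (Ci * (zeta - gam))))%C
      else if Rle_dec (Re zeta) (- (PI + gam)) then
        ((1 + Cexp (Ci * (zeta + gam)))
         * S_extend rho gam n' (zeta + 2 * gam))%C
      else S_strip rho gam zeta
  end.

(* The number of steps allowed exceeds |Re zeta| / (2 gam), which suffices to
   reach the strip for [0 < gam].
   The poles of the meromorphic function S lie to the right of the strip, where
   one of the divisors vanishes; as [/ 0 = 0] in [C], [S_gamma] is 0 there and
   [/ S_gamma] takes its correct value, the zero of the meromorphic 1/S. *)
Definition S_gamma (rho gam : R) (zeta : C) : C :=
  S_extend rho gam (Z.abs_nat (up (Rabs (Re zeta) / (2 * gam)))) zeta.

(* * Dedekind sums *)

Definition sawtooth (x : R) : R :=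
  if Req_EM_T (frac_part x) 0 then 0 else frac_part x - / 2.

Definition dedekind_sum (p q : Z) : R :=
  sum_n_m (G := R_AbelianMonoid)
    (fun k => sawtooth (INR k / IZR q) * sawtooth (IZR p * INR k / IZR q))
    1 (Z.abs_nat q - 1).

Definition dedekind_symbol (p q : Z) : R :=
  12 * IZR (Z.sgn q) * dedekind_sum p (Z.abs q).

(* * Quantum invariants of p/q surgery on the figure 8 knot *)

Definition xi (r : nat) : C := Cexp (2 * PI * Ci / INR r)%C.

(* The exponents [k - l] are nonnegative, as [l <= m <= k - 1]. *)
Definition J' (r k : nat) : C :=
  Csum (fun m =>
      / (xi r ^ (m * k))
      * Cprod (fun l => (1 - xi r ^ (k - l)) * (1 - xi r ^ (k + l))) m)%C
    0 (k - 1).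

(* exp(-3 pi i/4 sign(pq)) exp(pi i/(2r) [3 sign(pq) - p/q + S(p/q)]) *)
Definition framing_phase (p q : Z) (r : nat) : C :=
  (Cexp (- (3 * PI * Ci / 4) * IZR (Z.sgn (p * q)))
   * Cexp (PI * Ci / (2 * INR r)
           * (3 * IZR (Z.sgn (p * q)) - IZR p / IZR q
              + dedekind_symbol p q)))%C.

Definition a_coef (p q : Z) (r : nat) : C :=
  (- (2 * IZR (Z.sgn q) / (INR r * sqrt (IZR (Z.abs q))))
   * sin (PI / INR r) * framing_phase p q r)%C.

Definition beta_coef (p q : Z) (r : nat) : C :=
  (Ci * IZR (Z.sgn q) / (INR r * sqrt (IZR (Z.abs q)))
   * framing_phase p q r)%C.

Definition tau_summand (p q d : Z) (r : nat) (n : Z) : C :=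
  (Cexp (2 * PI * Ci * INR r * (IZR d * IZR n ^ 2 / IZR q))
   * Csum (fun k =>
       sin (PI / IZR q * (2 * IZR n * IZR d - INR k / INR r))%R
       * Cexp (PI * Ci * INR r / (2 * IZR q)
               * (IZR p * (INR k / INR r) ^ 2 - 4 * IZR n * (INR k / INR r)))
       * (sin (PI * INR k / INR r) / sin (PI / INR r))%R
       * J' r k)
     1 (r - 1))%C.

(* tau_r(M_(p/q)) through its surgery formula, normalized by
   tau_r(S^3) = sqrt(2/r) sin(pi/r); [d] is an inverse of [p] modulo [q]. The
   summand only depends on [n] modulo [q]. *)
Definition tau (p q d : Z) (r : nat) : C :=
  (a_coef p q r
   * Csum (fun j => tau_summand p q d r (Z.of_nat j)) 0 (Z.abs_nat q - 1))%C.

(* * The integrand and its domain *)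

Definition Omega (r : nat) (w : C) : Prop :=
  - (1 / (4 * INR r)) < Re w < 1 + 1 / (4 * INR r).

Definition f_nr (rho : R) (p q d : Z) (r : nat) (n : Z) (x y : C) : C :=
  (Csin (PI / IZR q * (x - 2 * IZR n * IZR d))
   * Cexp (2 * PI * Ci * INR r
           * (IZR d * IZR n ^ 2 / IZR q + IZR p / (4 * IZR q) * x ^ 2
              - IZR n / IZR q * x - x * y))
   * (S_gamma rho (PI / INR r) (- PI + 2 * PI * (x - y))
      / S_gamma rho (PI / INR r) (- PI + 2 * PI * (x + y))))%C.

Definition contour_x (r : nat) (c : R -> C) : Prop :=
  closed_curve c /\ anticlockwise c /\
  (forall t, 0 <= t <= 1 -> Omega r (c t)) /\
  (forall k, (1 <= k <= r - 1)%nat -> inside c (RtoC (INR k / INR r))) /\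
  outside c (RtoC 0) /\ outside c (RtoC 1).

Definition contour_y (r : nat) (c : R -> C) : Prop :=
  closed_curve c /\ anticlockwise c /\
  (forall t, 0 <= t <= 1 -> Omega r (c t)) /\
  (forall m, (m <= r - 1)%nat -> inside c (RtoC ((INR m + / 2) / INR r))).

(* [nu 0, ..., nu (|q| - 1)] represent the classes of Z/|q|Z. As [f_nr] itself
   is not periodic in [n], sums of it over Z/|q|Z are taken over an arbitrary
   system of representatives. *)
Definition residue_system (q : Z) (nu : nat -> Z) : Prop :=
  forall j, (j < Z.abs_nat q)%nat -> (q | nu j - Z.of_nat j)%Z.

(* Main.v *)
Require Import Defs.
From Stdlib Require Import Lra Lia Psatz Classical List ClassicalEpsilon FinFun.

(** The double integral is computed by residues, first in [y] and then in [x].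

    Write [g = PI / r]. The extension of Faddeev's function by its functional
    equation only multiplies by factors [1 + e^(i w)] to the left of the strip,
    and its inverse only does so to the right of it; hence [S] is holomorphic on
    [Re z < PI + g] and [1 / S] on [- (PI + g) < Re z]. For [x] and
    [y] in [Omega r] the first half-plane contains the argument of the numerator
    in [f_nr x y] and the second that of the denominator, so [f_nr] is holomorphic
    in each variable. In [Omega r] the tangent has its poles
    at [y_m = (m + 1/2) / r], which the second curve winds around once, and
    the inner integral is [- (2 i / r)] times the sum of the [f_nr x y_m]. The
    cotangent has its poles in [Omega r] at [k / r] for [0 <= k <= r]; at
    [k = 0] and [k = r] the sum just found vanishes, because there [S] has a zero
    or [1 / S] does. So the double integral is [4 / r^2] times the sum of
    the [f_nr (k / r) y_m] with [1 <= k < r] ([double_contour_int]).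

    At such a point the two arguments of [S] differ by [2 m + 1] steps [2 g], and
    the functional equation telescopes ([S_gamma_ratio]): the quotient is
    [1 - xi^k] times the product of the [(1 - xi^(k-l)) (1 - xi^(k+l))] for
    [1 <= l <= m]. It is zero as soon as [k <= m], the remaining factor of
    [f_nr] supplies [xi^(- m k)], and the sum over [m] is [J'].

    Two pieces of analysis carry this.

    Residues. Holomorphic means here infinitely differentiable in the complex
    sense. This class is stable under difference quotients
    [(f z - f a) / (z - a)], which on a star-shaped domain are the averages of
    the derivative along the segments from [a]; the same averages give
    primitives. Splitting off one simple zero of the denominator after the other
    then yields the residue theorem for quotients ([residues_simple_zeros]).

    Faddeev's function. On a star-shaped domain the contour can be moved
    to the line [Im z = 1/2], where the integral is [e^(i zeta / 2)] times a
    bilateral Laplace transform, so it is holomorphic in [zeta]. The logarithm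
    of [S (zeta - g) / S (zeta + g)] is such a transform [L] too, and its
    derivative is, up to a constant, the transform of [1 / sinh (PI z)]. Moving the line up by [i], across
    the pole of [1 / sinh (PI z)] at [i], evaluates the latter
    ([laplace_recip_sinh]) and gives [L' (1 + e^(i zeta)) = i e^(i zeta)]. So
    [e^(-L) (1 + e^(i zeta))] is constant, and it tends to 1 as [zeta] tends to
    [i oo] ([Cexp_strip_log]); this is the functional equation in the strip. *)

(** * Complex derivatives *)

Lemma RtoC_m1 : RtoC (-1) = (- RtoC 1)%C.
Proof. apply injective_projections; simpl; ring. Qed.

Lemma RtoC_m1_mult (z : C) : (RtoC (-1) * z = - z)%C.
Proof. rewrite RtoC_m1. ring. Qed.

Lemma Cplus_minus (z h : C) : (z + h - z = h)%C.
Proof. ring. Qed.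

Lemma Cplus_minus_r (z y : C) : (z + (y - z) = y)%C.
Proof. ring. Qed.

Lemma Ceq_epsilon (z w : C) :
  (forall eps, 0 < eps -> Cmod (z - w)%C <= eps) -> z = w.
Proof.
intros H. apply Ceq_minus, Cmod_eq_0.
apply Rle_antisym; [|apply Cmod_ge_0].
apply le_epsilon. intros eps He. rewrite Rplus_0_l. auto.
Qed.

Lemma is_Cderive_iff (f : C -> C) (z l : C) :
  is_derive (K := C_AbsRing) (V := C_NormedModule) f z l <->
  forall eps, 0 < eps -> exists del, 0 < del /\
    forall h, Cmod h < del ->
      Cmod (f (z + h) - f z - l * h)%C <= eps * Cmod h.
Proof.
split.
- intros [_ H] eps Heps.
  destruct (H z (fun P p => p) (mkposreal eps Heps)) as [d Hd].
  exists d; split; [apply cond_pos|]; intros h Hh.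
  assert (Hb : ball (M := AbsRing_UniformSpace C_AbsRing) z d (z + h)%C).
  { change (Cmod (z + h - z)%C < d). now rewrite Cplus_minus. }
  specialize (Hd _ Hb). simpl in Hd.
  change (Cmod (f (z + h) - f z - (z + h - z) * l)%C <= eps * Cmod (z + h - z)%C)
    in Hd.
  rewrite Cplus_minus in Hd.
  now rewrite (Cmult_comm l).
- intros H; split; [apply is_linear_scal_l|].
  intros x Hx. rewrite <- (is_filter_lim_locally_unique _ _ Hx).
  intros eps. destruct (H eps (cond_pos eps)) as (d & Hd & H').
  exists (mkposreal d Hd). intros y Hy. change (Cmod (y - z)%C < d) in Hy.
  specialize (H' (y - z)%C Hy). rewrite Cplus_minus_r in H'.
  change (Cmod (f y - f z - (y - z) * l)%C <= eps * Cmod (y - z)%C).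
  now rewrite (Cmult_comm _ l).
Qed.

Lemma Ccontinuous_iff (f : C -> C) (z : C) :
  continuous f z <->
  forall eps, 0 < eps -> exists del, 0 < del /\
    forall h, Cmod h < del -> Cmod (f (z + h) - f z)%C < eps.
Proof.
split.
- intros H eps Heps.
  assert (He : 0 < eps / 2) by lra.
  assert (Hl : locally (T := AbsRing_UniformSpace C_AbsRing) (f z)
                 (fun y => Cmod (y - f z)%C < eps)).
  { exists (mkposreal eps Heps). intros y Hy. exact Hy. }
  apply locally_C in Hl. apply H in Hl. unfold filtermap in Hl.
  apply locally_C in Hl. destruct Hl as [d Hd].
  exists d; split; [apply cond_pos|]; intros h Hh. apply Hd.
  change (Cmod (z + h - z)%C < d). now rewrite Cplus_minus.
- intros H P HP. apply locally_C in HP. destruct HP as [e He].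
  destruct (H e (cond_pos e)) as (d & Hd & H').
  apply (locally_C z). exists (mkposreal d Hd). intros y Hy.
  change (Cmod (y - z)%C < d) in Hy. apply He.
  specialize (H' _ Hy). now rewrite Cplus_minus_r in H'.
Qed.

Lemma Copen_iff (U : C -> Prop) :
  open U <-> forall z, U z -> exists del, 0 < del /\
    forall h, Cmod h < del -> U (z + h)%C.
Proof.
split.
- intros H z Hz. specialize (H z Hz). apply locally_C in H.
  destruct H as [d Hd]. exists d; split; [apply cond_pos|]; intros h Hh.
  apply Hd. change (Cmod (z + h - z)%C < d).
  now rewrite Cplus_minus.
- intros H z Hz. destruct (H z Hz) as (d & Hd & H').
  apply (locally_C z). exists (mkposreal d Hd). intros y Hy.
  change (Cmod (y - z)%C < d) in Hy.
  rewrite <- (Cplus_minus_r z y). now apply H'.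
Qed.

Lemma locally_Cderive (U : C -> Prop) (z : C) :
  open U -> U z -> locally (T := AbsRing_UniformSpace C_AbsRing) z U.
Proof. intros HU Hz. apply locally_C. now apply HU. Qed.

Notation is_Cderive := (is_derive (K := C_AbsRing) (V := C_NormedModule)).

(** The rules for products and compositions are stated for the normed module that
    an absolute-value ring is over itself, which is not convertible to
    [C_NormedModule]; the two have the same norm, hence the same derivatives. *)
Lemma is_Cderive_AbsRing (f : C -> C) (z l : C) :
  is_derive (K := C_AbsRing) (V := AbsRing_NormedModule C_AbsRing) f z l ->
  is_Cderive f z l.
Proof.
intros [[H1 H2 H3] H4].
split; [split; [exact H1|exact H2|exact H3]|exact H4].
Qed.

Lemma is_Cderive_to_AbsRing (f : C -> C) (z l : C) :
  is_Cderive f z l ->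
  is_derive (K := C_AbsRing) (V := AbsRing_NormedModule C_AbsRing) f z l.
Proof.
intros [[H1 H2 H3] H4].
split; [split; [exact H1|exact H2|exact H3]|exact H4].
Qed.

Lemma is_Cderive_const (c z : C) : is_Cderive (fun _ => c) z (RtoC 0).
Proof. apply (is_derive_const (K := C_AbsRing) (V := C_NormedModule)). Qed.

Lemma is_Cderive_id (z : C) : is_Cderive (fun w => w) z (RtoC 1).
Proof. apply is_Cderive_AbsRing, (is_derive_id (K := C_AbsRing)). Qed.

Lemma is_Cderive_plus (f g : C -> C) (z l m : C) :
  is_Cderive f z l -> is_Cderive g z m ->
  is_Cderive (fun w => f w + g w)%C z (l + m)%C.
Proof. apply (is_derive_plus (K := C_AbsRing) (V := C_NormedModule)). Qed.

Lemma is_Cderive_mult (f g : C -> C) (z l m : C) :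
  is_Cderive f z l -> is_Cderive g z m ->
  is_Cderive (fun w => f w * g w)%C z (l * g z + f z * m)%C.
Proof.
intros Hf Hg. apply is_Cderive_AbsRing.
apply (is_derive_mult (K := C_AbsRing)); try now apply is_Cderive_to_AbsRing.
intros; apply Cmult_comm.
Qed.

Lemma is_Cderive_comp (f g : C -> C) (z l m : C) :
  is_Cderive f (g z) l -> is_Cderive g z m ->
  is_Cderive (fun w => f (g w)) z (l * m)%C.
Proof.
intros Hf Hg. rewrite Cmult_comm.
apply (is_derive_comp (K := C_AbsRing) (V := C_NormedModule) f g); trivial.
now apply is_Cderive_to_AbsRing.
Qed.

Lemma is_Cderive_scal (k : C) (f : C -> C) (z l : C) :
  is_Cderive f z l -> is_Cderive (fun w => k * f w)%C z (k * l)%C.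
Proof.
intros H. replace (k * l)%C with (RtoC 0 * f z + k * l)%C by ring.
apply (is_Cderive_mult (fun _ => k)); [apply is_Cderive_const|trivial].
Qed.

Lemma is_Cderive_linear (a z : C) : is_Cderive (fun w => a * w)%C z a.
Proof.
assert (H := is_Cderive_scal a _ _ _ (is_Cderive_id z)). now rewrite Cmult_1_r in H.
Qed.

Lemma is_Cderive_comp_linear (f : C -> C) (a z l : C) :
  is_Cderive f (a * z)%C l -> is_Cderive (fun w => f (a * w))%C z (l * a)%C.
Proof. intros H. apply (is_Cderive_comp f); [trivial|apply is_Cderive_linear]. Qed.

Lemma is_Cderive_sub_const (a z : C) : is_Cderive (fun w => w - a)%C z (RtoC 1).
Proof.
replace (RtoC 1) with (RtoC 1 + RtoC 0)%C by ring.
apply (is_Cderive_plus (fun w => w) (fun _ => - a)%C);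
  [apply is_Cderive_id|apply is_Cderive_const].
Qed.

Lemma is_Cderive_continuous (f : C -> C) (z l : C) :
  is_Cderive f z l -> continuous f z.
Proof.
intros H. apply Ccontinuous_iff. intros eps Heps.
destruct (proj1 (is_Cderive_iff f z l) H 1 Rlt_0_1) as (d & Hd & Hf).
assert (Hc : 0 < eps / (2 + Cmod l)).
{ apply Rdiv_lt_0_compat; [lra|]. generalize (Cmod_ge_0 l); lra. }
exists (Rmin d (eps / (2 + Cmod l))); split; [now apply Rmin_pos|].
intros h Hh. specialize (Hf h (Rlt_le_trans _ _ _ Hh (Rmin_l _ _))).
replace (f (z + h) - f z)%C with ((f (z + h) - f z - l * h) + l * h)%C by ring.
apply Rle_lt_trans with (1 := Cmod_triangle _ _). rewrite Cmod_mult.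
assert (Hh' := Rlt_le_trans _ _ _ Hh (Rmin_r _ _)).
apply (Rmult_lt_compat_r (2 + Cmod l)) in Hh'.
2: generalize (Cmod_ge_0 l); lra.
unfold Rdiv in Hh'. rewrite Rmult_assoc, Rinv_l, Rmult_1_r in Hh'.
2: generalize (Cmod_ge_0 l); lra.
generalize (Cmod_ge_0 h); lra.
Qed.

Lemma Cinv_0 : (/ RtoC 0)%C = RtoC 0.
Proof.
unfold Cinv, RtoC; simpl. unfold Rdiv. rewrite Ropp_0, !Rmult_0_l. reflexivity.
Qed.

Lemma Ccontinuous_neq_0 (f : C -> C) (z : C) :
  continuous f z -> f z <> RtoC 0 ->
  exists del, 0 < del /\
    forall h, Cmod h < del -> Cmod (f z) / 2 <= Cmod (f (z + h)%C).
Proof.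
intros H Hz. apply Cmod_gt_0 in Hz.
destruct (proj1 (Ccontinuous_iff f z) H (Cmod (f z) / 2)) as (d & Hd & Hf).
{ lra. }
exists d; split; trivial. intros h Hh. specialize (Hf h Hh).
assert (Ht : Cmod (f z) <= Cmod (f (z + h)%C) + Cmod (f (z + h) - f z)%C).
{ rewrite <- (Cmod_opp (f (z + h) - f z)%C).
  replace (f z) with (f (z + h) + - (f (z + h) - f z))%C at 1 by ring.
  apply Cmod_triangle. }
lra.
Qed.

Lemma is_Cderive_Cinv (z : C) :
  z <> RtoC 0 -> is_Cderive Cinv z (- / (z * z))%C.
Proof.
intros Hz. apply is_Cderive_iff. intros eps Heps.
assert (Hm := proj1 (Cmod_gt_0 z) Hz).
destruct (Ccontinuous_neq_0 (fun w => w) z) as (d & Hd & Hlow); trivial.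
{ apply (is_Cderive_continuous _ _ _ (is_Cderive_id z)). }
set (m := Cmod z) in *.
assert (Hc : 0 < eps * m ^ 3 / 2).
{ assert (0 < m ^ 3) by now apply pow_lt. nra. }
exists (Rmin d (eps * m ^ 3 / 2)); split; [now apply Rmin_pos|].
intros h Hh. specialize (Hlow h (Rlt_le_trans _ _ _ Hh (Rmin_l _ _))).
assert (Hh' := Rlt_le_trans _ _ _ Hh (Rmin_r _ _)).
assert (Hzh : (z + h)%C <> RtoC 0) by (apply Cmod_gt_0; lra).
replace (/ (z + h) - / z - - / (z * z) * h)%C with (h * h / (z * z * (z + h)))%C
  by (field; auto).
rewrite Cmod_div, !Cmod_mult by (repeat apply Cmult_neq_0; trivial).
fold m. set (n := Cmod (z + h)) in *. assert (0 <= Cmod h) by apply Cmod_ge_0.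
set (k := Cmod h) in *.
apply Rmult_le_reg_r with (m * m * n); [apply Rmult_lt_0_compat; nra|].
unfold Rdiv. rewrite Rmult_assoc, Rinv_l by (apply Rgt_not_eq; apply Rmult_lt_0_compat; nra).
rewrite Rmult_1_r.
assert (k <= eps * (m * m * n)).
{ assert (m * m * (m / 2) <= m * m * n) by (apply Rmult_le_compat_l; nra).
  simpl in Hh'. nra. }
nra.
Qed.

Lemma is_Cderive_inv (f : C -> C) (z l : C) :
  is_Cderive f z l -> f z <> RtoC 0 ->
  is_Cderive (fun w => / f w)%C z (- l * (/ f z * / f z))%C.
Proof.
intros H Hz. replace (- l * (/ f z * / f z))%C with (- / (f z * f z) * l)%C.
2: now field.
apply (is_Cderive_comp Cinv f); trivial. now apply is_Cderive_Cinv.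
Qed.

Lemma is_Cderive_ext_on (U : C -> Prop) (f g : C -> C) (z l : C) :
  open U -> (forall w, U w -> f w = g w) -> U z ->
  is_Cderive f z l -> is_Cderive g z l.
Proof.
intros HU He Hz. apply is_derive_ext_loc.
apply (filter_imp U); [exact He|]. now apply locally_Cderive.
Qed.

(** * Infinitely differentiable functions of a complex variable *)

(** Levels of differentiability make the closure properties provable by
    induction; at level 0 there is nothing to prove, not even continuity. *)
Fixpoint holomorphic_upto (n : nat) (U : C -> Prop) (f : C -> C) : Prop :=
  match n with
  | O => True
  | S m => (forall z, U z -> is_Cderive f z (C_derive f z)) /\
           holomorphic_upto m U (C_derive f)
  end.

Definition holomorphic (U : C -> Prop) (f : C -> C) : Prop :=
  forall n, holomorphic_upto n U f.

Lemma holomorphic_upto_ext n (U : C -> Prop) f g :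
  open U -> (forall z, U z -> f z = g z) ->
  holomorphic_upto n U f -> holomorphic_upto n U g.
Proof.
intros HU. revert f g. induction n as [|n IH]; simpl; trivial.
intros f g He [Hd Hn].
assert (Hg : forall z, U z -> is_Cderive g z (C_derive f z)).
{ intros z Hz. apply (is_Cderive_ext_on U f); auto. }
assert (Hc : forall z, U z -> C_derive g z = C_derive f z).
{ intros z Hz. apply is_C_derive_unique. auto. }
split.
- intros z Hz. rewrite Hc by trivial. auto.
- apply IH with (2 := Hn). intros z Hz. symmetry; auto.
Qed.

Lemma holomorphic_upto_S n (U : C -> Prop) f f' :
  open U -> (forall z, U z -> is_Cderive f z (f' z)) ->
  holomorphic_upto n U f' -> holomorphic_upto (S n) U f.
Proof.
intros HU Hd Hn.
assert (Hc : forall z, U z -> C_derive f z = f' z).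
{ intros z Hz. apply is_C_derive_unique. auto. }
split.
- intros z Hz. rewrite Hc by trivial. auto.
- apply holomorphic_upto_ext with (3 := Hn); trivial.
  intros z Hz. symmetry; auto.
Qed.

Lemma holomorphic_upto_pred n U f :
  holomorphic_upto (S n) U f -> holomorphic_upto n U f.
Proof.
revert f. induction n as [|n IH]; intros f; [easy|].
intros [Hd H]. split; [exact Hd|]. apply IH, H.
Qed.

Lemma holomorphic_ext (U : C -> Prop) f g :
  open U -> (forall z, U z -> f z = g z) ->
  holomorphic U f -> holomorphic U g.
Proof. intros HU He H n. now apply (holomorphic_upto_ext n U f). Qed.

Lemma holomorphic_subset (U V : C -> Prop) f :
  (forall z, V z -> U z) -> holomorphic U f -> holomorphic V f.
Proof.
intros HUV H n. generalize (H n). clear H. revert f.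
induction n as [|n IH]; simpl; trivial. intros f [Hd Hn]. split; auto.
Qed.

Lemma holomorphic_Union (I : Type) (U : I -> C -> Prop) f :
  (forall i, holomorphic (U i) f) -> holomorphic (fun z => exists i, U i z) f.
Proof.
intros H n. assert (Hn : forall i, holomorphic_upto n (U i) f) by (intros i; apply H).
clear H. revert f Hn. induction n as [|n IH]; simpl; trivial. intros f Hn. split.
- intros z [i Hz]. exact (proj1 (Hn i) z Hz).
- apply IH. intros i. apply Hn.
Qed.

Lemma holomorphic_is_derive (U : C -> Prop) f z :
  holomorphic U f -> U z -> is_Cderive f z (C_derive f z).
Proof. intros H Hz. now apply (proj1 (H 1%nat)). Qed.

Lemma holomorphic_derive (U : C -> Prop) f :
  holomorphic U f -> holomorphic U (C_derive f).
Proof. intros H n. apply (proj2 (H (S n))). Qed.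

Lemma holomorphic_continuous (U : C -> Prop) f z :
  holomorphic U f -> U z -> continuous f z.
Proof.
intros H Hz. apply (is_Cderive_continuous _ _ (C_derive f z)).
now apply (holomorphic_is_derive U).
Qed.

Lemma holomorphic_const (U : C -> Prop) c : open U -> holomorphic U (fun _ => c).
Proof.
intros HU n. revert c. induction n as [|n IH]; intros c; [easy|].
apply holomorphic_upto_S with (fun _ => RtoC 0); auto.
intros; apply is_Cderive_const.
Qed.

Lemma holomorphic_id (U : C -> Prop) : open U -> holomorphic U (fun z => z).
Proof.
intros HU [|n]; [easy|].
apply holomorphic_upto_S with (fun _ => RtoC 1); trivial.
- intros; apply is_Cderive_id.
- now apply holomorphic_const.
Qed.

Lemma holomorphic_upto_plus n (U : C -> Prop) f g :
  open U -> holomorphic_upto n U f -> holomorphic_upto n U g ->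
  holomorphic_upto n U (fun z => f z + g z)%C.
Proof.
intros HU. revert f g. induction n as [|n IH]; intros f g; [easy|].
intros [Hf Hf'] [Hg Hg'].
apply holomorphic_upto_S with (fun z => C_derive f z + C_derive g z)%C; auto.
intros z Hz. apply is_Cderive_plus; auto.
Qed.

Lemma holomorphic_upto_mult n (U : C -> Prop) f g :
  open U -> holomorphic_upto n U f -> holomorphic_upto n U g ->
  holomorphic_upto n U (fun z => f z * g z)%C.
Proof.
intros HU. revert f g. induction n as [|n IH]; intros f g; [easy|].
intros Hf Hg.
apply holomorphic_upto_S
  with (fun z => C_derive f z * g z + f z * C_derive g z)%C; trivial.
- intros z Hz. apply is_Cderive_mult; [apply Hf|apply Hg]; trivial.
- apply holomorphic_upto_plus; trivial; apply IH;
    (apply Hf || apply Hg || now apply holomorphic_upto_pred).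
Qed.

Lemma holomorphic_upto_inv n (U : C -> Prop) f :
  open U -> (forall z, U z -> f z <> RtoC 0) -> holomorphic_upto n U f ->
  holomorphic_upto n U (fun z => / f z)%C.
Proof.
intros HU Hf0. induction n as [|n IH]; [easy|].
intros Hf.
apply holomorphic_upto_S
  with (fun z => (RtoC (-1) * C_derive f z) * (/ f z * / f z))%C; trivial.
- intros z Hz. replace (RtoC (-1) * C_derive f z)%C with (- C_derive f z)%C.
  2: now rewrite RtoC_m1_mult.
  apply is_Cderive_inv; auto. now apply Hf.
- apply holomorphic_upto_pred in Hf as Hf'. destruct Hf as [_ Hf].
  repeat apply holomorphic_upto_mult; auto.
  now apply holomorphic_const.
Qed.

Lemma holomorphic_upto_comp n (U V : C -> Prop) f g :
  open U -> open V -> (forall z, U z -> V (g z)) ->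
  holomorphic_upto n V f -> holomorphic_upto n U g ->
  holomorphic_upto n U (fun z => f (g z)).
Proof.
intros HU HV Hm. revert f. induction n as [|n IH]; intros f; [easy|].
intros Hf Hg.
apply holomorphic_upto_S with (fun z => C_derive f (g z) * C_derive g z)%C;
  trivial.
- intros z Hz. apply (is_Cderive_comp f g); [apply Hf|apply Hg]; auto.
- apply holomorphic_upto_mult; trivial; [|apply Hg].
  apply IH; [apply Hf|]. now apply holomorphic_upto_pred.
Qed.

Lemma holomorphic_plus (U : C -> Prop) f g :
  open U -> holomorphic U f -> holomorphic U g ->
  holomorphic U (fun z => f z + g z)%C.
Proof. intros HU Hf Hg n. now apply holomorphic_upto_plus. Qed.

Lemma holomorphic_mult (U : C -> Prop) f g :
  open U -> holomorphic U f -> holomorphic U g ->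
  holomorphic U (fun z => f z * g z)%C.
Proof. intros HU Hf Hg n. now apply holomorphic_upto_mult. Qed.

Lemma holomorphic_opp (U : C -> Prop) f :
  open U -> holomorphic U f -> holomorphic U (fun z => - f z)%C.
Proof.
intros HU Hf. apply holomorphic_ext with (fun z => RtoC (-1) * f z)%C; trivial.
- intros z _. apply RtoC_m1_mult.
- apply holomorphic_mult; trivial. now apply holomorphic_const.
Qed.

Lemma holomorphic_minus (U : C -> Prop) f g :
  open U -> holomorphic U f -> holomorphic U g ->
  holomorphic U (fun z => f z - g z)%C.
Proof. intros HU Hf Hg. apply holomorphic_plus; trivial. now apply holomorphic_opp. Qed.

Lemma holomorphic_inv (U : C -> Prop) f :
  open U -> (forall z, U z -> f z <> RtoC 0) -> holomorphic U f ->
  holomorphic U (fun z => / f z)%C.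
Proof. intros HU H0 Hf n. now apply holomorphic_upto_inv. Qed.

Lemma holomorphic_div (U : C -> Prop) f g :
  open U -> (forall z, U z -> g z <> RtoC 0) ->
  holomorphic U f -> holomorphic U g ->
  holomorphic U (fun z => f z / g z)%C.
Proof. intros HU H0 Hf Hg. apply holomorphic_mult; trivial. now apply holomorphic_inv. Qed.

Lemma holomorphic_comp (U V : C -> Prop) f g :
  open U -> open V -> (forall z, U z -> V (g z)) ->
  holomorphic V f -> holomorphic U g -> holomorphic U (fun z => f (g z)).
Proof. intros HU HV Hm Hf Hg n. now apply (holomorphic_upto_comp n U V). Qed.

(** * Integrals of complex functions of a real variable *)

Notation is_Rderive := (is_derive (K := R_AbsRing) (V := C_R_NormedModule)).
Notation is_CInt := (is_RInt (V := C_R_NormedModule)).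
Definition CInt (f : R -> C) (a b : R) : C :=
  RInt (V := C_R_CompleteNormedModule) f a b.
Notation Rcontinuous := (continuous (T := R_UniformSpace) (U := C_UniformSpace)).

Lemma is_Rderive_iff (c : R -> C) (t : R) (l : C) :
  is_Rderive c t l <->
  forall eps, 0 < eps -> exists del, 0 < del /\
    forall h, Rabs h < del ->
      Cmod (c (t + h)%R - c t - h * l)%C <= eps * Rabs h.
Proof.
split.
- intros [_ H] eps Heps.
  destruct (H t (fun P p => p) (mkposreal eps Heps)) as [d Hd].
  exists d; split; [apply cond_pos|]; intros h Hh.
  assert (E : t + h - t = h) by ring.
  assert (Hb : ball (M := R_UniformSpace) t d (t + h)).
  { change (Rabs (t + h - t) < d). now rewrite E. }
  specialize (Hd _ Hb). rewrite <- Cmod_norm in Hd.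
  change (norm (minus (t + h) t)) with (Rabs (t + h - t)) in Hd.
  change (minus (t + h) t) with (t + h - t) in Hd. rewrite E in Hd.
  apply Rle_trans with (2 := Hd). apply Req_le, f_equal.
  apply injective_projections; simpl; unfold scal, plus, opp; simpl;
  unfold mult; simpl; ring.
- intros H; split; [apply is_linear_scal_l|].
  intros x Hx. rewrite <- (is_filter_lim_locally_unique _ _ Hx).
  intros eps. destruct (H eps (cond_pos eps)) as (d & Hd & H').
  exists (mkposreal d Hd). intros y Hy. change (Rabs (y - t) < d) in Hy.
  specialize (H' (y - t) Hy).
  rewrite Rplus_minus in H'.
  rewrite <- Cmod_norm.
  change (norm (minus y t)) with (Rabs (y - t)).
  apply Rle_trans with (2 := H'). apply Req_le, f_equal.
  apply injective_projections; simpl; unfold minus, scal, plus, opp; simpl;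
  unfold mult; simpl; ring.
Qed.

Lemma Cmod_le_Re_Im (z : C) : Cmod z <= Rabs (Re z) + Rabs (Im z).
Proof.
replace z with (RtoC (Re z) + Ci * RtoC (Im z))%C at 1.
- apply Rle_trans with (1 := Cmod_triangle _ _).
  rewrite Cmod_mult, Cmod_Ci, !Cmod_R. lra.
- destruct z as [x y]. apply injective_projections; simpl; ring.
Qed.

Lemma is_Rderive_pair (c : R -> C) (t a b : R) :
  is_derive (fun s => Re (c s)) t a -> is_derive (fun s => Im (c s)) t b ->
  is_Rderive c t (a, b).
Proof.
intros [_ Ha] [_ Hb]. apply is_Rderive_iff. intros eps Heps.
assert (He : 0 < eps / 2) by lra.
destruct (Ha t (fun P p => p) (mkposreal _ He)) as [d1 H1].
destruct (Hb t (fun P p => p) (mkposreal _ He)) as [d2 H2].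
exists (Rmin d1 d2); split; [apply Rmin_pos; apply cond_pos|].
intros h Hh.
assert (E : t + h - t = h) by ring.
assert (Hb1 : ball (M := R_UniformSpace) t d1 (t + h)).
{ change (Rabs (t + h - t) < d1). rewrite E.
  apply Rlt_le_trans with (1 := Hh), Rmin_l. }
assert (Hb2 : ball (M := R_UniformSpace) t d2 (t + h)).
{ change (Rabs (t + h - t) < d2). rewrite E.
  apply Rlt_le_trans with (1 := Hh), Rmin_r. }
specialize (H1 _ Hb1). specialize (H2 _ Hb2).
change (Rabs (Re (c (t + h)) - Re (c t) - (t + h - t) * a)
        <= eps / 2 * Rabs (t + h - t)) in H1.
change (Rabs (Im (c (t + h)) - Im (c t) - (t + h - t) * b)
        <= eps / 2 * Rabs (t + h - t)) in H2.
rewrite E in H1, H2.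
apply Rle_trans with (1 := Cmod_le_Re_Im _). simpl.
unfold Re, Im in *.
replace (fst (c (t + h)) + - fst (c t) + - (h * a - 0 * b))
  with (fst (c (t + h)) - fst (c t) - h * a) by ring.
replace (snd (c (t + h)) + - snd (c t) + - (h * b + 0 * a))
  with (snd (c (t + h)) - snd (c t) - h * b) by ring.
lra.
Qed.

Lemma is_Rderive_comp (f : C -> C) (c : R -> C) (t : R) (l m : C) :
  is_Cderive f (c t) l -> is_Rderive c t m ->
  is_Rderive (fun s => f (c s)) t (l * m)%C.
Proof.
intros Hf Hc. apply is_Rderive_iff. intros eps Heps.
set (M := 1 + Cmod l + Cmod m).
assert (HM : 1 <= M).
{ unfold M. generalize (Cmod_ge_0 l) (Cmod_ge_0 m). lra. }
set (e := Rmin 1 (eps / (3 * M))).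
assert (He : 0 < e).
{ apply Rmin_pos; [lra|]. apply Rdiv_lt_0_compat; lra. }
assert (He1 : e <= 1) by apply Rmin_l.
assert (HeM : e * (3 * M) <= eps).
{ apply Rle_trans with (eps / (3 * M) * (3 * M)).
  - apply Rmult_le_compat_r; [lra|apply Rmin_r].
  - apply Req_le. field. lra. }
destruct (proj1 (is_Cderive_iff f _ l) Hf e He) as (d1 & Hd1 & H1).
destruct (proj1 (is_Rderive_iff c t m) Hc e He) as (d2 & Hd2 & H2).
exists (Rmin d2 (d1 / (2 * M))); split.
{ apply Rmin_pos; trivial. apply Rdiv_lt_0_compat; lra. }
intros h Hh.
assert (Hh1 := Rlt_le_trans _ _ _ Hh (Rmin_l _ _)).
assert (Hh2 := Rlt_le_trans _ _ _ Hh (Rmin_r _ _)).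
specialize (H2 h Hh1).
set (k := (c (t + h)%R - c t)%C) in *.
assert (Hk : Cmod k <= 2 * M * Rabs h).
{ replace k with ((k - h * m) + h * m)%C by ring.
  apply Rle_trans with (1 := Cmod_triangle _ _).
  rewrite Cmod_mult, Cmod_R.
  assert (Cmod m <= M) by (unfold M; generalize (Cmod_ge_0 l); lra).
  generalize (Rabs_pos h). nra. }
assert (Hkd : Cmod k < d1).
{ apply Rle_lt_trans with (1 := Hk).
  apply (Rmult_lt_compat_l (2 * M)) in Hh2; [|lra].
  replace (2 * M * (d1 / (2 * M))) with d1 in Hh2 by (field; lra). exact Hh2. }
specialize (H1 k Hkd).
replace (c t + k)%C with (c (t + h)%R) in H1 by (unfold k; ring).
replace (f (c (t + h)%R) - f (c t) - h * (l * m))%C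
  with ((f (c (t + h)%R) - f (c t) - l * k) + l * (k - h * m))%C by ring.
apply Rle_trans with (1 := Cmod_triangle _ _). rewrite Cmod_mult.
assert (Cmod l <= M) by (unfold M; generalize (Cmod_ge_0 m); lra).
assert (Cmod l * Cmod (k - h * m) <= M * (e * Rabs h)).
{ apply Rmult_le_compat; trivial; apply Cmod_ge_0. }
assert (e * Cmod k <= e * (2 * M * Rabs h)) by (apply Rmult_le_compat_l; lra).
generalize (Rabs_pos h). nra.
Qed.

Lemma Rcontinuous_pair (f : R -> C) (t : R) :
  continuous (fun s => Re (f s)) t -> continuous (fun s => Im (f s)) t ->
  Rcontinuous f t.
Proof.
intros H1 H2. apply (filterlim_ext (fun s => (Re (f s), Im (f s)))).
{ intros s. now destruct (f s). }
assert (H := filterlim_pair _ _ H1 H2).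
intros P [d Hd]. apply H.
exists (ball (Re (f t)) d) (ball (Im (f t)) d).
- now exists d.
- now exists d.
- intros u v Hu Hv. apply Hd. now split.
Qed.

Lemma continuous_Re (f : R -> C) (t : R) :
  Rcontinuous f t -> continuous (fun s => Re (f s)) t.
Proof.
intros H. apply (continuous_comp f (fun z : C => Re z)); trivial.
destruct (f t) as [x y]. apply (continuous_fst (U := R_UniformSpace) (V := R_UniformSpace)).
Qed.

Lemma continuous_Im (f : R -> C) (t : R) :
  Rcontinuous f t -> continuous (fun s => Im (f s)) t.
Proof.
intros H. apply (continuous_comp f (fun z : C => Im z)); trivial.
destruct (f t) as [x y]. apply (continuous_snd (U := R_UniformSpace) (V := R_UniformSpace)).
Qed.

Lemma Rcontinuous_mult (f g : R -> C) (t : R) :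
  Rcontinuous f t -> Rcontinuous g t -> Rcontinuous (fun s => f s * g s)%C t.
Proof.
intros Hf Hg.
assert (Hf1 := continuous_Re f t Hf). assert (Hf2 := continuous_Im f t Hf).
assert (Hg1 := continuous_Re g t Hg). assert (Hg2 := continuous_Im g t Hg).
apply Rcontinuous_pair.
- apply (continuous_minus (V := R_NormedModule)
   (fun s => Re (f s) * Re (g s)) (fun s => Im (f s) * Im (g s)));
  apply (continuous_mult (K := R_AbsRing)); trivial.
- apply (continuous_plus (V := R_NormedModule)
   (fun s => Re (f s) * Im (g s)) (fun s => Im (f s) * Re (g s)));
  apply (continuous_mult (K := R_AbsRing)); trivial.
Qed.

Lemma Rcontinuous_plus (f g : R -> C) (t : R) :
  Rcontinuous f t -> Rcontinuous g t -> Rcontinuous (fun s => f s + g s)%C t.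
Proof. apply (continuous_plus (V := C_R_NormedModule)). Qed.

Lemma Rcontinuous_minus (f g : R -> C) (t : R) :
  Rcontinuous f t -> Rcontinuous g t -> Rcontinuous (fun s => f s - g s)%C t.
Proof. apply (continuous_minus (V := C_R_NormedModule)). Qed.

Lemma Rcontinuous_const (c : C) (t : R) : Rcontinuous (fun _ => c) t.
Proof. apply continuous_const. Qed.

Lemma Rcontinuous_RtoC (f : R -> R) (t : R) :
  continuous f t -> Rcontinuous (fun s => RtoC (f s)) t.
Proof.
intros H. apply Rcontinuous_pair; [exact H|apply continuous_const].
Qed.

Lemma Rcontinuous_comp (f : C -> C) (c : R -> C) (t : R) :
  continuous f (c t) -> Rcontinuous c t -> Rcontinuous (fun s => f (c s)) t.
Proof. intros Hf Hc. now apply continuous_comp. Qed.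

Lemma is_CInt_Cmult (k : C) (f : R -> C) (a b : R) (l : C) :
  is_CInt f a b l -> is_CInt (fun t => k * f t)%C a b (k * l)%C.
Proof.
intros H.
assert (H1 := is_RInt_fct_extend_fst (U := R_NormedModule) (V := R_NormedModule) _ _ _ _ H).
assert (H2 := is_RInt_fct_extend_snd (U := R_NormedModule) (V := R_NormedModule) _ _ _ _ H).
apply (is_RInt_fct_extend_pair (U := R_NormedModule) (V := R_NormedModule)); simpl.
- apply (is_RInt_minus (V := R_NormedModule)); now apply (is_RInt_scal (V := R_NormedModule)).
- apply (is_RInt_plus (V := R_NormedModule)); now apply (is_RInt_scal (V := R_NormedModule)).
Qed.

Lemma Cscal_R (x : R) (z : C) :
  scal (V := C_R_NormedModule) x z = (RtoC x * z)%C.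
Proof.
destruct z as [u v]. apply injective_projections; simpl;
  unfold scal; simpl; unfold mult; simpl; ring.
Qed.

Lemma is_CInt_const (c : C) (a b : R) : is_CInt (fun _ => c) a b (RtoC (b - a) * c)%C.
Proof. rewrite <- Cscal_R. apply (is_RInt_const (V := C_R_NormedModule)). Qed.

Lemma is_CInt_plus (f g : R -> C) (a b : R) (l m : C) :
  is_CInt f a b l -> is_CInt g a b m ->
  is_CInt (fun t => f t + g t)%C a b (l + m)%C.
Proof. apply (is_RInt_plus (V := C_R_NormedModule)). Qed.

Lemma is_CInt_minus (f g : R -> C) (a b : R) (l m : C) :
  is_CInt f a b l -> is_CInt g a b m ->
  is_CInt (fun t => f t - g t)%C a b (l - m)%C.
Proof. apply (is_RInt_minus (V := C_R_NormedModule)). Qed.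

Lemma is_CInt_ext (f g : R -> C) (a b : R) (l : C) :
  (forall t, Rmin a b < t < Rmax a b -> f t = g t) ->
  is_CInt f a b l -> is_CInt g a b l.
Proof. apply (is_RInt_ext (V := C_R_NormedModule)). Qed.

Lemma is_CInt_continuous (f : R -> C) (a b : R) :
  (forall t, Rmin a b <= t <= Rmax a b -> Rcontinuous f t) ->
  is_CInt f a b (CInt f a b).
Proof.
intros H. apply (RInt_correct (V := C_R_CompleteNormedModule)).
now apply (ex_RInt_continuous (V := C_R_CompleteNormedModule)).
Qed.

Lemma CInt_unique (f : R -> C) (a b : R) (l : C) :
  is_CInt f a b l -> CInt f a b = l.
Proof. apply (is_RInt_unique (V := C_R_CompleteNormedModule)). Qed.

Lemma Cmod_is_CInt_le (f : R -> C) (g : R -> R) (a b : R) (l : C) (m : R) :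
  a <= b -> (forall t, a <= t <= b -> Cmod (f t) <= g t) ->
  is_CInt f a b l -> is_RInt g a b m -> Cmod l <= m.
Proof.
intros Hab H Hf Hg. rewrite Cmod_norm.
apply (norm_RInt_le (V := C_R_NormedModule) f g a b l m); trivial.
intros x Hx. rewrite <- Cmod_norm. auto.
Qed.

Lemma Cmod_is_CInt_le_const (f : R -> C) (M a b : R) (l : C) :
  a <= b -> (forall t, a <= t <= b -> Cmod (f t) <= M) ->
  is_CInt f a b l -> Cmod l <= (b - a) * M.
Proof.
intros Hab H Hf. apply (Cmod_is_CInt_le f (fun _ => M) a b); trivial.
apply (is_RInt_const (V := R_NormedModule)).
Qed.

Lemma is_CInt_derive (F f : R -> C) (a b : R) :
  (forall t, Rmin a b <= t <= Rmax a b -> is_Rderive F t (f t)) ->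
  (forall t, Rmin a b <= t <= Rmax a b -> Rcontinuous f t) ->
  is_CInt f a b (F b - F a)%C.
Proof. apply (is_RInt_derive (V := C_R_CompleteNormedModule)). Qed.

Lemma is_Rderive_affine (p k : C) (t : R) :
  is_Rderive (fun s => p + RtoC s * k)%C t k.
Proof.
apply is_Rderive_iff. intros eps Heps. exists 1; split; [lra|]. intros h _.
replace (p + RtoC (t + h) * k - (p + RtoC t * k) - RtoC h * k)%C with (RtoC 0).
- rewrite Cmod_0. generalize (Rabs_pos h). nra.
- rewrite RtoC_plus. ring.
Qed.

Lemma is_Rderive_continuous (c : R -> C) (t : R) (l : C) :
  is_Rderive c t l -> Rcontinuous c t.
Proof.
intros H. apply (ex_derive_continuous (V := C_R_NormedModule)). now exists l.
Qed.

Lemma Rcontinuous_affine (p k : C) (t : R) :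
  Rcontinuous (fun s => p + RtoC s * k)%C t.
Proof. apply (is_Rderive_continuous _ _ k), is_Rderive_affine. Qed.

Lemma is_CInt_segment (f f' : C -> C) (p k : C) :
  (forall s, 0 <= s <= 1 -> is_Cderive f (p + RtoC s * k)%C (f' (p + RtoC s * k)%C)) ->
  (forall s, 0 <= s <= 1 -> continuous f' (p + RtoC s * k)%C) ->
  is_CInt (fun s => f' (p + RtoC s * k) * k)%C 0 1 (f (p + k) - f p)%C.
Proof.
intros Hd Hc.
replace (f (p + k) - f p)%C with (f (p + RtoC 1 * k) - f (p + RtoC 0 * k))%C.
2: { now rewrite Cmult_1_l, Cmult_0_l, Cplus_0_r. }
apply (is_CInt_derive (fun s => f (p + RtoC s * k)%C));
rewrite (Rmin_left 0 1), (Rmax_right 0 1) by lra.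
- intros s Hs. apply (is_Rderive_comp f (fun s => p + RtoC s * k)%C).
  + now apply Hd.
  + apply is_Rderive_affine.
- intros s Hs. apply Rcontinuous_mult; [|apply Rcontinuous_const].
  apply (Rcontinuous_comp f' (fun s => p + RtoC s * k)%C); [auto|].
  apply Rcontinuous_affine.
Qed.

(** The remainder is the integral of [(f' (p + s k) - f' p) k]. *)
Lemma Cderive_remainder (f f' : C -> C) (p k : C) (eps : R) :
  (forall s, 0 <= s <= 1 -> is_Cderive f (p + RtoC s * k)%C (f' (p + RtoC s * k)%C)) ->
  (forall s, 0 <= s <= 1 -> continuous f' (p + RtoC s * k)%C) ->
  (forall s, 0 <= s <= 1 -> Cmod (f' (p + RtoC s * k) - f' p)%C <= eps) ->
  Cmod (f (p + k) - f p - f' p * k)%C <= eps * Cmod k.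
Proof.
intros Hd Hc He.
assert (H := is_CInt_segment f f' p k Hd Hc).
assert (H0 := is_CInt_const (f' p * k)%C 0 1).
rewrite Rminus_0_r, Cmult_1_l in H0.
assert (H1 := is_CInt_minus _ _ _ _ _ _ H H0).
replace (eps * Cmod k) with ((1 - 0) * (eps * Cmod k)) by ring.
apply Cmod_is_CInt_le_const with (3 := H1); [lra|].
intros t Ht.
replace (f' (p + RtoC t * k) * k - f' p * k)%C
  with ((f' (p + RtoC t * k) - f' p) * k)%C by ring.
rewrite Cmod_mult. apply Rmult_le_compat_r; [apply Cmod_ge_0|auto].
Qed.

(** * Star-shaped domains, primitives and difference quotients *)

Definition star_shaped (a : C) (U : C -> Prop) : Prop :=
  forall z t, U z -> 0 <= t <= 1 -> U (a + RtoC t * (z - a))%C.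

(** The segment from [a] to [z] is compact: this is uniform continuity on a
    neighbourhood of it, perturbations [k] off the segment being allowed. *)
Lemma ray_uniform (U : C -> Prop) (f : C -> C) (a z : C) :
  open U -> star_shaped a U -> (forall w, U w -> continuous f w) -> U z ->
  forall eps, 0 < eps -> exists del, 0 < del /\
    forall t k, 0 <= t <= 1 -> Cmod k < del ->
      U (a + RtoC t * (z - a) + k)%C /\
      Cmod (f (a + RtoC t * (z - a) + k) - f (a + RtoC t * (z - a)))%C < eps.
Proof.
intros HU Hs Hf Hz eps Heps.
set (p t := (a + RtoC t * (z - a))%C).
(* Within twice this radius of [p t], [f] varies by less than half the tolerance. *)
assert (Hloc : forall t, exists d : posreal, 0 <= t <= 1 ->
  forall k, Cmod k < 2 * d -> U (p t + k)%C /\ Cmod (f (p t + k) - f (p t))%C < eps / 2).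
{ intros t. destruct (Rle_dec 0 t) as [H0|H0].
  2: { exists (mkposreal 1 Rlt_0_1). lra. }
  destruct (Rle_dec t 1) as [H1|H1].
  2: { exists (mkposreal 1 Rlt_0_1). lra. }
  assert (Hp : U (p t)) by now apply Hs.
  destruct (proj1 (Copen_iff U) HU _ Hp) as (d1 & Hd1 & HU1).
  destruct (proj1 (Ccontinuous_iff f _) (Hf _ Hp) (eps / 2)) as (d2 & Hd2 & Hf2).
  { lra. }
  assert (Hd : 0 < Rmin d1 d2 / 2).
  { apply Rdiv_lt_0_compat; [now apply Rmin_pos|lra]. }
  exists (mkposreal _ Hd). intros _ k Hk. simpl in Hk.
  assert (Hk' : Cmod k < Rmin d1 d2) by lra.
  split; [apply HU1|apply Hf2]; apply Rlt_le_trans with (1 := Hk');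
    [apply Rmin_l|apply Rmin_r]. }
set (delta t := proj1_sig (constructive_indefinite_description _ (Hloc t))).
assert (Hdelta : forall t, 0 <= t <= 1 -> forall k, Cmod k < 2 * delta t ->
  U (p t + k)%C /\ Cmod (f (p t + k) - f (p t))%C < eps / 2).
{ intros t. unfold delta.
  exact (proj2_sig (constructive_indefinite_description _ (Hloc t))). }
set (L := 1 + Cmod (z - a)%C).
assert (HL : 1 <= L) by (unfold L; generalize (Cmod_ge_0 (z - a)%C); lra).
assert (HdL : forall t, 0 < delta t / L).
{ intros t. apply Rdiv_lt_0_compat; [apply cond_pos|lra]. }
destruct (compactness_value_1d 0 1 (fun t => mkposreal _ (HdL t))) as [d Hd].
exists d; split; [apply cond_pos|]. intros t k Ht Hk.
apply NNPP. intros Hn. apply (Hd t Ht). intros (u & Hu & Htu & Hdu).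
apply Hn. clear Hn. simpl in Htu, Hdu.
assert (Hdl : delta u / L <= delta u).
{ apply Rmult_le_reg_r with L; [lra|].
  unfold Rdiv. rewrite Rmult_assoc, Rinv_l by lra.
  generalize (cond_pos (delta u)). nra. }
assert (Hw : Cmod (p t - p u)%C < delta u).
{ replace (p t - p u)%C with (RtoC (t - u) * (z - a))%C.
  2: unfold p; rewrite RtoC_minus; ring.
  rewrite Cmod_mult, Cmod_R.
  apply Rle_lt_trans with (Rabs (t - u) * L).
  - apply Rmult_le_compat_l; [apply Rabs_pos|unfold L; lra].
  - apply (Rmult_lt_compat_r L) in Htu; [|lra].
    unfold Rdiv in Htu. rewrite Rmult_assoc, Rinv_l in Htu by lra. lra. }
assert (Hg := cond_pos (delta u)).
destruct (Hdelta u Hu (p t - p u)%C) as [_ H1]; try lra.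
destruct (Hdelta u Hu (p t - p u + k)%C) as [H2 H3].
{ apply Rle_lt_trans with (1 := Cmod_triangle _ _). lra. }
replace (p u + (p t - p u))%C with (p t) in H1 by ring.
replace (p u + (p t - p u + k))%C with (p t + k)%C in H2, H3 by ring.
split; [exact H2|]. change (Cmod (f (p t + k) - f (p t))%C < eps).
replace (f (p t + k) - f (p t))%C
  with ((f (p t + k) - f (p u)) + - (f (p t) - f (p u)))%C by ring.
apply Rle_lt_trans with (1 := Cmod_triangle _ _). rewrite Cmod_opp. lra.
Qed.

(** Differentiating in [z] brings out one more factor [t], so the powers of [t]
    make this family closed under derivation. *)
Definition ray_moment (n : nat) (f : C -> C) (a z : C) : C :=
  CInt (fun t => RtoC (t ^ n) * f (a + RtoC t * (z - a)))%C 0 1.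

Lemma is_CInt_ray_moment n (U : C -> Prop) f a z :
  star_shaped a U -> (forall w, U w -> continuous f w) -> U z ->
  is_CInt (fun t => RtoC (t ^ n) * f (a + RtoC t * (z - a)))%C 0 1
    (ray_moment n f a z).
Proof.
intros Hs Hf Hz. apply is_CInt_continuous.
rewrite Rmin_left, Rmax_right by lra. intros t Ht.
apply Rcontinuous_mult.
- apply (Rcontinuous_RtoC (fun s => s ^ n)).
  apply (ex_derive_continuous (V := R_NormedModule)). auto_derive. trivial.
- apply (Rcontinuous_comp f (fun s => a + RtoC s * (z - a))%C).
  + apply Hf. now apply Hs.
  + apply Rcontinuous_affine.
Qed.

(** Differentiation under the integral sign: [ray_uniform], applied to the
    derivative of [f], bounds the remainder uniformly along the segment. *)
Lemma is_Cderive_ray_moment n (U : C -> Prop) f a z :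
  open U -> star_shaped a U -> holomorphic U f -> U z ->
  is_Cderive (ray_moment n f a) z (ray_moment (S n) (C_derive f) a z).
Proof.
intros HU Hs Hf Hz. apply is_Cderive_iff. intros eps Heps.
assert (Hf' := holomorphic_derive U f Hf).
assert (Cf : forall w, U w -> continuous f w).
{ intros w. now apply holomorphic_continuous. }
assert (Cf' : forall w, U w -> continuous (C_derive f) w).
{ intros w. now apply holomorphic_continuous. }
destruct (ray_uniform U (C_derive f) a z HU Hs Cf' Hz eps Heps) as (d & Hd & H).
exists d; split; trivial. intros h Hh.
assert (Hzh : U (z + h)%C).
{ destruct (H 1 h) as [H1 _]; [lra|trivial|].
  now replace (a + RtoC 1 * (z - a) + h)%C with (z + h)%C in H1 by ring. }
assert (I1 := is_CInt_ray_moment n U f a _ Hs Cf Hzh).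
assert (I2 := is_CInt_ray_moment n U f a _ Hs Cf Hz).
assert (I3 := is_CInt_ray_moment (S n) U _ a _ Hs Cf' Hz).
apply (is_CInt_Cmult h) in I3.
assert (I := is_CInt_minus _ _ _ _ _ _ (is_CInt_minus _ _ _ _ _ _ I1 I2) I3).
rewrite (Cmult_comm _ h).
replace (eps * Cmod h) with ((1 - 0) * (eps * Cmod h)) by ring.
apply Cmod_is_CInt_le_const with (3 := I); [lra|].
intros t Ht. set (p := (a + RtoC t * (z - a))%C).
replace (a + RtoC t * (z + h - a))%C with (p + RtoC t * h)%C by (unfold p; ring).
replace (RtoC (t ^ n) * f (p + RtoC t * h) - RtoC (t ^ n) * f p -
         h * (RtoC (t ^ S n) * C_derive f p))%C
  with (RtoC (t ^ n) * (f (p + RtoC t * h) - f p - C_derive f p * (RtoC t * h)))%C.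
2: { simpl. rewrite RtoC_mult. ring. }
rewrite Cmod_mult, Cmod_R.
assert (Hn : Rabs (t ^ n) <= 1).
{ rewrite Rabs_pos_eq by now apply pow_le.
  rewrite <- (pow1 n). now apply pow_incr. }
assert (Hth : forall s, 0 <= s <= 1 -> Cmod (RtoC s * (RtoC t * h))%C < d).
{ intros s Hs'. rewrite !Cmod_mult, !Cmod_R, !Rabs_pos_eq by lra.
  generalize (Cmod_ge_0 h). intros.
  assert (t * Cmod h <= Cmod h) by nra.
  assert (0 <= t * Cmod h) by nra. nra. }
assert (Hr : Cmod (f (p + RtoC t * h) - f p - C_derive f p * (RtoC t * h))%C
             <= eps * Cmod (RtoC t * h)%C).
{ apply Cderive_remainder.
  - intros s Hs'. apply (holomorphic_is_derive U); trivial. now apply H; [|apply Hth].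
  - intros s Hs'. apply Cf'. now apply H; [|apply Hth].
  - intros s Hs'. apply Rlt_le. now apply H; [|apply Hth]. }
rewrite Cmod_mult, Cmod_R, (Rabs_pos_eq t) in Hr by lra.
apply Rle_trans with (1 * (eps * (t * Cmod h))).
- apply Rmult_le_compat; trivial; [apply Rabs_pos|apply Cmod_ge_0].
- rewrite Rmult_1_l. apply Rmult_le_compat_l; [lra|].
  generalize (Cmod_ge_0 h). nra.
Qed.

Lemma holomorphic_ray_moment n (U : C -> Prop) f a :
  open U -> star_shaped a U -> holomorphic U f ->
  holomorphic U (ray_moment n f a).
Proof.
intros HU Hs Hf k. revert n f Hf. induction k as [|k IH]; intros n f Hf; [easy|].
apply holomorphic_upto_S with (ray_moment (S n) (C_derive f) a); trivial.
- intros z Hz. now apply (is_Cderive_ray_moment n U).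
- apply IH. now apply holomorphic_derive.
Qed.

(** The primitive is the integral along the segment from [a] to [z]. *)
Lemma holomorphic_primitive (U : C -> Prop) f a :
  open U -> star_shaped a U -> holomorphic U f ->
  exists F, forall z, U z -> is_Cderive F z (f z).
Proof.
intros HU Hs Hf. exists (fun z => (z - a) * ray_moment 0 f a z)%C.
intros z Hz.
assert (Hf' := holomorphic_derive U f Hf).
assert (E : f z = (RtoC 1 * ray_moment 0 f a z +
                   (z - a) * ray_moment 1 (C_derive f) a z)%C).
{ assert (I1 := is_CInt_ray_moment 0 U f a z Hs
                  (fun w => holomorphic_continuous U f w Hf) Hz).
  assert (I2 := is_CInt_ray_moment 1 U _ a z Hs
                  (fun w => holomorphic_continuous U _ w Hf') Hz).
  apply (is_CInt_Cmult (z - a)) in I2.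
  assert (I := is_CInt_plus _ _ _ _ _ _ I1 I2).
  rewrite Cmult_1_l.
  apply CInt_unique in I. rewrite <- I. symmetry. apply CInt_unique.
  (* The integrand is the derivative of [t f (a + t (z - a))]. *)
  set (p t := (a + RtoC t * (z - a))%C).
  replace (f z) with (RtoC 1 * f (p 1) - RtoC 0 * f (p 0))%C.
  2: { replace (p 1) with z by (unfold p; ring). ring. }
  assert (Hp : forall t, 0 <= t <= 1 -> U (p t)) by now intros t; apply Hs.
  assert (I' := is_RInt_scal_derive (V := C_R_CompleteNormedModule)
    (fun t => t) (fun t => f (p t)) (fun _ => 1)
    (fun t => C_derive f (p t) * (z - a))%C 0 1).
  rewrite (Rmin_left 0 1), (Rmax_right 0 1) in I' by lra.
  rewrite <- !Cscal_R.
  refine (is_CInt_ext _ _ _ _ _ _ (I' _ _ _ _)).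
  - intros t _. rewrite !Cscal_R.
    change (RtoC 1 * f (p t) + RtoC t * (C_derive f (p t) * (z - a)) =
            RtoC (t ^ 0) * f (p t) + (z - a) * (RtoC (t ^ 1) * C_derive f (p t)))%C.
    simpl. rewrite Rmult_1_r. ring.
  - intros t _. apply (is_derive_id (K := R_AbsRing)).
  - intros t Ht. apply (is_Rderive_comp f p).
    + apply (holomorphic_is_derive U); auto.
    + apply is_Rderive_affine.
  - intros t _. apply continuous_const.
  - intros t Ht. apply Rcontinuous_mult; [|apply Rcontinuous_const].
    apply (Rcontinuous_comp (C_derive f) p); [|apply Rcontinuous_affine].
    apply (holomorphic_continuous U); auto. }
rewrite E. apply (is_Cderive_mult (fun w => w - a)%C); [apply is_Cderive_sub_const|].
now apply (is_Cderive_ray_moment 0 U).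
Qed.

(** The average of the derivative on the segment is the difference quotient of
    [f], with its singularity at [a] removed. *)
Definition slope (f : C -> C) (a : C) : C -> C := ray_moment 0 (C_derive f) a.

Lemma holomorphic_slope (U : C -> Prop) f a :
  open U -> star_shaped a U -> holomorphic U f -> holomorphic U (slope f a).
Proof.
intros HU Hs Hf. unfold slope. apply holomorphic_ray_moment; trivial.
now apply holomorphic_derive.
Qed.

Lemma slope_eq (U : C -> Prop) f a z :
  star_shaped a U -> holomorphic U f -> U z ->
  ((z - a) * slope f a z = f z - f a)%C.
Proof.
intros Hs Hf Hz.
assert (Hf' := holomorphic_derive U f Hf).
assert (I := is_CInt_ray_moment 0 U _ a z Hs
               (fun w => holomorphic_continuous U _ w Hf') Hz).
apply (is_CInt_Cmult (z - a)%C) in I. apply CInt_unique in I.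
unfold slope. rewrite <- I. apply CInt_unique.
replace (f z) with (f (a + (z - a))%C) by (f_equal; ring).
apply (is_CInt_ext
         (fun s => C_derive f (a + RtoC s * (z - a)) * (z - a))%C).
- intros t _. simpl. ring.
- apply is_CInt_segment; intros s Hs'.
  + apply (holomorphic_is_derive U); trivial. now apply Hs.
  + apply (holomorphic_continuous U); trivial. now apply Hs.
Qed.

Lemma slope_diag (f : C -> C) (a : C) : slope f a a = C_derive f a.
Proof.
unfold slope, ray_moment. apply CInt_unique.
assert (H := is_CInt_const (C_derive f a) 0 1).
rewrite Rminus_0_r, Cmult_1_l in H.
apply (is_CInt_ext) with (2 := H).
intros t _. simpl. rewrite Cmult_1_l. f_equal. ring.
Qed.

(** * Contour integrals *)

(** What is additive over consecutive intervals and holds on each smooth piece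
    holds on the whole curve. *)
Lemma piecewise_C1_ind (c : R -> C) (P : R -> R -> Prop) :
  piecewise_C1 c ->
  (forall x, P x x) ->
  (forall x y z, P x y -> P y z -> P x z) ->
  (forall x y g, 0 <= x -> x < y -> y <= 1 ->
     C1_real (fun t => Re (g t)) -> C1_real (fun t => Im (g t)) ->
     (forall t, x <= t <= y -> c t = g t) -> P x y) ->
  P 0 1.
Proof.
intros (n & s & H0 & Hn & Hs) Hid Htrans Hpiece.
assert (Hmono : forall k, (k <= n)%nat -> 0 <= s k).
{ induction k as [|k IH]; intros Hk; [rewrite H0; lra|].
  destruct (Hs k) as [H _]; [lia|]. specialize (IH ltac:(lia)). lra. }
assert (Hmono' : forall k, (k <= n)%nat -> s (n - k)%nat <= 1).
{ induction k as [|k IH]; intros Hk; [rewrite Nat.sub_0_r; lra|].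
  destruct (Hs (n - S k)%nat) as [H _]; [lia|].
  replace (S (n - S k))%nat with (n - k)%nat in H by lia.
  specialize (IH ltac:(lia)). lra. }
rewrite <- Hn.
assert (HP : forall k, (k <= n)%nat -> P 0 (s k)).
{ induction k as [|k IH]; intros Hk; [rewrite H0; apply Hid|].
  apply Htrans with (s k); [apply IH; lia|].
  destruct (Hs k) as (Hlt & g & G1 & G2 & Hg); [lia|].
  apply Hpiece with g; trivial; [apply Hmono; lia|].
  specialize (Hmono' (n - S k)%nat ltac:(lia)).
  now replace (n - (n - S k))%nat with (S k) in Hmono' by lia. }
now apply HP.
Qed.

Lemma path_deriv_C1 (g : R -> C) (t : R) :
  C1_real (fun t => Re (g t)) -> C1_real (fun t => Im (g t)) ->
  is_Rderive g t (path_deriv g t) /\ Rcontinuous (path_deriv g) t.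
Proof.
intros G1 G2. split.
- apply is_Rderive_pair; apply Derive_correct; [apply G1|apply G2].
- apply Rcontinuous_pair; [apply G1|apply G2].
Qed.

(** Only in the open interval: at a break point the derivative of the curve may
    not exist. *)
Lemma path_deriv_ext (c g : R -> C) (x y t : R) :
  (forall t, x <= t <= y -> c t = g t) -> x < t < y ->
  path_deriv c t = path_deriv g t.
Proof.
intros He Ht. unfold path_deriv.
assert (Hl : locally t (fun s => c s = g s)).
{ assert (Hd : 0 < Rmin (t - x) (y - t)) by (apply Rmin_pos; lra).
  exists (mkposreal _ Hd). intros s Hs. change (Rabs (s - t) < Rmin (t - x) (y - t)) in Hs.
  apply He. apply Rabs_lt_between in Hs.
  generalize (Rmin_l (t - x) (y - t)) (Rmin_r (t - x) (y - t)). lra. }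
f_equal; apply Derive_ext_loc; revert Hl; apply filter_imp; intros s Hs;
  now rewrite Hs.
Qed.

Lemma is_CInt_piece (f : C -> C) (c g : R -> C) (x y : R) :
  x < y ->
  C1_real (fun t => Re (g t)) -> C1_real (fun t => Im (g t)) ->
  (forall t, x <= t <= y -> c t = g t) ->
  (forall t, x <= t <= y -> continuous f (c t)) ->
  forall l, is_CInt (fun t => f (g t) * path_deriv g t)%C x y l ->
  is_CInt (fun t => f (c t) * path_deriv c t)%C x y l.
Proof.
intros Hxy G1 G2 He Hf l. apply (is_CInt_ext).
rewrite Rmin_left, Rmax_right by lra. intros t Ht.
rewrite He by lra. now rewrite (path_deriv_ext c g x y).
Qed.

Lemma ex_contour_int (f : C -> C) (c : R -> C) :
  piecewise_C1 c -> (forall t, 0 <= t <= 1 -> continuous f (c t)) ->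
  is_CInt (fun t => f (c t) * path_deriv c t)%C 0 1 (contour_int f c 0 1).
Proof.
intros Hc Hf. apply (RInt_correct (V := C_R_CompleteNormedModule)).
apply (piecewise_C1_ind c (fun x y =>
  ex_RInt (V := C_R_NormedModule) (fun t => f (c t) * path_deriv c t)%C x y)); trivial.
- intros x. apply ex_RInt_point.
- intros x y z. apply ex_RInt_Chasles.
- intros x y g Hx Hxy Hy G1 G2 He.
  eexists. apply (is_CInt_piece f c g); trivial.
  { intros t Ht. apply Hf. lra. }
  apply is_CInt_continuous. rewrite Rmin_left, Rmax_right by lra.
  intros t Ht. destruct (path_deriv_C1 g t G1 G2) as [Dg Cg].
  apply Rcontinuous_mult; trivial. apply (Rcontinuous_comp f g).
  + rewrite <- He by trivial. apply Hf. lra.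
  + now apply is_Rderive_continuous with (1 := Dg).
Qed.

Lemma contour_int_primitive (U : C -> Prop) (F f : C -> C) (c : R -> C) :
  piecewise_C1 c -> (forall t, 0 <= t <= 1 -> U (c t)) ->
  (forall z, U z -> is_Cderive F z (f z)) ->
  (forall z, U z -> continuous f z) ->
  contour_int f c 0 1 = (F (c 1) - F (c 0))%C.
Proof.
intros Hc HU HF Hf. apply CInt_unique.
apply (piecewise_C1_ind c (fun x y =>
  is_CInt (fun t => f (c t) * path_deriv c t)%C x y (F (c y) - F (c x))%C)); trivial.
- intros x. replace (F (c x) - F (c x))%C with (RtoC 0) by ring.
  apply (is_RInt_point (V := C_R_NormedModule)).
- intros x y z H1 H2.
  replace (F (c z) - F (c x))%C with ((F (c y) - F (c x)) + (F (c z) - F (c y)))%C by ring.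
  now apply (is_RInt_Chasles (V := C_R_NormedModule)) with y.
- intros x y g Hx Hxy Hy G1 G2 He. apply (is_CInt_piece f c g); trivial.
  { intros t Ht. apply Hf, HU. lra. }
  rewrite !He by lra.
  assert (HUg : forall t, x <= t <= y -> U (g t)).
  { intros t Ht. rewrite <- He by trivial. apply HU. lra. }
  apply (is_CInt_derive (fun t => F (g t))); rewrite Rmin_left, Rmax_right by lra;
    intros t Ht; destruct (path_deriv_C1 g t G1 G2) as [Dg Cg].
  + apply is_Rderive_comp; auto.
  + apply Rcontinuous_mult; trivial. apply (Rcontinuous_comp f g); auto.
    now apply is_Rderive_continuous with (1 := Dg).
Qed.

Lemma contour_int_ext (f g : C -> C) (c : R -> C) :
  (forall t, 0 <= t <= 1 -> f (c t) = g (c t)) ->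
  contour_int f c 0 1 = contour_int g c 0 1.
Proof.
intros H. apply (RInt_ext (V := C_R_CompleteNormedModule)).
rewrite Rmin_left, Rmax_right by lra. intros t Ht. now rewrite H by lra.
Qed.

Lemma contour_int_Cmult (k : C) (f : C -> C) (c : R -> C) :
  piecewise_C1 c -> (forall t, 0 <= t <= 1 -> continuous f (c t)) ->
  contour_int (fun z => k * f z)%C c 0 1 = (k * contour_int f c 0 1)%C.
Proof.
intros Hc Hf. apply CInt_unique.
apply (is_CInt_ext
         (fun t => k * (f (c t) * path_deriv c t))%C).
- intros t _. ring.
- now apply is_CInt_Cmult, ex_contour_int.
Qed.

Lemma contour_int_plus (f g : C -> C) (c : R -> C) :
  piecewise_C1 c -> (forall t, 0 <= t <= 1 -> continuous f (c t)) ->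
  (forall t, 0 <= t <= 1 -> continuous g (c t)) ->
  contour_int (fun z => f z + g z)%C c 0 1 =
  (contour_int f c 0 1 + contour_int g c 0 1)%C.
Proof.
intros Hc Hf Hg. apply CInt_unique.
apply (is_CInt_ext
         (fun t => f (c t) * path_deriv c t + g (c t) * path_deriv c t)%C).
- intros t _. ring.
- apply is_CInt_plus; now apply ex_contour_int.
Qed.

Theorem contour_int_holomorphic (U : C -> Prop) (f : C -> C) (a : C) (c : R -> C) :
  open U -> star_shaped a U -> holomorphic U f ->
  closed_curve c -> (forall t, 0 <= t <= 1 -> U (c t)) ->
  contour_int f c 0 1 = RtoC 0.
Proof.
intros HU Hs Hf [Hc Hcl] Hin.
destruct (holomorphic_primitive U f a HU Hs Hf) as [F HF].
rewrite (contour_int_primitive U F f c Hc Hin HF).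
- rewrite Hcl. ring.
- intros z. now apply holomorphic_continuous.
Qed.

Definition Cconvex (U : C -> Prop) : Prop := forall a, U a -> star_shaped a U.

Definition Clist_sum (l : list C) : C := fold_right Cplus (RtoC 0) l.

Lemma continuous_Cquot (U : C -> Prop) (f g : C -> C) (z : C) :
  holomorphic U f -> holomorphic U g -> U z -> g z <> RtoC 0 ->
  continuous (fun w => f w / g w)%C z.
Proof.
intros Hf Hg Hz H0.
eapply is_Cderive_continuous. apply is_Cderive_mult.
- now apply (holomorphic_is_derive U).
- apply is_Cderive_inv; trivial. now apply (holomorphic_is_derive U).
Qed.

(** Induction on the zeros. If [h = (z - a) k] and [rho = g a / h' a], then
    [g - rho k = (z - a) g1] as it vanishes at [a], so that
    [g / h = g1 / k + rho / (z - a)]; the quotient [g1 / k] has one zero less in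
    its denominator, and at another zero [b] its residue is that of [g / h], since
    [g b = (b - a) g1 b] and [h' b = (b - a) k' b]. *)
Theorem residues_simple_zeros (U : C -> Prop) (g h : C -> C) (zs : list C) (c : R -> C) :
  open U -> Cconvex U -> holomorphic U g -> holomorphic U h ->
  NoDup zs -> (forall z, U z /\ h z = RtoC 0 <-> In z zs) ->
  (forall z, In z zs -> C_derive h z <> RtoC 0) ->
  closed_curve c -> (forall t, 0 <= t <= 1 -> U (c t)) ->
  (forall z, In z zs -> ~ on_curve c z) ->
  contour_int (fun z => g z / h z)%C c 0 1 =
  Clist_sum (map (fun a => g a / C_derive h a *
                           contour_int (fun z => / (z - a)) c 0 1)%C zs).
Proof.
intros HU Hconv. revert g h. induction zs as [|a zs IH];
  intros g h Hg Hh Hnd Hzs Hsimple Hc Hin Hoff.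
- simpl. apply (contour_int_holomorphic U _ (c 0)); trivial.
  + apply Hconv, Hin. lra.
  + apply holomorphic_div; trivial. intros z Hz Hz0. now apply (Hzs z).
- assert (Ha : U a /\ h a = RtoC 0) by (apply Hzs; now left).
  destruct Ha as [Ha Ha0].
  assert (Hsa : star_shaped a U) by now apply Hconv.
  assert (Hda : C_derive h a <> RtoC 0) by (apply Hsimple; now left).
  inversion Hnd as [|a' zs' Hnin Hnd']; subst a' zs'.
  set (k := slope h a).
  assert (Hk : holomorphic U k) by now apply holomorphic_slope.
  assert (Hka : k a = C_derive h a) by apply slope_diag.
  assert (Ehk : forall z, U z -> h z = ((z - a) * k z)%C).
  { intros z Hz. unfold k. rewrite (slope_eq U) by trivial. rewrite Ha0. ring. }
  set (rho := (g a / k a)%C).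
  set (g1 := slope (fun z => g z - rho * k z)%C a).
  assert (Hgk : holomorphic U (fun z => g z - rho * k z)%C).
  { apply holomorphic_minus; trivial. apply holomorphic_mult; trivial.
    now apply holomorphic_const. }
  assert (Hg1 : holomorphic U g1) by now apply holomorphic_slope.
  assert (Eg1 : forall z, U z -> (g z - rho * k z = (z - a) * g1 z)%C).
  { intros z Hz. unfold g1. rewrite (slope_eq U) by trivial.
    unfold rho. rewrite Hka. field. trivial. }
  assert (Hkz : forall z, In z zs -> U z /\ z <> a /\ k z = RtoC 0).
  { intros z Hz. destruct (proj2 (Hzs z) (or_intror Hz)) as [HUz Hhz].
    assert (Hza : z <> a) by now intros ->. repeat split; trivial.
    rewrite Ehk in Hhz by trivial.
    apply NNPP. intros Hn. now apply (Cmult_neq_0 (z - a) (k z)); auto using Cminus_eq_contra. }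
  assert (Edk : forall z, In z zs -> C_derive h z = ((z - a) * C_derive k z)%C).
  { intros z Hz. destruct (Hkz z Hz) as (HUz & Hza & Hkz0).
    apply is_C_derive_unique.
    apply (is_Cderive_ext_on U (fun z => (z - a) * k z)%C); trivial.
    { intros w Hw. now rewrite Ehk. }
    replace ((z - a) * C_derive k z)%C
      with (RtoC 1 * k z + (z - a) * C_derive k z)%C by (rewrite Hkz0; ring).
    apply (is_Cderive_mult (fun w => w - a)%C); [apply is_Cderive_sub_const|].
    now apply (holomorphic_is_derive U). }
  assert (Hca : forall t, 0 <= t <= 1 -> c t <> a).
  { intros t Ht He. apply (Hoff a); [now left|]. now exists t. }
  assert (Hkc : forall t, 0 <= t <= 1 -> k (c t) <> RtoC 0).
  { intros t Ht H0.
    assert (Hz : In (c t) (a :: zs)).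
    { apply Hzs. split; [auto|]. rewrite Ehk, H0 by auto. ring. }
    apply (Hoff _ Hz). now exists t. }
  rewrite (contour_int_ext _ (fun z => g1 z / k z + rho * / (z - a))%C).
  2: { intros t Ht. assert (Hu := Hin t Ht). assert (Hk0 := Hkc t Ht).
    assert (Ht0 := Cminus_eq_contra _ _ (Hca t Ht)).
    rewrite (Ehk _ Hu).
    replace (g (c t)) with ((c t - a) * g1 (c t) + rho * k (c t))%C.
    - field. now split.
    - rewrite <- Eg1 by trivial. ring. }
  assert (Hinv : forall t, 0 <= t <= 1 -> continuous (fun z => / (z - a))%C (c t)).
  { intros t Ht. eapply is_Cderive_continuous.
    apply (is_Cderive_inv (fun w => w - a)%C); [apply is_Cderive_sub_const|].
    apply Cminus_eq_contra. auto. }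
  destruct Hc as [Hpc Hcl].
  rewrite contour_int_plus; trivial.
  2: { intros t Ht. apply (continuous_Cquot U); auto. }
  2: { intros t Ht. eapply (continuous_comp (fun z => / (z - a))%C (fun w => rho * w)%C).
    - auto.
    - eapply is_Cderive_continuous. apply is_Cderive_linear. }
  rewrite contour_int_Cmult by trivial.
  simpl. rewrite Cplus_comm. unfold rho. rewrite Hka. f_equal.
  rewrite IH; trivial.
  + unfold Clist_sum. f_equal. apply map_ext_in. intros b Hb. f_equal.
    destruct (Hkz b Hb) as (HUb & Hba & Hkb).
    assert (Hdb : C_derive h b <> RtoC 0) by (apply Hsimple; now right).
    rewrite Edk in Hdb |- * by trivial.
    assert (Hk' : C_derive k b <> RtoC 0).
    { intros H0. apply Hdb. rewrite H0. ring. }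
    assert (Eb := Eg1 b HUb). rewrite Hkb in Eb.
    replace (g b) with ((b - a) * g1 b)%C by (rewrite <- Eb; ring).
    field. split; auto using Cminus_eq_contra.
  + intros z. split.
    * intros [HUz Hz0].
      assert (Hz : In z (a :: zs)).
      { apply Hzs. split; trivial. rewrite Ehk, Hz0 by trivial. ring. }
      destruct Hz as [<-|Hz]; trivial. now rewrite Hka in Hz0.
    * intros Hz. destruct (Hkz z Hz) as (? & _ & ?). now split.
  + intros z Hz H0. apply (Hsimple z); [now right|].
    rewrite Edk, H0 by trivial. ring.
  + now split.
  + intros z Hz. apply Hoff. now right.
Qed.

(** * The complex exponential *)

Lemma Cexp_plus (z w : C) : Cexp (z + w) = (Cexp z * Cexp w)%C.
Proof.
destruct z as [a b], w as [c d]. unfold Cexp; simpl.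
rewrite exp_plus, cos_plus, sin_plus.
apply injective_projections; simpl; ring.
Qed.

Lemma Cexp_RtoC (x : R) : Cexp (RtoC x) = RtoC (exp x).
Proof.
unfold Cexp, RtoC; simpl. rewrite cos_0, sin_0.
apply injective_projections; simpl; ring.
Qed.

Lemma Cexp_Ci (x : R) : Cexp (Ci * RtoC x)%C = (cos x, sin x).
Proof.
unfold Cexp; simpl. replace (0 * x - 1 * 0) with 0 by ring.
replace (0 * 0 + 1 * x) with x by ring. rewrite exp_0.
apply injective_projections; simpl; ring.
Qed.

Lemma Cexp_0 : Cexp (RtoC 0) = RtoC 1.
Proof. now rewrite Cexp_RtoC, exp_0. Qed.

Lemma Cmod_Cexp (z : C) : Cmod (Cexp z) = exp (Re z).
Proof.
unfold Cexp, Cmod; simpl.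
replace (exp (Re z) * cos (Im z) * (exp (Re z) * cos (Im z) * 1) +
         exp (Re z) * sin (Im z) * (exp (Re z) * sin (Im z) * 1))
  with (exp (Re z) * exp (Re z) * ((sin (Im z))² + (cos (Im z))²))
  by (unfold Rsqr; ring).
rewrite sin2_cos2, Rmult_1_r. apply sqrt_square, Rlt_le, exp_pos.
Qed.

Lemma Cexp_neq_0 (z : C) : Cexp z <> RtoC 0.
Proof. apply Cmod_gt_0. rewrite Cmod_Cexp. apply exp_pos. Qed.

Lemma Cexp_opp (z : C) : Cexp (- z)%C = (/ Cexp z)%C.
Proof.
assert (H : (Cexp (- z) * Cexp z)%C = RtoC 1).
{ rewrite <- Cexp_plus, <- Cexp_0. f_equal. ring. }
rewrite <- (Cmult_1_l (/ Cexp z)), <- H. field. apply Cexp_neq_0.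
Qed.

Lemma Cexp_pow (z : C) (n : nat) : (Cexp z ^ n)%C = Cexp (RtoC (INR n) * z).
Proof.
induction n as [|n IH].
- simpl. rewrite Cmult_0_l, Cexp_0. reflexivity.
- rewrite S_INR, RtoC_plus, Cmult_plus_distr_r, Cexp_plus, Cmult_1_l, <- IH.
  simpl. ring.
Qed.

Lemma Cexp_2PI_Z (n : Z) : Cexp (Ci * RtoC (2 * PI * IZR n))%C = RtoC 1.
Proof.
rewrite Cexp_Ci.
assert (Hc : sin (PI * IZR n) = 0) by (apply sin_eq_0_1; exists n; ring).
replace (2 * PI * IZR n) with (2 * (PI * IZR n)) by ring.
rewrite cos_2a_sin, sin_2a, Hc. apply injective_projections; simpl; ring.
Qed.

Lemma is_CInt_Cexp (h : C) :
  is_CInt (fun t => Cexp (RtoC t * h) * h)%C 0 1 (Cexp h - RtoC 1)%C.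
Proof.
replace (Cexp h - RtoC 1)%C with (Cexp (RtoC 1 * h) - Cexp (RtoC 0 * h))%C.
2: now rewrite Cmult_1_l, Cmult_0_l, Cexp_0.
assert (H : forall t, is_Rderive (fun t => Cexp (RtoC t * h)) t (Cexp (RtoC t * h) * h)%C).
{ intros t.
  replace (Cexp (RtoC t * h) * h)%C with
    (exp (t * Re h) * (Re h * cos (t * Im h) - Im h * sin (t * Im h)),
     exp (t * Re h) * (Re h * sin (t * Im h) + Im h * cos (t * Im h))).
  2: { unfold Cexp. rewrite re_scal_l, im_scal_l. destruct h as [a b].
    apply injective_projections; simpl; ring. }
  apply is_Rderive_pair.
  - apply (is_derive_ext (fun t => exp (t * Re h) * cos (t * Im h))).
    + intros s. unfold Cexp. now rewrite re_scal_l, im_scal_l.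
    + auto_derive; trivial. ring.
  - apply (is_derive_ext (fun t => exp (t * Re h) * sin (t * Im h))).
    + intros s. unfold Cexp. now rewrite re_scal_l, im_scal_l.
    + auto_derive; trivial. ring. }
apply (is_CInt_derive (fun t => Cexp (RtoC t * h))); intros t _; [apply H|].
apply Rcontinuous_mult; [|apply Rcontinuous_const].
apply (is_Rderive_continuous _ _ _ (H t)).
Qed.

Lemma Re_le_Cmod (z : C) : Re z <= Cmod z.
Proof. apply Rle_trans with (2 := re_le_Cmod z), Rle_abs. Qed.

Lemma exp_le (x y : R) : x <= y -> exp x <= exp y.
Proof. intros [H| ->]; [apply Rlt_le; now apply exp_increasing|apply Rle_refl]. Qed.

Lemma Cmod_Cexp_minus_1 (h : C) : Cmod (Cexp h - RtoC 1)%C <= Cmod h * exp (Cmod h).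
Proof.
replace (Cmod h * exp (Cmod h)) with ((1 - 0) * (exp (Cmod h) * Cmod h)) by ring.
apply Cmod_is_CInt_le_const with (3 := is_CInt_Cexp h); [lra|].
intros t Ht. rewrite Cmod_mult, Cmod_Cexp, re_scal_l.
apply Rmult_le_compat_r; [apply Cmod_ge_0|]. apply exp_le.
generalize (Re_le_Cmod h) (Cmod_ge_0 h). nra.
Qed.

(** Uniform in [h]: this is also what bounds the remainder of a Laplace
    transform. *)
Lemma Cmod_Cexp_remainder (h : C) :
  Cmod (Cexp h - RtoC 1 - h)%C <= Cmod h ^ 2 * exp (Cmod h).
Proof.
assert (H := is_CInt_minus _ _ _ _ _ _ (is_CInt_Cexp h) (is_CInt_const h 0 1)).
rewrite Rminus_0_r, Cmult_1_l in H.
replace (Cmod h ^ 2 * exp (Cmod h)) with ((1 - 0) * (Cmod h ^ 2 * exp (Cmod h))) by ring.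
apply Cmod_is_CInt_le_const with (3 := H); [lra|].
intros t Ht.
replace (Cexp (RtoC t * h) * h - h)%C with ((Cexp (RtoC t * h) - RtoC 1) * h)%C by ring.
rewrite Cmod_mult.
apply Rle_trans with (Cmod h * exp (Cmod h) * Cmod h); [|apply Req_le; ring].
apply Rmult_le_compat_r; [apply Cmod_ge_0|].
apply Rle_trans with (1 := Cmod_Cexp_minus_1 _).
rewrite Cmod_mult, Cmod_R, Rabs_pos_eq by lra.
assert (Hh := Cmod_ge_0 h).
apply Rmult_le_compat; [nra|apply Rlt_le, exp_pos|nra|apply exp_le; nra].
Qed.

Lemma is_Cderive_Cexp (z : C) : is_Cderive Cexp z (Cexp z).
Proof.
apply is_Cderive_iff. intros eps Heps.
set (K := exp (Re z) * exp 1).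
assert (HK : 0 < K) by (apply Rmult_lt_0_compat; apply exp_pos).
exists (Rmin 1 (eps / K)); split.
{ apply Rmin_pos; [lra|]. now apply Rdiv_lt_0_compat. }
intros h Hh.
assert (Hh1 := Rlt_le_trans _ _ _ Hh (Rmin_l _ _)).
assert (Hh2 := Rlt_le_trans _ _ _ Hh (Rmin_r _ _)).
replace (Cexp (z + h) - Cexp z - Cexp z * h)%C
  with (Cexp z * (Cexp h - RtoC 1 - h))%C by (rewrite Cexp_plus; ring).
rewrite Cmod_mult, Cmod_Cexp.
assert (Hr := Cmod_Cexp_remainder h).
assert (He : exp (Cmod h) <= exp 1) by (apply exp_le; lra).
assert (Hm := Cmod_ge_0 h).
apply Rle_trans with (exp (Re z) * (Cmod h ^ 2 * exp 1)).
{ apply Rmult_le_compat_l; [apply Rlt_le, exp_pos|].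
  apply Rle_trans with (1 := Hr). apply Rmult_le_compat_l; [nra|trivial]. }
apply (Rmult_lt_compat_r K) in Hh2; trivial.
replace (eps / K * K) with eps in Hh2 by (field; lra).
replace (exp (Re z) * (Cmod h ^ 2 * exp 1)) with (Cmod h * K * Cmod h) by (unfold K; ring).
apply Rmult_le_compat_r; lra.
Qed.

Lemma open_True : open (fun _ : C => True).
Proof. apply open_true. Qed.

Lemma holomorphic_Cexp (U : C -> Prop) : open U -> holomorphic U Cexp.
Proof.
intros HU n. induction n as [|n IH]; [easy|].
apply holomorphic_upto_S with Cexp; trivial.
intros; apply is_Cderive_Cexp.
Qed.

Lemma holomorphic_Cexp_comp (U : C -> Prop) (f : C -> C) :
  open U -> holomorphic U f -> holomorphic U (fun z => Cexp (f z)).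
Proof.
intros HU Hf. apply (holomorphic_comp U (fun _ => True) Cexp f); trivial.
- apply open_True.
- apply holomorphic_Cexp, open_True.
Qed.

Lemma continuous_Cexp (z : C) : continuous Cexp z.
Proof. apply (is_Cderive_continuous _ _ _ (is_Cderive_Cexp z)). Qed.

(** * The hyperbolic sine *)

Lemma Csinh_pair (z : C) :
  Csinh z = (sinh (Re z) * cos (Im z), cosh (Re z) * sin (Im z)).
Proof.
destruct z as [a b]. unfold Csinh, Cexp, sinh, cosh. simpl.
rewrite cos_neg, sin_neg.
apply injective_projections; simpl; field.
Qed.

Lemma cosh_sinh_2 (x : R) : cosh x ^ 2 = sinh x ^ 2 + 1.
Proof.
assert (He : exp x * exp (- x) = 1) by (rewrite <- exp_plus, Rplus_opp_r; apply exp_0).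
unfold cosh, sinh. nra.
Qed.

(** Zeros and lower bounds of [Csinh] are read off from this formula. *)
Lemma Csinh_Cmod2 (z : C) :
  Cmod (Csinh z) ^ 2 = sinh (Re z) ^ 2 + sin (Im z) ^ 2.
Proof.
rewrite Cmod2_alt, Csinh_pair. simpl Re. simpl Im.
rewrite !Rpow_mult_distr, cosh_sinh_2.
assert (H := sin2_cos2 (Im z)). rewrite !Rsqr_pow2 in H.
replace (cos (Im z) ^ 2) with (1 - sin (Im z) ^ 2) by lra. ring.
Qed.

Lemma Csinh_eq_0 (z : C) :
  Csinh z = RtoC 0 -> exists n : Z, z = (Ci * RtoC (PI * IZR n))%C.
Proof.
intros H. assert (E := Csinh_Cmod2 z). rewrite H, Cmod_0 in E.
assert (Hs : sinh (Re z) = 0) by nra.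
assert (Hi : sin (Im z) = 0) by nra.
destruct (sin_eq_0_0 _ Hi) as [n Hn]. exists n.
assert (Hr : Re z = 0).
{ unfold sinh in Hs. assert (exp (Re z) = exp (- Re z)) as He by lra.
  apply exp_inv in He. lra. }
destruct z as [x y]. simpl in *. subst x.
apply injective_projections; simpl; [ring|lra].
Qed.

Lemma cosh_ge_exp (x : R) : exp (Rabs x) / 2 <= cosh x.
Proof.
unfold cosh. generalize (exp_pos x) (exp_pos (- x)).
unfold Rabs. destruct (Rcase_abs x); lra.
Qed.

Lemma sinh_ge_exp (x rho : R) :
  rho <= Rabs x -> (1 - exp (- (2 * rho))) / 2 * exp (Rabs x) <= Rabs (sinh x).
Proof.
intros H.
assert (E : exp (- Rabs x) <= exp (- (2 * rho)) * exp (Rabs x)).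
{ rewrite <- exp_plus. apply exp_le. lra. }
assert (E2 : Rabs (sinh x) >= (exp (Rabs x) - exp (- Rabs x)) / 2).
{ unfold sinh. unfold Rabs at 2 3. destruct (Rcase_abs x) as [Hx|Hx].
  - rewrite Ropp_involutive, Rabs_left1.
    + lra.
    + assert (exp x <= exp (- x)) by (apply exp_le; lra). lra.
  - rewrite Rabs_pos_eq; [lra|].
    assert (exp (- x) <= exp x) by (apply exp_le; lra). lra. }
lra.
Qed.

Lemma Csinh_ge_sinh (z : C) : Rabs (sinh (Re z)) <= Cmod (Csinh z).
Proof.
apply Rsqr_incr_0_var; [|apply Cmod_ge_0].
rewrite <- Rsqr_abs, !Rsqr_pow2, Csinh_Cmod2. generalize (pow2_ge_0 (sin (Im z))). lra.
Qed.

Lemma Csinh_ge_cosh (z : C) : Rabs (sin (Im z)) * cosh (Re z) <= Cmod (Csinh z).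
Proof.
apply Rsqr_incr_0_var; [|apply Cmod_ge_0].
rewrite Rsqr_mult, <- Rsqr_abs, !Rsqr_pow2, Csinh_Cmod2, cosh_sinh_2.
assert (H := sin2_cos2 (Im z)). rewrite !Rsqr_pow2 in H.
generalize (pow2_ge_0 (sinh (Re z))) (pow2_ge_0 (cos (Im z))). nra.
Qed.

Lemma holomorphic_Csinh (U : C -> Prop) (f : C -> C) :
  open U -> holomorphic U f -> holomorphic U (fun z => Csinh (f z)).
Proof.
intros HU Hf. unfold Csinh. apply holomorphic_div; trivial.
- intros _ _ H. apply (f_equal Re) in H. simpl in H. lra.
- apply holomorphic_minus; trivial; apply holomorphic_Cexp_comp; trivial.
  now apply holomorphic_opp.
- now apply holomorphic_const.
Qed.

(** * Exponentially convergent integrals *)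

Lemma inv_small (B eps : R) : 0 < eps -> 0 <= B -> exists M, 1 <= M /\ forall X, M <= X -> B / X < eps.
Proof.
intros He HB. exists (B / eps + 1).
assert (0 <= B / eps) by (apply Rdiv_le_0_compat; lra).
split; [lra|]. intros X HX.
apply Rmult_lt_reg_r with X; [lra|].
replace (B / X * X) with B by (field; lra).
apply Rlt_le_trans with (eps * (B / eps + 1)).
- replace (eps * (B / eps + 1)) with (B + eps) by (field; lra). lra.
- apply Rmult_le_compat_l; lra.
Qed.

Lemma exp_decay_small (C0 b eps : R) :
  0 < b -> 0 < eps -> exists M, 0 <= M /\ forall X, M <= X -> C0 * exp (- (b * X)) < eps.
Proof.
intros Hb He.
destruct (inv_small (Rabs C0 / b) eps He) as (M & HM & H).
{ apply Rdiv_le_0_compat; [apply Rabs_pos|trivial]. }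
exists M. split; [lra|]. intros X HX.
apply Rle_lt_trans with (2 := H X HX).
apply Rle_trans with (Rabs C0 * / (b * X)); [|apply Req_le; field; lra].
assert (HbX : 0 < b * X) by nra.
apply Rle_trans with (Rabs C0 * exp (- (b * X))).
- apply Rmult_le_compat_r; [apply Rlt_le, exp_pos|apply Rle_abs].
- apply Rmult_le_compat_l; [apply Rabs_pos|]. rewrite exp_Ropp.
  apply Rinv_le_contravar; trivial. generalize (exp_ineq1_le (b * X)). lra.
Qed.

(** The tail estimate is both the Cauchy criterion and, in the limit, the error
    bound. *)
Lemma exp_Cauchy (phi : R -> C) (C0 a b : R) :
  0 < b ->
  (forall X Y, a <= X -> X <= Y -> Cmod (phi Y - phi X)%C <= C0 * exp (- (b * X))) ->
  exists l, forall X, a <= X -> Cmod (phi X - l)%C <= C0 * exp (- (b * X)).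
Proof.
intros Hb H.
assert (Hlim : exists l : C_R_CompleteNormedModule,
  filterlim phi (Rbar_locally p_infty) (locally l)).
{ apply (filterlim_locally_cauchy (U := C_R_CompleteNormedModule)).
  intros eps.
  destruct (exp_decay_small C0 b (eps / 2) Hb) as (M & _ & HM).
  { generalize (cond_pos eps). lra. }
  exists (fun X => Rmax M a < X). split; [now exists (Rmax M a)|].
  intros u v Hu Hv.
  assert (Hball : forall x y, Rmax M a < x -> x <= y -> Cmod (phi y - phi x)%C < eps).
  { intros x y Hx Hxy. apply Rle_lt_trans with (C0 * exp (- (b * x))).
    - apply H; trivial. generalize (Rmax_r M a). lra.
    - generalize (cond_pos eps) (Rmax_l M a). intros.
      apply Rlt_trans with (eps / 2); [apply HM|]; lra. }
  apply (C_NormedModule_mixin_compat1 (phi u) (phi v) eps).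
  change (Cmod (phi v - phi u)%C < eps).
  destruct (Rle_dec u v).
  - now apply Hball.
  - rewrite <- Cmod_opp. replace (- (phi v - phi u))%C with (phi u - phi v)%C by ring.
    apply Hball; trivial. lra. }
destruct Hlim as [l Hl]. exists l. intros X HX.
apply le_epsilon. intros eps Heps.
assert (Hnb : locally (T := AbsRing_UniformSpace C_AbsRing) l (fun y => Cmod (y - l)%C < eps)).
{ exists (mkposreal eps Heps). intros y Hy. exact Hy. }
apply locally_C in Hnb. apply Hl in Hnb. destruct Hnb as [M HM].
set (Y := Rmax M X + 1).
assert (HY := HM Y). specialize (HY ltac:(unfold Y; generalize (Rmax_l M X); lra)).
assert (HXY := H X Y HX ltac:(unfold Y; generalize (Rmax_r M X); lra)).
replace (phi X - l)%C with ((phi Y - l) + - (phi Y - phi X))%C by ring.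
apply Rle_trans with (1 := Cmod_triangle _ _). rewrite Cmod_opp. simpl in HY. lra.
Qed.

Lemma is_RInt_exp_tail (C0 b X Y : R) :
  0 < b ->
  is_RInt (fun x => C0 * exp (- (b * x))) X Y
    (C0 / b * exp (- (b * X)) - C0 / b * exp (- (b * Y))).
Proof.
intros Hb.
replace (C0 / b * exp (- (b * X)) - C0 / b * exp (- (b * Y)))
  with (minus (- (C0 / b * exp (- (b * Y)))) (- (C0 / b * exp (- (b * X)))))
  by (unfold minus, plus, opp; simpl; ring).
apply (is_RInt_derive (V := R_CompleteNormedModule)
         (fun x => - (C0 / b * exp (- (b * x))))).
- intros x _. auto_derive; trivial. field. lra.
- intros x _. apply (ex_derive_continuous (V := R_NormedModule)). now auto_derive.
Qed.

Lemma Cmod_tail_right (f : R -> C) (C0 b a X Y : R) (l : C) :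
  0 < b -> (forall x, a <= x -> Cmod (f x) <= C0 * exp (- (b * x))) ->
  a <= X -> X <= Y -> is_CInt f X Y l -> Cmod l <= C0 / b * exp (- (b * X)).
Proof.
intros Hb Hf Ha HXY Hl.
assert (HC : 0 <= C0).
{ specialize (Hf a (Rle_refl _)). generalize (Cmod_ge_0 (f a)) (exp_pos (- (b * a))). nra. }
apply Rle_trans with (C0 / b * exp (- (b * X)) - C0 / b * exp (- (b * Y))).
- apply Cmod_is_CInt_le with (3 := Hl) (4 := is_RInt_exp_tail C0 b X Y Hb); trivial.
  intros t Ht. apply Hf. lra.
- assert (0 <= C0 / b * exp (- (b * Y))).
  { apply Rmult_le_pos; [now apply Rdiv_le_0_compat|apply Rlt_le, exp_pos]. }
  lra.
Qed.

Lemma is_CInt_reflect (f : R -> C) (X Y : R) (l : C) :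
  is_CInt f (- Y) (- X) l -> is_CInt (fun x => f (- x)) X Y l.
Proof.
intros H. apply (is_RInt_swap (V := C_R_NormedModule)) in H.
apply (is_RInt_comp_opp (V := C_R_NormedModule)) in H.
rewrite <- (opp_opp (G := C_AbelianGroup) l).
apply (is_RInt_ext (V := C_R_NormedModule)) with (2 := is_RInt_opp (V := C_R_NormedModule) _ _ _ _ H).
intros t _. apply (opp_opp (G := C_AbelianGroup)).
Qed.

Notation is_LInt f l :=
  (is_RInt_gen (V := C_R_NormedModule) f (Rbar_locally m_infty) (Rbar_locally p_infty) l).
Definition LInt (f : R -> C) : C :=
  RInt_gen (V := C_R_CompleteNormedModule) f (Rbar_locally m_infty) (Rbar_locally p_infty).

Lemma is_RInt_gen_right (f : R -> C) (a : R) (l : C) :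
  (forall x, a <= x -> Rcontinuous f x) ->
  (forall eps, 0 < eps -> exists M, forall X, M <= X -> Cmod (CInt f a X - l)%C < eps) ->
  is_RInt_gen (V := C_R_NormedModule) f (at_point a) (Rbar_locally p_infty) l.
Proof.
intros Hc H P HP. apply locally_C in HP. destruct HP as [e He].
destruct (H e (cond_pos e)) as [M HM].
exists (fun x => x = a) (fun X => Rmax M a < X).
- reflexivity.
- now exists (Rmax M a).
- intros x X -> HX. exists (CInt f a X). split.
  + simpl. apply is_CInt_continuous. assert (Hr := Rmax_r M a).
    rewrite Rmin_left by lra. intros t Ht. apply Hc. lra.
  + apply He. apply HM. generalize (Rmax_l M a). lra.
Qed.

Lemma CInt_Chasles (f : R -> C) (a b c : R) :
  (forall x, Rmin a (Rmin b c) <= x <= Rmax a (Rmax b c) -> Rcontinuous f x) ->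
  (CInt f a c = CInt f a b + CInt f b c)%C.
Proof.
intros H. symmetry.
apply (RInt_Chasles (V := C_R_CompleteNormedModule) f a b c);
  eexists; apply is_CInt_continuous; intros t Ht; apply H; revert Ht;
  unfold Rmin, Rmax; repeat destruct (Rle_dec _ _); lra.
Qed.

Lemma is_RInt_gen_exp_right (f : R -> C) (C0 a b : R) :
  0 < b -> (forall x, a <= x -> Rcontinuous f x) ->
  (forall x, a <= x -> Cmod (f x) <= C0 * exp (- (b * x))) ->
  exists l, is_RInt_gen (V := C_R_NormedModule) f (at_point a) (Rbar_locally p_infty) l /\
    forall X, a <= X -> Cmod (CInt f a X - l)%C <= C0 / b * exp (- (b * X)).
Proof.
intros Hb Hc Hf.
destruct (exp_Cauchy (fun X => CInt f a X) (C0 / b) a b Hb) as [l Hl].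
{ intros X Y HX HXY. apply (Cmod_tail_right f C0 b a X Y); trivial.
  rewrite (CInt_Chasles f a X Y).
  - replace (CInt f a X + CInt f X Y - CInt f a X)%C with (CInt f X Y) by ring.
    apply is_CInt_continuous. rewrite Rmin_left by lra. intros t Ht. apply Hc. lra.
  - rewrite (Rmin_left X), (Rmin_left a) by lra. intros x Hx. apply Hc. lra. }
exists l. split; trivial.
apply is_RInt_gen_right; trivial. intros eps He.
destruct (exp_decay_small (C0 / b) b eps Hb He) as (M & _ & HM).
exists (Rmax M a). intros X HX.
apply Rle_lt_trans with (C0 / b * exp (- (b * X))).
- apply Hl. generalize (Rmax_r M a). lra.
- apply HM. generalize (Rmax_l M a). lra.
Qed.

Lemma is_RInt_gen_exp_left (f : R -> C) (C0 a b : R) :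
  0 < b -> (forall x, x <= - a -> Rcontinuous f x) ->
  (forall x, a <= x -> Cmod (f (- x)) <= C0 * exp (- (b * x))) ->
  exists l, is_RInt_gen (V := C_R_NormedModule) f (Rbar_locally m_infty) (at_point (- a)) l /\
    forall X, a <= X -> Cmod (CInt f (- X) (- a) - l)%C <= C0 / b * exp (- (b * X)).
Proof.
intros Hb Hc Hf.
assert (Hr : forall X l, is_CInt (fun x => f (- x)) a (- X) l -> is_CInt f X (- a) l).
{ intros X l H.
  apply (is_CInt_ext (fun x => f (- - x))); [intros x _; now rewrite Ropp_involutive|].
  apply (is_CInt_reflect (fun x => f (- x))). now rewrite Ropp_involutive. }
assert (Hg : forall x, a <= x -> Rcontinuous (fun x => f (- x)) x).
{ intros x Hx. apply (continuous_comp Ropp f).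
  - apply (continuous_opp (V := R_NormedModule)), continuous_id.
  - apply Hc. lra. }
destruct (is_RInt_gen_exp_right (fun x => f (- x)) C0 a b Hb Hg Hf) as (l & G & B).
exists l. split.
- intros P HP. destruct (G P HP) as [Q S HQ [M HS] H].
  exists (fun X => S (- X)) (fun x => x = - a).
  + exists (- M). intros X HX. apply HS. lra.
  + reflexivity.
  + intros X x HX ->. destruct (H a (- X) HQ HX) as (y & Hy & HPy).
    exists y. split; [now apply Hr|trivial].
- intros X HX.
  rewrite (CInt_unique f (- X) (- a) (CInt (fun x => f (- x)) a X)); [auto|].
  apply Hr. rewrite Ropp_involutive. apply is_CInt_continuous.
  rewrite Rmin_left by lra. intros x Hx. apply Hg. lra.
Qed.

Lemma LInt_exp (f : R -> C) (C0 b : R) :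
  0 < b -> (forall x, Rcontinuous f x) ->
  (forall x, Cmod (f x) <= C0 * exp (- (b * Rabs x))) ->
  is_LInt f (LInt f) /\
  forall X, 0 <= X -> Cmod (CInt f (- X) X - LInt f)%C <= 2 * C0 / b * exp (- (b * X)).
Proof.
intros Hb Hc Hf.
destruct (is_RInt_gen_exp_right f C0 0 b Hb) as (l1 & H1 & B1); auto.
{ intros x Hx. specialize (Hf x). now rewrite Rabs_pos_eq in Hf. }
destruct (is_RInt_gen_exp_left f C0 0 b Hb) as (l2 & H2 & B2); auto.
{ intros x Hx. specialize (Hf (- x)). now rewrite Rabs_Ropp, Rabs_pos_eq in Hf. }
rewrite Ropp_0 in H2, B2.
assert (H := is_RInt_gen_Chasles (V := C_R_NormedModule) f 0 l2 l1 H2 H1).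
assert (E : LInt f = (l2 + l1)%C)
  by apply (is_RInt_gen_unique (V := C_R_CompleteNormedModule) _ _ H).
rewrite E. split; trivial. intros X HX.
rewrite (CInt_Chasles f (- X) 0 X) by auto.
replace (CInt f (- X) 0 + CInt f 0 X - (l2 + l1))%C
  with ((CInt f (- X) 0 - l2) + (CInt f 0 X - l1))%C by ring.
apply Rle_trans with (1 := Cmod_triangle _ _).
specialize (B1 X HX). specialize (B2 X HX).
replace (2 * C0 / b * exp (- (b * X)))
  with (C0 / b * exp (- (b * X)) + C0 / b * exp (- (b * X))) by (field; lra).
lra.
Qed.

Lemma Cmod_LInt_le (f : R -> C) (C0 b : R) :
  0 < b -> (forall x, Rcontinuous f x) ->
  (forall x, Cmod (f x) <= C0 * exp (- (b * Rabs x))) ->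
  Cmod (LInt f) <= 2 * C0 / b.
Proof.
intros Hb Hc Hf. destruct (LInt_exp f C0 b Hb Hc Hf) as [_ H].
specialize (H 0 (Rle_refl 0)).
rewrite Ropp_0, Rmult_0_r, Ropp_0, exp_0, Rmult_1_r in H.
unfold CInt in H. rewrite (RInt_point (V := C_R_CompleteNormedModule)) in H.
change (Cmod (RtoC 0 - LInt f)%C <= 2 * C0 / b) in H.
rewrite <- Cmod_opp. now replace (- LInt f)%C with (RtoC 0 - LInt f)%C by ring.
Qed.

(** Symmetric limits suffice to identify the value of an improper integral that
    is known to converge, and primitives deliver them directly. *)
Definition is_SInt (f : R -> C) (l : C) : Prop :=
  forall eps, 0 < eps -> exists M, forall X, M <= X -> Cmod (CInt f (- X) X - l)%C <= eps.

Lemma is_SInt_minus (f g : R -> C) (l m : C) :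
  (forall x, Rcontinuous f x) -> (forall x, Rcontinuous g x) ->
  is_SInt f l -> is_SInt g m -> is_SInt (fun x => f x - g x)%C (l - m)%C.
Proof.
intros Cf Cg Hf Hg eps He.
destruct (Hf (eps / 2)) as [M HM]; [lra|].
destruct (Hg (eps / 2)) as [N HN]; [lra|].
exists (Rmax M N). intros X HX.
specialize (HM X (Rle_trans _ _ _ (Rmax_l M N) HX)).
specialize (HN X (Rle_trans _ _ _ (Rmax_r M N) HX)).
assert (E : CInt (fun x => f x - g x)%C (- X) X = (CInt f (- X) X - CInt g (- X) X)%C).
{ apply CInt_unique, is_CInt_minus; now apply is_CInt_continuous. }
rewrite E.
replace (CInt f (- X) X - CInt g (- X) X - (l - m))%C
  with ((CInt f (- X) X - l) + - (CInt g (- X) X - m))%C by ring.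
apply Rle_trans with (1 := Cmod_triangle _ _). rewrite Cmod_opp. lra.
Qed.

Lemma is_SInt_Cmult (k : C) (f : R -> C) (l : C) :
  (forall x, Rcontinuous f x) ->
  is_SInt f l -> is_SInt (fun x => k * f x)%C (k * l)%C.
Proof.
intros Cf Hf eps He.
assert (Hk := Cmod_ge_0 k).
destruct (Hf (eps / (Cmod k + 1))) as [M HM]; [apply Rdiv_lt_0_compat; lra|].
exists M. intros X HX. specialize (HM X HX).
assert (E : CInt (fun x => k * f x)%C (- X) X = (k * CInt f (- X) X)%C).
{ apply CInt_unique, is_CInt_Cmult; now apply is_CInt_continuous. }
rewrite E.
replace (k * CInt f (- X) X - k * l)%C with (k * (CInt f (- X) X - l))%C by ring.
rewrite Cmod_mult.
apply Rle_trans with ((Cmod k + 1) * (eps / (Cmod k + 1))).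
- apply Rmult_le_compat; try lra; apply Cmod_ge_0.
- apply Req_le. field. lra.
Qed.

Lemma is_SInt_exp (f : R -> C) (C0 b : R) :
  0 < b -> (forall x, Rcontinuous f x) ->
  (forall x, Cmod (f x) <= C0 * exp (- (b * Rabs x))) ->
  is_SInt f (LInt f).
Proof.
intros Hb Cf Hf eps He.
destruct (LInt_exp f C0 b Hb Cf Hf) as [_ H].
destruct (exp_decay_small (2 * C0 / b) b eps Hb He) as (M & HM & Hd).
exists M. intros X HX. apply Rle_trans with (1 := H X ltac:(lra)).
apply Rlt_le. auto.
Qed.

Lemma is_SInt_unique (f : R -> C) (l m : C) : is_SInt f l -> is_SInt f m -> l = m.
Proof.
intros Hl Hm. apply Ceq_epsilon. intros eps He.
destruct (Hl (eps / 2)) as [M HM]; [lra|].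
destruct (Hm (eps / 2)) as [N HN]; [lra|].
specialize (HM _ (Rmax_l M N)). specialize (HN _ (Rmax_r M N)).
set (X := Rmax M N) in *.
replace (l - m)%C with ((CInt f (- X) X - m) + - (CInt f (- X) X - l))%C by ring.
apply Rle_trans with (1 := Cmod_triangle _ _). rewrite Cmod_opp. lra.
Qed.

Lemma Cmod_is_SInt_le (f : R -> C) (C0 b : R) (l : C) :
  0 < b -> (forall x, Rcontinuous f x) ->
  (forall x, Cmod (f x) <= C0 * exp (- (b * Rabs x))) ->
  is_SInt f l -> Cmod l <= 2 * C0 / b.
Proof.
intros Hb Cf Hf H.
rewrite (is_SInt_unique f l (LInt f) H (is_SInt_exp f C0 b Hb Cf Hf)).
now apply Cmod_LInt_le.
Qed.

Lemma is_SInt_ext (f g : R -> C) (l : C) :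
  (forall x, f x = g x) -> is_SInt f l -> is_SInt g l.
Proof.
intros E H eps He. destruct (H eps He) as [M HM]. exists M. intros X HX.
replace (CInt g (- X) X) with (CInt f (- X) X); [auto|].
apply (RInt_ext (V := C_R_CompleteNormedModule)). auto.
Qed.

(** * The bilateral Laplace transform *)

Lemma exp_bound_nonneg (f : R -> C) (C0 b : R) :
  (forall x, Cmod (f x) <= C0 * exp (- (b * Rabs x))) -> 0 <= C0.
Proof.
intros H. specialize (H 0). rewrite Rabs_R0, Rmult_0_r, Ropp_0, exp_0 in H.
apply Rle_trans with (1 := Cmod_ge_0 _) in H. lra.
Qed.

(** Any rate below [b], not [b] itself, so that a polynomial factor does not
    change the exponent ([decays_mult_x]). *)
Definition decays (b : R) (K : R -> C) : Prop :=
  (forall x, Rcontinuous K x) /\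
  forall b', b' < b -> exists C0, forall x, Cmod (K x) <= C0 * exp (- (b' * Rabs x)).

Definition laplace (K : R -> C) (zeta : C) : C :=
  LInt (fun x => Cexp (zeta * RtoC x) * K x)%C.

Definition strip (b : R) (z : C) : Prop := - b < Re z < b.

Lemma open_Re_lt (b : R) : open (fun z : C => Re z < b).
Proof.
apply Copen_iff. intros z Hz. exists (b - Re z). split; [lra|].
intros h Hh. rewrite re_plus. generalize (Re_le_Cmod h). lra.
Qed.

Lemma open_Re_gt (b : R) : open (fun z : C => b < Re z).
Proof.
apply Copen_iff. intros z Hz. exists (Re z - b). split; [lra|].
intros h Hh. rewrite re_plus.
generalize (Re_le_Cmod (- h)%C). rewrite Cmod_opp, re_opp. lra.
Qed.

Lemma open_strip (b : R) : open (strip b).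
Proof. apply (open_and (T := C_UniformSpace)); [apply open_Re_gt|apply open_Re_lt]. Qed.

Lemma decays_mult (b1 b2 : R) (K1 K2 : R -> C) :
  decays b1 K1 -> decays b2 K2 -> decays (b1 + b2) (fun x => K1 x * K2 x)%C.
Proof.
intros [H1 B1] [H2 B2]. split; [intros x; now apply Rcontinuous_mult|].
intros b' Hb'. set (e := (b1 + b2 - b') / 2).
destruct (B1 (b1 - e)) as [C1 HC1]; [unfold e; lra|].
destruct (B2 (b2 - e)) as [C2 HC2]; [unfold e; lra|].
exists (C1 * C2). intros x. rewrite Cmod_mult.
replace (- (b' * Rabs x)) with (- ((b1 - e) * Rabs x) + - ((b2 - e) * Rabs x))
  by (unfold e; field).
rewrite exp_plus.
apply Rle_trans with (C1 * exp (- ((b1 - e) * Rabs x)) * (C2 * exp (- ((b2 - e) * Rabs x))));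
  [|apply Req_le; ring].
apply Rmult_le_compat; auto using Cmod_ge_0.
Qed.

Lemma decays_RtoC : decays 0 RtoC.
Proof.
split; [intros x; apply (Rcontinuous_RtoC (fun x => x)), continuous_id|].
intros b' Hb'. exists (/ - b'). intros x. rewrite Cmod_R.
apply Rmult_le_reg_l with (- b'); [lra|].
rewrite <- Rmult_assoc, Rinv_r, Rmult_1_l by lra.
generalize (exp_ineq1_le (- (b' * Rabs x))). lra.
Qed.

Lemma decays_mult_x (b : R) (K : R -> C) :
  decays b K -> decays b (fun x => RtoC x * K x)%C.
Proof. intros HK. rewrite <- (Rplus_0_l b). now apply decays_mult; [apply decays_RtoC|]. Qed.

Lemma continuous_laplace_integrand (K : R -> C) (zeta : C) (x : R) :
  Rcontinuous K x -> Rcontinuous (fun x => Cexp (zeta * RtoC x) * K x)%C x.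
Proof.
intros H. apply Rcontinuous_mult; trivial.
apply (Rcontinuous_comp Cexp (fun x => zeta * RtoC x)%C).
- apply continuous_Cexp.
- apply Rcontinuous_mult; [apply Rcontinuous_const|].
  apply (Rcontinuous_RtoC (fun x => x)), continuous_id.
Qed.

Lemma Cmod_Cexp_mult_R (zeta : C) (x : R) :
  Cmod (Cexp (zeta * RtoC x)) <= exp (Rabs (Re zeta) * Rabs x).
Proof.
rewrite Cmod_Cexp, Cmult_comm, re_scal_l. apply exp_le.
rewrite <- Rabs_mult, Rmult_comm. apply Rle_abs.
Qed.

Lemma strip_Rabs (b : R) (z : C) : strip b z -> Rabs (Re z) < b.
Proof. intros H. now apply Rabs_lt_between. Qed.

Lemma laplace_bound (b : R) (K : R -> C) (zeta : C) :
  decays b K -> strip b zeta ->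
  exists C0 d, 0 < d /\
    forall x, Cmod (Cexp (zeta * RtoC x) * K x)%C <= C0 * exp (- (d * Rabs x)).
Proof.
intros [_ Kb] Hz. apply strip_Rabs in Hz. set (d := (b - Rabs (Re zeta)) / 2).
destruct (Kb (Rabs (Re zeta) + d)) as [C0 HC]; [unfold d; lra|].
exists C0, d. split; [unfold d; lra|]. intros x. rewrite Cmod_mult.
apply Rle_trans with (exp (Rabs (Re zeta) * Rabs x) *
                      (C0 * exp (- ((Rabs (Re zeta) + d) * Rabs x)))).
{ apply Rmult_le_compat; auto using Cmod_ge_0, Cmod_Cexp_mult_R. }
replace (- ((Rabs (Re zeta) + d) * Rabs x))
  with (- (Rabs (Re zeta) * Rabs x) + - (d * Rabs x)) by ring.
rewrite exp_plus, exp_Ropp. apply Req_le. field. apply Rgt_not_eq, exp_pos.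
Qed.

Lemma is_SInt_laplace (b : R) (K : R -> C) (zeta : C) :
  decays b K -> strip b zeta ->
  is_SInt (fun x => Cexp (zeta * RtoC x) * K x)%C (laplace K zeta).
Proof.
intros HK Hz. destruct (laplace_bound b K zeta HK Hz) as (C0 & d & Hd & H).
apply (is_SInt_exp _ C0 d); trivial.
intros x. apply continuous_laplace_integrand, HK.
Qed.

(** For [|h| <= d] the remainder is at most [|h|^2] times the integral of
    [x^2 |K x| e^((|Re zeta| + d) |x|)], which converges when [|Re zeta| + 2 d < b]. *)
Lemma is_Cderive_laplace (b : R) (K : R -> C) (zeta : C) :
  decays b K -> strip b zeta ->
  is_Cderive (laplace K) zeta (laplace (fun x => RtoC x * K x)%C zeta).
Proof.
intros HK Hz. apply is_Cderive_iff. intros eps Heps.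
assert (HK1 := decays_mult_x b K HK). assert (HK2 := decays_mult_x b _ HK1).
assert (Hz' := strip_Rabs b zeta Hz).
(* Thirds leave a margin: the integrand above decays at rate [d]. *)
set (d := (b - Rabs (Re zeta)) / 3).
assert (Hd : 0 < d) by (unfold d; lra).
destruct (proj2 HK2 (Rabs (Re zeta) + 2 * d)) as [C0 HC]; [unfold d; lra|].
assert (HC0 := exp_bound_nonneg _ _ _ HC).
set (M := 2 * C0 / d + 1).
assert (HM : 0 < M).
{ unfold M. assert (0 <= 2 * C0 / d) by (apply Rdiv_le_0_compat; lra). lra. }
exists (Rmin d (eps / M)). split.
{ apply Rmin_pos; trivial. now apply Rdiv_lt_0_compat. }
intros h Hh.
assert (Hh1 := Rlt_le_trans _ _ _ Hh (Rmin_l _ _)).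
assert (Hh2 := Rlt_le_trans _ _ _ Hh (Rmin_r _ _)).
assert (Hzh : strip b (zeta + h)%C).
{ unfold strip. rewrite re_plus. apply Rabs_lt_between.
  apply Rle_lt_trans with (1 := Rabs_triang _ _).
  generalize (re_le_Cmod h). unfold d in Hh1. lra. }
assert (Hc : forall K' z, decays b K' ->
  forall x, Rcontinuous (fun x => Cexp (z * RtoC x) * K' x)%C x).
{ intros K' z HK' x. apply continuous_laplace_integrand, HK'. }
assert (I1 := is_SInt_laplace b K _ HK Hzh).
assert (I2 := is_SInt_laplace b K _ HK Hz).
assert (I3 := is_SInt_laplace b _ _ HK1 Hz).
apply (is_SInt_Cmult h) in I3; [|now apply Hc].
assert (I12 := is_SInt_minus _ _ _ _ (Hc K _ HK) (Hc K _ HK) I1 I2).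
apply is_SInt_minus with (3 := I12) in I3.
2: { intros x. apply Rcontinuous_minus; now apply Hc. }
2: { intros x. apply Rcontinuous_mult; [apply Rcontinuous_const|now apply Hc]. }
rewrite (Cmult_comm _ h).
apply Rle_trans with (2 * (Cmod h ^ 2 * C0) / d).
- apply Cmod_is_SInt_le with (4 := I3); trivial.
  + intros x.
    apply Rcontinuous_minus; [apply Rcontinuous_minus; now apply Hc|].
    apply Rcontinuous_mult; [apply Rcontinuous_const|now apply Hc].
  + intros x.
    replace (Cexp ((zeta + h) * x) * K x - Cexp (zeta * x) * K x -
             h * (Cexp (zeta * x) * (x * K x)))%C
      with (Cexp (zeta * x) * ((Cexp (h * x) - RtoC 1 - h * x) * K x))%C.
    2: { rewrite Cmult_plus_distr_r, Cexp_plus. ring. }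
    rewrite !Cmod_mult.
    assert (HR := Cmod_Cexp_remainder (h * RtoC x)%C).
    rewrite Cmod_mult, Cmod_R in HR.
    specialize (HC x). rewrite !Cmod_mult, Cmod_R in HC.
    apply Rle_trans with (exp (Rabs (Re zeta) * Rabs x) *
      ((Cmod h * Rabs x) ^ 2 * exp (Cmod h * Rabs x) * Cmod (K x))).
    { apply Rmult_le_compat; auto using Cmod_ge_0, Cmod_Cexp_mult_R.
      - apply Rmult_le_pos; apply Cmod_ge_0.
      - apply Rmult_le_compat_r; auto using Cmod_ge_0. }
    replace (exp (Rabs (Re zeta) * Rabs x) *
      ((Cmod h * Rabs x) ^ 2 * exp (Cmod h * Rabs x) * Cmod (K x)))
      with (exp (Rabs (Re zeta) * Rabs x) * exp (Cmod h * Rabs x) * Cmod h ^ 2 *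
            (Rabs x * (Rabs x * Cmod (K x)))) by ring.
    apply Rle_trans with (exp (Rabs (Re zeta) * Rabs x) * exp (d * Rabs x) * Cmod h ^ 2 *
       (C0 * exp (- ((Rabs (Re zeta) + 2 * d) * Rabs x)))).
    { apply Rmult_le_compat; trivial.
      - repeat apply Rmult_le_pos; try (apply Rlt_le, exp_pos); try apply Cmod_ge_0; lra.
      - repeat apply Rmult_le_pos; try apply Rabs_pos; apply Cmod_ge_0.
      - apply Rmult_le_compat_r; [apply pow2_ge_0|].
        apply Rmult_le_compat_l; [apply Rlt_le, exp_pos|].
        apply exp_le, Rmult_le_compat_r; [apply Rabs_pos|lra]. }
    replace (- ((Rabs (Re zeta) + 2 * d) * Rabs x))
      with (- (Rabs (Re zeta) * Rabs x) + (- (d * Rabs x) + - (d * Rabs x))) by ring.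
    rewrite !exp_plus, !exp_Ropp. apply Req_le. field.
    split; apply Rgt_not_eq, exp_pos.
- apply (Rmult_lt_compat_r M) in Hh2; trivial.
  replace (eps / M * M) with eps in Hh2 by (field; lra).
  replace (2 * (Cmod h ^ 2 * C0) / d) with (Cmod h * (2 * C0 / d) * Cmod h) by (field; lra).
  apply Rmult_le_compat_r; [apply Cmod_ge_0|].
  unfold M in Hh2. generalize (Cmod_ge_0 h). lra.
Qed.

Lemma holomorphic_laplace (b : R) (K : R -> C) :
  decays b K -> holomorphic (strip b) (laplace K).
Proof.
intros HK n. revert K HK. induction n as [|n IH]; intros K HK; [easy|].
apply holomorphic_upto_S with (laplace (fun x => RtoC x * K x)%C).
- apply open_strip.
- intros z Hz. now apply (is_Cderive_laplace b).
- now apply IH, decays_mult_x.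
Qed.

(** * Horizontal lines *)

Lemma open_Im_lt (b : R) : open (fun z : C => Im z < b).
Proof.
apply Copen_iff. intros z Hz. exists (b - Im z). split; [lra|].
intros h Hh. rewrite im_plus. generalize (Rmax_Cmod h) (Rmax_r (Rabs (fst h)) (Rabs (snd h))) (Rle_abs (Im h)).
unfold Im in *. lra.
Qed.

Lemma open_Im_gt (b : R) : open (fun z : C => b < Im z).
Proof.
apply Copen_iff. intros z Hz. exists (Im z - b). split; [lra|].
intros h Hh. rewrite im_plus. generalize (Rmax_Cmod h) (Rmax_r (Rabs (fst h)) (Rabs (snd h))) (Rle_abs (- Im h)).
rewrite Rabs_Ropp. unfold Im in *. lra.
Qed.

Definition band (a b : R) (z : C) : Prop := a < Im z < b.

Lemma open_band (a b : R) : open (band a b).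
Proof. apply (open_and (T := C_UniformSpace)); [apply open_Im_gt|apply open_Im_lt]. Qed.

Lemma Im_segment (a z : C) (t : R) :
  Im (a + RtoC t * (z - a)) = (1 - t) * Im a + t * Im z.
Proof. destruct a, z; simpl; ring. Qed.

Lemma Re_segment (a z : C) (t : R) :
  Re (a + RtoC t * (z - a)) = (1 - t) * Re a + t * Re z.
Proof. destruct a, z; simpl; ring. Qed.

Lemma convex_between (a b x y t : R) :
  a < x < b -> a < y < b -> 0 <= t <= 1 -> a < (1 - t) * x + t * y < b.
Proof. intros. destruct (Rle_dec t (1/2)); nra. Qed.

Lemma convex_band (a b : R) : Cconvex (band a b).
Proof.
intros p Hp z t Hz Ht. unfold band. rewrite Im_segment. now apply convex_between.
Qed.

Lemma convex_strip (b : R) : Cconvex (strip b).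
Proof.
intros p Hp z t Hz Ht. unfold strip. rewrite Re_segment. now apply convex_between.
Qed.

Definition horizontal (eta x : R) : C := (RtoC x + Ci * RtoC eta)%C.

Lemma Re_horizontal (eta x : R) : Re (horizontal eta x) = x.
Proof. simpl. ring. Qed.

Lemma Im_horizontal (eta x : R) : Im (horizontal eta x) = eta.
Proof. simpl. ring. Qed.

Lemma Rcontinuous_horizontal (f : C -> C) (eta x : R) :
  continuous f (horizontal eta x) -> Rcontinuous (fun s => f (horizontal eta s)) x.
Proof.
intros Hf. apply (Rcontinuous_comp f); trivial. unfold horizontal.
apply Rcontinuous_plus; [|apply Rcontinuous_const].
apply (Rcontinuous_RtoC (fun x => x)), continuous_id.
Qed.

(** With [Cmod_vertical] this moves integrals between horizontal lines: a
    primitive gives both lines, and the two vertical sides tend to 0. *)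
Lemma is_CInt_horizontal (F f : C -> C) (eta a b : R) :
  (forall x, Rmin a b <= x <= Rmax a b -> is_Cderive F (horizontal eta x) (f (horizontal eta x))) ->
  (forall x, Rmin a b <= x <= Rmax a b -> continuous f (horizontal eta x)) ->
  is_CInt (fun x => f (horizontal eta x)) a b (F (horizontal eta b) - F (horizontal eta a))%C.
Proof.
intros HF Hf. apply (is_CInt_derive (fun x => F (horizontal eta x))); intros x Hx.
- replace (f (horizontal eta x)) with (f (horizontal eta x) * RtoC 1)%C by ring.
  apply is_Rderive_comp; [now apply HF|].
  apply (is_derive_ext (V := C_R_NormedModule) (fun s => Ci * RtoC eta + RtoC s * RtoC 1)%C).
  + intros s. unfold horizontal. change ((Ci * eta + s * 1)%C = (s + Ci * eta)%C). ring.
  + apply is_Rderive_affine.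
- now apply Rcontinuous_horizontal, Hf.
Qed.

Lemma Cmod_vertical (F f : C -> C) (x y1 y2 eps : R) :
  y1 <= y2 ->
  (forall y, y1 <= y <= y2 -> is_Cderive F (horizontal y x) (f (horizontal y x))) ->
  (forall y, y1 <= y <= y2 -> continuous f (horizontal y x)) ->
  (forall y, y1 <= y <= y2 -> Cmod (f (horizontal y x)) <= eps) ->
  Cmod (F (horizontal y2 x) - F (horizontal y1 x))%C <= eps * (y2 - y1).
Proof.
intros Hy HF Hf He.
set (k := (Ci * RtoC (y2 - y1))%C).
assert (Hp : forall s, (horizontal y1 x + RtoC s * k)%C = horizontal (y1 + s * (y2 - y1)) x).
{ intros s. unfold horizontal, k. rewrite RtoC_plus, RtoC_mult. ring. }
assert (Hs : forall s, 0 <= s <= 1 -> y1 <= y1 + s * (y2 - y1) <= y2) by (intros; nra).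
replace (horizontal y2 x) with (horizontal y1 x + k)%C.
2: { unfold horizontal, k. rewrite RtoC_minus. ring. }
replace (eps * (y2 - y1)) with ((1 - 0) * (eps * (y2 - y1))) by ring.
apply Cmod_is_CInt_le_const with (fun s => f (horizontal y1 x + RtoC s * k) * k)%C; [lra| |].
- intros s H. rewrite Hp, Cmod_mult. apply Rmult_le_compat; auto using Cmod_ge_0.
  unfold k. rewrite Cmod_mult, Cmod_Ci, Cmod_R, Rabs_pos_eq; lra.
- apply is_CInt_segment; intros s H; rewrite Hp; auto.
Qed.

Lemma is_Cderive_Csinh (z : C) : is_Cderive Csinh z ((Cexp z + Cexp (- z)) / 2)%C.
Proof.
apply (is_Cderive_ext_on (fun _ => True)
  (fun w => / RtoC 2 * (Cexp w + RtoC (-1) * Cexp (RtoC (-1) * w)))%C).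
- apply open_True.
- intros w _. unfold Csinh, Cdiv. rewrite !RtoC_m1_mult. ring.
- trivial.
- replace ((Cexp z + Cexp (- z)) / 2)%C with
    (/ RtoC 2 * (Cexp z + RtoC (-1) * (Cexp (RtoC (-1) * z) * RtoC (-1))))%C.
  2: { rewrite (Cmult_comm (Cexp _) (RtoC (-1))), !RtoC_m1_mult. unfold Cdiv. ring. }
  apply is_Cderive_scal, is_Cderive_plus; [apply is_Cderive_Cexp|].
  apply is_Cderive_scal, is_Cderive_comp_linear, is_Cderive_Cexp.
Qed.

Lemma Cexp_Ci_PI : Cexp (RtoC PI * Ci) = RtoC (-1).
Proof. rewrite Cmult_comm, Cexp_Ci, cos_PI, sin_PI. reflexivity. Qed.

Lemma Csinh_shift (z : C) : Csinh (RtoC PI * (z + Ci)) = (- Csinh (RtoC PI * z))%C.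
Proof.
unfold Csinh. rewrite Cmult_plus_distr_l, Cexp_plus, Cexp_Ci_PI.
replace (- (RtoC PI * z + RtoC PI * Ci))%C with (- (RtoC PI * z) + - (RtoC PI * Ci))%C by ring.
rewrite Cexp_plus, (Cexp_opp (RtoC PI * Ci)), Cexp_Ci_PI.
rewrite RtoC_m1.
field.
Qed.

Lemma Csinh_PI_eq_0 (z : C) :
  Csinh (RtoC PI * z) = RtoC 0 -> exists n : Z, z = (Ci * RtoC (IZR n))%C.
Proof.
intros H. destruct (Csinh_eq_0 _ H) as [n Hn]. exists n.
assert (Hpi : RtoC PI <> RtoC 0) by (intros E; injection E; apply PI_neq0).
replace z with (/ RtoC PI * (RtoC PI * z))%C by (field; trivial).
rewrite Hn, RtoC_mult. field. trivial.
Qed.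

Lemma Csinh_horizontal_lower (a x : R) :
  Rabs (sin (a / 2)) / 2 * exp (a * Rabs x) <= Cmod (Csinh (RtoC a * horizontal (/ 2) x)).
Proof.
apply Rle_trans with (2 := Csinh_ge_cosh _).
rewrite re_scal_l, im_scal_l, Re_horizontal, Im_horizontal.
replace (a * / 2) with (a / 2) by field.
apply Rle_trans with (Rabs (sin (a / 2)) * (exp (Rabs (a * x)) / 2)).
- apply Rle_trans with (Rabs (sin (a / 2)) * (exp (a * Rabs x) / 2)); [apply Req_le; field|].
  apply Rmult_le_compat_l; [apply Rabs_pos|].
  apply Rmult_le_compat_r; [lra|]. apply exp_le. rewrite Rabs_mult.
  apply Rmult_le_compat_r; [apply Rabs_pos|apply Rle_abs].
- apply Rmult_le_compat_l; [apply Rabs_pos|apply cosh_ge_exp].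
Qed.

(** The zeros of [sinh (a z)] are the [i PI n / a], and [PI / a >= 1]. *)
Lemma Csinh_band_neq_0 (a : R) (z : C) :
  0 < a <= PI -> band 0 1 z -> Csinh (RtoC a * z) <> RtoC 0.
Proof.
intros Ha [H0 H1] E.
assert (H := Csinh_ge_cosh (RtoC a * z)). rewrite E, Cmod_0, im_scal_l in H.
assert (0 < sin (a * Im z)) by (apply sin_gt_0; nra).
assert (Hc := cosh_ge_exp (Re (RtoC a * z))).
assert (He := exp_pos (Rabs (Re (RtoC a * z)))).
rewrite Rabs_pos_eq in H by lra. nra.
Qed.

(** * Kernels on the line Im z = 1/2 *)

Lemma holomorphic_linear (U : C -> Prop) (a : C) :
  open U -> holomorphic U (fun z => a * z)%C.
Proof.
intros HU. apply holomorphic_mult; trivial.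
- now apply holomorphic_const.
- now apply holomorphic_id.
Qed.

Lemma decays_horizontal (f : C -> C) (C0 b : R) :
  0 <= C0 -> holomorphic (band 0 1) f ->
  (forall x, Cmod (f (horizontal (/ 2) x)) <= C0 * exp (- (b * Rabs x))) ->
  decays b (fun x => f (horizontal (/ 2) x)).
Proof.
intros HC Hf Hb. split.
- intros x. apply Rcontinuous_horizontal, (holomorphic_continuous (band 0 1)); trivial.
  unfold band. rewrite Im_horizontal. lra.
- intros b' Hb'. exists C0. intros x. apply Rle_trans with (1 := Hb x).
  apply Rmult_le_compat_l; trivial. apply exp_le. generalize (Rabs_pos x). nra.
Qed.

Lemma horizontal_half_band (x : R) : band 0 1 (horizontal (/ 2) x).
Proof. unfold band. rewrite Im_horizontal. lra. Qed.

Lemma horizontal_half_neq_0 (x : R) : horizontal (/ 2) x <> RtoC 0.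
Proof. intros E. apply (f_equal Im) in E. rewrite Im_horizontal in E. simpl in E. lra. Qed.

(** On the line, [|sinh (a z)|] is at least [sin (a / 2) cosh (a x)]. *)
Lemma decays_inv_Csinh (a : R) :
  0 < a <= PI -> decays a (fun x => / Csinh (RtoC a * horizontal (/ 2) x))%C.
Proof.
intros Ha. assert (Hs : 0 < sin (a / 2)) by (apply sin_gt_0; lra).
apply (decays_horizontal (fun z => / Csinh (RtoC a * z))%C (2 / sin (a / 2))).
- apply Rdiv_le_0_compat; lra.
- apply holomorphic_inv; [apply open_band| |].
  + intros z Hz. now apply Csinh_band_neq_0.
  + apply holomorphic_Csinh, holomorphic_linear; apply open_band.
- intros x. rewrite Cmod_inv by now apply Csinh_band_neq_0, horizontal_half_band.
  assert (H := Csinh_horizontal_lower a x). rewrite Rabs_pos_eq in H by lra.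
  assert (He := exp_pos (a * Rabs x)).
  rewrite exp_Ropp. replace (2 / sin (a / 2) * / exp (a * Rabs x))
    with (/ (sin (a / 2) / 2 * exp (a * Rabs x))) by (field; lra).
  apply Rinv_le_contravar; trivial. nra.
Qed.

Lemma decays_inv_horizontal : decays 0 (fun x => / horizontal (/ 2) x)%C.
Proof.
apply (decays_horizontal Cinv 2); [lra| |].
- apply holomorphic_inv; [apply open_band| |apply holomorphic_id, open_band].
  intros z [H _] ->. simpl in H. lra.
- intros x. rewrite Cmod_inv by apply horizontal_half_neq_0.
  rewrite Rmult_0_l, Ropp_0, exp_0, Rmult_1_r.
  apply Rle_trans with (/ / 2); [|rewrite Rinv_inv; lra].
  apply Rinv_le_contravar; [lra|].
  apply Rle_trans with (2 := Rmax_Cmod _), Rle_trans with (2 := Rmax_r _ _).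
  change (/ 2 <= Rabs (Im (horizontal (/ 2) x))). rewrite Im_horizontal, Rabs_pos_eq; lra.
Qed.

Definition recip_sinh (x : R) : C := (/ Csinh (RtoC PI * horizontal (/ 2) x))%C.

Lemma decays_recip_sinh : decays PI recip_sinh.
Proof. apply decays_inv_Csinh. generalize PI_RGT_0. lra. Qed.

(** * The integral of e^(zeta z) / sinh (pi z) *)

Lemma RtoC_neq_0 (x : R) : x <> 0 -> RtoC x <> RtoC 0.
Proof. intros H E. apply H. now injection E. Qed.

Lemma C_derive_Csinh_Ci : C_derive (fun z => Csinh (RtoC PI * z)) Ci = (- RtoC PI)%C.
Proof.
apply is_C_derive_unique.
replace (- RtoC PI)%C with
  ((Cexp (RtoC PI * Ci) + Cexp (- (RtoC PI * Ci))) / 2 * RtoC PI)%C.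
- apply is_Cderive_comp_linear, is_Cderive_Csinh.
- rewrite Cexp_opp, Cexp_Ci_PI, RtoC_m1. field.
Qed.

Lemma Cmod_Cexp_horizontal (zeta : C) (x y : R) :
  0 <= y <= 2 ->
  Cmod (Cexp (zeta * horizontal y x)) <= exp (2 * Rabs (Im zeta)) * exp (Rabs (Re zeta) * Rabs x).
Proof.
intros Hy. rewrite Cmod_Cexp, <- exp_plus. apply exp_le.
replace (Re (zeta * horizontal y x)) with (Re zeta * x - Im zeta * y)
  by (destruct zeta; simpl; ring).
generalize (Rle_abs (Re zeta * x)) (Rle_abs (- Im zeta)) (Rabs_pos (Im zeta)).
rewrite Rabs_mult, Rabs_Ropp. intros. nra.
Qed.

Lemma atan_le_id (y : R) : 0 < y -> atan y <= y.
Proof.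
intros Hy.
destruct (MVT_gen atan 0 y (fun x => / (1 + x²))) as (c & Hc & E).
- intros x _. apply is_derive_atan.
- intros x _. apply continuity_pt_filterlim, (ex_derive_continuous (V := R_NormedModule)).
  eexists. apply is_derive_atan.
- rewrite Rmin_left, Rmax_right in Hc by lra. rewrite atan_0, !Rminus_0_r in E.
  rewrite E. assert (H := Rle_0_sqr c).
  assert (/ (1 + c²) <= / 1) by (apply Rinv_le_contravar; lra).
  rewrite Rinv_1 in H0. nra.
Qed.

(** This integral is the difference of those of [1 / (z - i)] over the lines
    [Im z = 1/2] and [Im z = 3/2], up to the factor [i]. *)
Lemma is_SInt_atan : is_SInt (fun x => RtoC (/ (x ^ 2 + / 4))) (RtoC (2 * PI)).
Proof.
intros eps He.
assert (Hd : forall X, CInt (fun x => RtoC (/ (x ^ 2 + / 4))) (- X) X = RtoC (4 * atan (2 * X))).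
{ intros X. apply CInt_unique.
  replace (RtoC (4 * atan (2 * X))) with (RtoC (2 * atan (2 * X)) - RtoC (2 * atan (2 * - X)))%C.
  2: { rewrite <- RtoC_minus. f_equal. rewrite <- Ropp_mult_distr_r, atan_opp. ring. }
  apply (is_CInt_derive (fun x => RtoC (2 * atan (2 * x)))); intros x _.
  - apply is_Rderive_pair; simpl.
    + auto_derive; trivial. unfold Rsqr. field. nra.
    + apply (is_derive_const (K := R_AbsRing) (V := R_NormedModule)).
  - apply (Rcontinuous_RtoC (fun x => / (x ^ 2 + / 4))).
    apply (ex_derive_continuous (V := R_NormedModule)). auto_derive. nra. }
destruct (inv_small 2 (eps) He) as (M & HM1 & HM); [lra|].
exists M. intros X HX. rewrite Hd, <- RtoC_minus, Cmod_R.
assert (E : atan (2 * X) = PI / 2 - atan (/ (2 * X))) by (rewrite atan_inv; lra).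
rewrite E. replace (4 * (PI / 2 - atan (/ (2 * X))) - 2 * PI) with (- (4 * atan (/ (2 * X)))) by field.
rewrite Rabs_Ropp.
assert (Hp : 0 < / (2 * X)) by (apply Rinv_0_lt_compat; lra).
assert (H0 : 0 < atan (/ (2 * X))) by (rewrite <- atan_0; now apply atan_increasing).
rewrite Rabs_pos_eq by lra.
assert (H1 : atan (/ (2 * X)) <= / (2 * X)).
{ now apply atan_le_id. }
specialize (HM X HX).
replace (2 / X) with (4 * / (2 * X)) in HM by (field; lra). lra.
Qed.

Lemma Ci_band : band 0 2 Ci.
Proof. unfold band. simpl. lra. Qed.

Lemma Csinh_PI_band (z : C) : band 0 2 z -> Csinh (RtoC PI * z) = RtoC 0 -> z = Ci.
Proof.
intros [H0 H2] H. destruct (Csinh_PI_eq_0 z H) as [n Hn].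
assert (Im z = IZR n) as E by (rewrite Hn; simpl; ring).
rewrite E in H0, H2. apply lt_IZR in H0, H2.
assert (n = 1%Z) as -> by lia. rewrite Hn. ring.
Qed.

(** The residue of [e^(zeta z) / sinh (PI z)] at [i] is [- e^(i zeta) / PI]; what
    is left after subtracting the pole is a difference quotient, hence
    holomorphic at [i] too. *)
Lemma removed_pole (zeta : C) :
  exists H : C -> C, holomorphic (band 0 2) H /\
    forall z, band 0 2 z -> z <> Ci ->
      H z = (Cexp (zeta * z) / Csinh (RtoC PI * z)
             + Cexp (Ci * zeta) / RtoC PI / (z - Ci))%C.
Proof.
assert (HU := open_band 0 2). assert (Hci := Ci_band).
assert (Hs := convex_band 0 2 Ci Hci).
assert (Hpi := RtoC_neq_0 PI PI_neq0).
set (h z := Csinh (RtoC PI * z)).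
assert (Hh : holomorphic (band 0 2) h) by now apply holomorphic_Csinh, holomorphic_linear.
assert (Hh0 : h Ci = RtoC 0).
{ unfold h, Csinh. rewrite Cexp_opp, Cexp_Ci_PI.
  rewrite RtoC_m1.
  field. }
set (k := slope h Ci).
assert (Hk : holomorphic (band 0 2) k) by now apply holomorphic_slope.
assert (Ehk : forall z, band 0 2 z -> h z = ((z - Ci) * k z)%C).
{ intros z Hz. unfold k. rewrite (slope_eq (band 0 2)) by trivial. rewrite Hh0. ring. }
assert (Ek : k Ci = (- RtoC PI)%C).
{ unfold k. rewrite slope_diag. apply C_derive_Csinh_Ci. }
assert (Hk0 : forall z, band 0 2 z -> k z <> RtoC 0).
{ intros z Hz E. assert (z = Ci) as ->.
  { apply Csinh_PI_band; trivial. fold (h z). rewrite Ehk, E by trivial. ring. }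
  rewrite Ek in E. apply Hpi. replace (RtoC PI) with (- - RtoC PI)%C by ring.
  rewrite E. ring. }
set (G z := (Cexp (zeta * z) / k z)%C).
assert (HG : holomorphic (band 0 2) G).
{ apply holomorphic_div; trivial.
  now apply holomorphic_Cexp_comp, holomorphic_linear. }
exists (slope G Ci). split; [now apply holomorphic_slope|].
intros z Hz Hzi. assert (Hd := Cminus_eq_contra _ _ Hzi).
assert (E := slope_eq (band 0 2) G Ci z Hs HG Hz).
replace (slope G Ci z) with ((G z - G Ci) / (z - Ci))%C by (rewrite <- E; field; trivial).
fold (h z). rewrite Ehk by trivial. unfold G. rewrite Ek, (Cmult_comm zeta Ci).
field. repeat split; auto.
Qed.

Lemma Csinh_lower (a rho x y : R) :
  0 < a -> 0 < rho -> rho <= Rabs x ->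
  (1 - exp (- (2 * (a * rho)))) / 2 * exp (a * Rabs x)
  <= Cmod (Csinh (RtoC a * horizontal y x)).
Proof.
intros Ha Hr Hx. apply Rle_trans with (2 := Csinh_ge_sinh _).
rewrite re_scal_l, Re_horizontal.
assert (E : Rabs (a * x) = a * Rabs x) by (rewrite Rabs_mult, (Rabs_pos_eq a); lra).
rewrite <- E. apply sinh_ge_exp. rewrite E. nra.
Qed.

Lemma Csinh_lower_pos (a rho : R) :
  0 < a -> 0 < rho -> 0 < (1 - exp (- (2 * (a * rho)))) / 2.
Proof.
intros Ha Hr. assert (H : exp (- (2 * (a * rho))) < exp 0) by (apply exp_increasing; nra).
rewrite exp_0 in H. lra.
Qed.

Lemma vertical_decay (zeta : C) :
  strip PI zeta ->
  forall eps, 0 < eps -> exists M, 1 <= M /\ forall x y, M <= Rabs x -> 0 <= y <= 2 ->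
    Cmod (Cexp (zeta * horizontal y x) / Csinh (RtoC PI * horizontal y x)
          + Cexp (Ci * zeta) / RtoC PI / (horizontal y x - Ci))%C <= eps.
Proof.
intros Hz eps Heps. apply strip_Rabs in Hz.
assert (Hpi := PI_RGT_0).
set (d := PI - Rabs (Re zeta)). assert (Hd : 0 < d) by (unfold d; lra).
set (c := (1 - exp (- (2 * (PI * 1)))) / 2).
assert (Hc : 0 < c) by (apply Csinh_lower_pos; lra).
set (A := exp (2 * Rabs (Im zeta)) / c).
destruct (exp_decay_small A d (eps / 2) Hd) as (M1 & _ & HM1); [lra|].
set (B := Cmod (Cexp (Ci * zeta) / RtoC PI)).
destruct (inv_small B (eps / 2)) as (M2 & HM2 & HB); [lra|apply Cmod_ge_0|].
exists (Rmax M1 M2). split; [generalize (Rmax_r M1 M2); lra|].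
intros x y Hx Hy.
assert (Hx1 := Rle_trans _ _ _ (Rmax_l M1 M2) Hx).
assert (Hx2 := Rle_trans _ _ _ (Rmax_r M1 M2) Hx).
assert (Hx0 : 1 <= Rabs x) by lra.
apply Rle_trans with (1 := Cmod_triangle _ _).
assert (HS : c * exp (PI * Rabs x) <= Cmod (Csinh (RtoC PI * horizontal y x)))
  by (apply Csinh_lower; lra).
assert (He := exp_pos (PI * Rabs x)).
assert (HS0 : 0 < Cmod (Csinh (RtoC PI * horizontal y x))) by nra.
assert (Hw : Rabs x <= Cmod (horizontal y x - Ci)).
{ apply Rle_trans with (2 := re_le_Cmod _). apply Req_le. f_equal. simpl. ring. }
rewrite !(Cmod_div _ (horizontal y x - Ci)%C) by (apply Cmod_gt_0; lra).
rewrite (Cmod_div _ (Csinh _)) by now apply Cmod_gt_0.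
fold B.
assert (T1 : Cmod (Cexp (zeta * horizontal y x)) / Cmod (Csinh (RtoC PI * horizontal y x))
             <= A * exp (- (d * Rabs x))).
{ apply Rle_trans with
    (exp (2 * Rabs (Im zeta)) * exp (Rabs (Re zeta) * Rabs x) / (c * exp (PI * Rabs x))).
  - apply Rmult_le_compat; [apply Cmod_ge_0| |now apply Cmod_Cexp_horizontal|].
    + now apply Rlt_le, Rinv_0_lt_compat.
    + apply Rinv_le_contravar; trivial. nra.
  - unfold A, d.
    replace (- ((PI - Rabs (Re zeta)) * Rabs x))
      with (Rabs (Re zeta) * Rabs x + - (PI * Rabs x)) by ring.
    rewrite exp_plus, (exp_Ropp (PI * Rabs x)). apply Req_le. field. lra. }
assert (T2 : B / Cmod (horizontal y x - Ci) <= B / Rabs x).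
{ apply Rmult_le_compat_l; [apply Cmod_ge_0|]. apply Rinv_le_contravar; lra. }
specialize (HM1 _ Hx1). specialize (HB _ Hx2). lra.
Qed.

(** The function [H] of [removed_pole] has the same integral over the lines
    [Im z = 1/2] and [Im z = 3/2]. As [sinh (PI (z + i)) = - sinh (PI z)], its
    main part contributes [1 + e^(i zeta)] times the integral sought, and the
    subtracted pole contributes an arctangent integral. *)
Theorem laplace_recip_sinh (zeta : C) :
  strip PI zeta ->
  (Cexp (Ci * RtoC (/ 2) * zeta) * laplace recip_sinh zeta * (RtoC 1 + Cexp (Ci * zeta))
   = - (2 * Ci * Cexp (Ci * zeta)))%C.
Proof.
intros Hz.
assert (HU := open_band 0 2). assert (Hci := Ci_band).
assert (Hpi := RtoC_neq_0 PI PI_neq0).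
destruct (removed_pole zeta) as (H & HH & EH).
destruct (holomorphic_primitive (band 0 2) H Ci HU (convex_band 0 2 Ci Hci) HH) as [F HF].
assert (Hc : forall z, band 0 2 z -> continuous H z).
{ intros z. now apply holomorphic_continuous. }
assert (Hb : forall y x, / 2 <= y <= 3 / 2 -> band 0 2 (horizontal y x)).
{ intros y x Hy. unfold band. rewrite Im_horizontal. lra. }
set (D x := (H (horizontal (/ 2) x) - H (horizontal (3 / 2) x))%C).
assert (HD : is_SInt D (RtoC 0)).
{ intros eps Heps.
  destruct (vertical_decay zeta Hz (eps / 2)) as (M & HM1 & HM); [lra|].
  exists M. intros X HX.
  assert (I1 : forall y, / 2 <= y <= 3 / 2 ->
    is_CInt (fun x => H (horizontal y x)) (- X) X (F (horizontal y X) - F (horizontal y (- X)))%C).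
  { intros y Hy. apply is_CInt_horizontal; auto. }
  assert (V : forall x, M <= Rabs x ->
    Cmod (F (horizontal (3 / 2) x) - F (horizontal (/ 2) x))%C <= eps / 2).
  { intros x Hx. replace (eps / 2) with (eps / 2 * (3 / 2 - / 2)) by field.
    apply Cmod_vertical with H; auto; [lra|].
    intros y Hy. rewrite EH by (auto; intros E; apply (f_equal Re) in E;
      rewrite Re_horizontal in E; simpl in E; rewrite E, Rabs_R0 in Hx; lra).
    apply HM; lra. }
  unfold D. rewrite (CInt_unique _ _ _ _ (is_CInt_minus _ _ _ _ _ _ (I1 (/ 2) ltac:(lra)) (I1 (3 / 2) ltac:(lra)))).
  assert (V1 := V X). assert (V2 := V (- X)). rewrite Rabs_Ropp in V2.
  rewrite Rabs_pos_eq in V1, V2 by lra.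
  specialize (V1 HX). specialize (V2 HX).
  match goal with |- Cmod ?e <= _ => replace e with
    ((F (horizontal (3 / 2) (- X)) - F (horizontal (/ 2) (- X))) +
     - (F (horizontal (3 / 2) X) - F (horizontal (/ 2) X)))%C by ring end.
  apply Rle_trans with (1 := Cmod_triangle _ _). rewrite Cmod_opp. lra. }
set (e := Cexp (Ci * RtoC (/ 2) * zeta)).
set (s := Cexp (Ci * zeta)).
assert (Ee : forall x, Cexp (zeta * horizontal (/ 2) x) = (e * Cexp (zeta * x))%C).
{ intros x. unfold e, horizontal. rewrite <- Cexp_plus. f_equal. ring. }
assert (Hhor : forall x, horizontal (3 / 2) x = (horizontal (/ 2) x + Ci)%C).
{ intros x. apply injective_projections; simpl; field. }
assert (ED : forall x, D x =
  (e * (RtoC 1 + s) * (Cexp (zeta * RtoC x) * recip_sinh x)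
   - (- (s / RtoC PI * Ci)) * RtoC (/ (x ^ 2 + / 4)))%C).
{ intros x. unfold D. rewrite !EH.
  2: { apply Hb; lra. }
  2: { intros E. apply (f_equal Im) in E. rewrite Im_horizontal in E. simpl in E. lra. }
  2: { apply Hb; lra. }
  2: { intros E. apply (f_equal Im) in E. rewrite Im_horizontal in E. simpl in E. lra. }
  rewrite Hhor, Csinh_shift, Cmult_plus_distr_l, Cexp_plus, Ee.
  rewrite (Cmult_comm zeta Ci). fold s. unfold recip_sinh.
  assert (Hs0 : Csinh (RtoC PI * horizontal (/ 2) x) <> RtoC 0).
  { apply Csinh_band_neq_0; [generalize PI_RGT_0; lra|].
    unfold band. rewrite Im_horizontal. lra. }
  set (S := Csinh (RtoC PI * horizontal (/ 2) x)) in *.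
  assert (Hq : (horizontal (/ 2) x - Ci)%C <> RtoC 0).
  { apply Cminus_eq_contra. intros E. apply (f_equal Im) in E.
    rewrite Im_horizontal in E. simpl in E. lra. }
  assert (Hq' : horizontal (/ 2) x <> RtoC 0).
  { intros E. apply (f_equal Im) in E. rewrite Im_horizontal in E. simpl in E. lra. }
  assert (Hq2 : RtoC (x ^ 2 + / 4) = ((horizontal (/ 2) x - Ci) * horizontal (/ 2) x)%C).
  { apply injective_projections; simpl; field. }
  rewrite RtoC_inv, Hq2 by nra.
  set (w := horizontal (/ 2) x) in *.
  replace (w + Ci - Ci)%C with w by ring.
  field. repeat split; trivial. }
assert (HK := decays_recip_sinh).
assert (Hcl : forall x, Rcontinuous (fun x => Cexp (zeta * RtoC x) * recip_sinh x)%C x).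
{ intros x. apply continuous_laplace_integrand, HK. }
assert (Hca : forall x, Rcontinuous (fun x => RtoC (/ (x ^ 2 + / 4))) x).
{ intros x. apply (Rcontinuous_RtoC (fun x => / (x ^ 2 + / 4))).
  apply (ex_derive_continuous (V := R_NormedModule)). auto_derive. nra. }
assert (L := is_SInt_minus _ _ _ _
  (fun x => Rcontinuous_mult _ _ x (Rcontinuous_const _ x) (Hcl x))
  (fun x => Rcontinuous_mult _ _ x (Rcontinuous_const _ x) (Hca x))
  (is_SInt_Cmult (e * (RtoC 1 + s))%C _ _ Hcl (is_SInt_laplace PI recip_sinh zeta HK Hz))
  (is_SInt_Cmult (- (s / RtoC PI * Ci))%C _ _ Hca is_SInt_atan)).
apply (is_SInt_ext _ D) in L; [|intros x; now rewrite ED].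
assert (E := is_SInt_unique _ _ _ HD L).
replace (e * laplace recip_sinh zeta * (RtoC 1 + s))%C
  with (e * (RtoC 1 + s) * laplace recip_sinh zeta)%C by ring.
match type of E with _ = (?a - ?b)%C =>
  replace a with (a - b + b)%C by ring; rewrite <- E end.
rewrite RtoC_mult. field. trivial.
Qed.

(** * Faddeev's integral on the line Im z = 1/2 *)

(** The plane below [Im z = 1], cut along the nonpositive imaginary axis, contains
    the contour and no pole of the integrand, and is star-shaped about any point
    of its part of the imaginary axis. *)
Definition slit (z : C) : Prop := Im z < 1 /\ (Re z < 0 \/ 0 < Re z \/ 0 < Im z).

Lemma open_slit : open slit.
Proof.
apply (open_and (T := C_UniformSpace)); [apply open_Im_lt|].
apply (open_or (T := C_UniformSpace)); [apply open_Re_lt|].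
apply (open_or (T := C_UniformSpace)); [apply open_Re_gt|apply open_Im_gt].
Qed.

Lemma star_slit : star_shaped (horizontal (/ 2) 0) slit.
Proof.
intros z t [H1 H2] Ht. unfold slit.
rewrite Re_segment, Im_segment, Re_horizontal, Im_horizontal.
split; [destruct (Rle_dec t (/ 2)); nra|].
destruct (Req_dec t 0) as [->|Ht0].
- right; right. lra.
- destruct H2 as [H|[H|H]]; [left|right; left|right; right]; nra.
Qed.

Lemma Csinh_slit_neq_0 (a : R) (z : C) :
  0 < a <= PI -> slit z -> Csinh (RtoC a * z) <> RtoC 0.
Proof.
intros Ha [H1 H2] E.
destruct (Rlt_dec 0 (Im z)) as [H|H].
- apply (Csinh_band_neq_0 a z); trivial. now split.
- destruct (Csinh_eq_0 _ E) as [n Hn].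
  apply (f_equal Re) in Hn. rewrite re_scal_l in Hn. simpl in Hn. nra.
Qed.

Lemma holomorphic_faddeev_integrand (gam : R) (zeta : C) :
  0 < gam <= PI -> holomorphic slit (faddeev_integrand gam zeta).
Proof.
intros Hg. assert (HU := open_slit). assert (Hpi := PI_RGT_0).
apply holomorphic_div; trivial.
- intros z Hz. apply Cmult_neq_0; [apply Cmult_neq_0|].
  + apply Csinh_slit_neq_0; trivial. lra.
  + now apply Csinh_slit_neq_0.
  + intros ->. destruct Hz as [_ Hz]. simpl in Hz. lra.
- now apply holomorphic_Cexp_comp, holomorphic_linear.
- apply holomorphic_mult; [trivial| |now apply holomorphic_id].
  apply holomorphic_mult; trivial; now apply holomorphic_Csinh, holomorphic_linear.
Qed.

Lemma faddeev_integrand_decay (rho gam : R) (zeta : C) :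
  0 < rho -> 0 < gam <= PI -> strip (PI + gam) zeta ->
  exists A d, 0 < d /\ forall x y, rho <= Rabs x -> 0 <= y <= 2 ->
    Cmod (faddeev_integrand gam zeta (horizontal y x)) <= A * exp (- (d * Rabs x)).
Proof.
intros Hr Hg Hz. apply strip_Rabs in Hz. assert (Hpi := PI_RGT_0).
set (c1 := (1 - exp (- (2 * (PI * rho)))) / 2).
set (c2 := (1 - exp (- (2 * (gam * rho)))) / 2).
assert (Hc1 : 0 < c1) by (apply Csinh_lower_pos; lra).
assert (Hc2 : 0 < c2) by (apply Csinh_lower_pos; lra).
exists (exp (2 * Rabs (Im zeta)) / (c1 * c2 * rho)), (PI + gam - Rabs (Re zeta)).
split; [lra|]. intros x y Hx Hy.
assert (L1 := Csinh_lower PI rho x y Hpi Hr Hx). fold c1 in L1.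
assert (L2 := Csinh_lower gam rho x y ltac:(lra) Hr Hx). fold c2 in L2.
assert (E1 := exp_pos (PI * Rabs x)). assert (E2 := exp_pos (gam * Rabs x)).
assert (L3 : rho <= Cmod (horizontal y x)).
{ apply Rle_trans with (1 := Hx), Rle_trans with (2 := re_le_Cmod _).
  rewrite Re_horizontal. lra. }
set (p1 := c1 * exp (PI * Rabs x)) in *. set (p2 := c2 * exp (gam * Rabs x)) in *.
assert (P1 : 0 < p1) by now apply Rmult_lt_0_compat.
assert (P2 : 0 < p2) by now apply Rmult_lt_0_compat.
assert (L12 : p1 * p2 <= Cmod (Csinh (RtoC PI * horizontal y x) * Csinh (RtoC gam * horizontal y x))).
{ rewrite Cmod_mult. apply Rmult_le_compat; lra. }
assert (P12 : 0 < p1 * p2) by now apply Rmult_lt_0_compat.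
assert (L : p1 * p2 * rho <= Cmod (Csinh (RtoC PI * horizontal y x) *
            Csinh (RtoC gam * horizontal y x) * horizontal y x)).
{ rewrite (Cmod_mult _ (horizontal y x)). apply Rmult_le_compat; lra. }
assert (P : 0 < p1 * p2 * rho) by now apply Rmult_lt_0_compat.
unfold faddeev_integrand. rewrite Cmod_div by (apply Cmod_gt_0; lra).
apply Rle_trans with
  (exp (2 * Rabs (Im zeta)) * exp (Rabs (Re zeta) * Rabs x) / (p1 * p2 * rho)).
- apply Rmult_le_compat; [apply Cmod_ge_0| |now apply Cmod_Cexp_horizontal|].
  + apply Rlt_le, Rinv_0_lt_compat. lra.
  + now apply Rinv_le_contravar.
- replace (- ((PI + gam - Rabs (Re zeta)) * Rabs x))
    with (Rabs (Re zeta) * Rabs x + (- (PI * Rabs x) + - (gam * Rabs x))) by ring.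
  rewrite !exp_plus, !exp_Ropp. unfold p1, p2. apply Req_le. field. lra.
Qed.

Definition faddeev_kernel (gam x : R) : C :=
  (recip_sinh x * / Csinh (RtoC gam * horizontal (/ 2) x) * / horizontal (/ 2) x)%C.

Lemma decays_faddeev_kernel (gam : R) :
  0 < gam <= PI -> decays (PI + gam) (faddeev_kernel gam).
Proof.
intros Hg. rewrite <- (Rplus_0_r (PI + gam)).
apply decays_mult; [apply decays_mult|apply decays_inv_horizontal].
- apply decays_recip_sinh.
- now apply decays_inv_Csinh.
Qed.

(** The integral of [e^(zeta z) K] over the line [Im z = 1/2], with the constant
    factor taken out of the exponential. *)
Definition line_transform (K : R -> C) (zeta : C) : C :=
  (Cexp (Ci * RtoC (/ 2) * zeta) * laplace K zeta)%C.

Lemma is_SInt_line_transform (b : R) (K : R -> C) (zeta : C) :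
  decays b K -> strip b zeta ->
  is_SInt (fun x => Cexp (zeta * horizontal (/ 2) x) * K x)%C (line_transform K zeta).
Proof.
intros HK Hz.
apply (is_SInt_ext (fun x => Cexp (Ci * RtoC (/ 2) * zeta) *
         (Cexp (zeta * RtoC x) * K x))%C).
- intros x. unfold horizontal.
  rewrite Cmult_plus_distr_l, Cexp_plus, (Cmult_comm zeta (Ci * _)). ring.
- apply is_SInt_Cmult; [|now apply (is_SInt_laplace b)].
  intros x. apply continuous_laplace_integrand, HK.
Qed.

Lemma Upsilon_pair (rho t : R) :
  Upsilon rho t = (rho * cos (PI - t), rho * sin (PI - t)).
Proof.
unfold Upsilon. rewrite <- RtoC_minus, Cexp_Ci.
apply injective_projections; simpl; ring.
Qed.

Lemma faddeev_arc (F f : C -> C) (rho : R) :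
  0 < rho < 1 -> (forall z, slit z -> is_Cderive F z (f z)) ->
  (forall z, slit z -> continuous f z) ->
  contour_int f (Upsilon rho) 0 PI = (F (RtoC rho) - F (RtoC (- rho)))%C.
Proof.
intros Hr HF Hf. assert (Hpi := PI_RGT_0).
assert (Hre : forall t, is_derive (fun s => Re (Upsilon rho s)) t (rho * sin (PI - t))).
{ intros t. apply (is_derive_ext (fun t => rho * cos (PI - t))).
  - intros s. now rewrite Upsilon_pair.
  - auto_derive; trivial. unfold Rminus. ring. }
assert (Him : forall t, is_derive (fun s => Im (Upsilon rho s)) t (- (rho * cos (PI - t)))).
{ intros t. apply (is_derive_ext (fun t => rho * sin (PI - t))).
  - intros s. now rewrite Upsilon_pair.
  - auto_derive; trivial. unfold Rminus. ring. }
assert (Hd := fun t => is_Rderive_pair (Upsilon rho) t _ _ (Hre t) (Him t)).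
assert (Hpd : forall t, path_deriv (Upsilon rho) t = (rho * sin (PI - t), - (rho * cos (PI - t)))).
{ intros t. unfold path_deriv. f_equal; apply is_derive_unique; auto. }
assert (Hs : forall t, 0 <= t <= PI -> slit (Upsilon rho t)).
{ intros t Ht. rewrite Upsilon_pair. unfold slit. simpl.
  assert (Hsin := SIN_bound (PI - t)). split; [nra|].
  destruct (Req_dec t 0) as [->|H0].
  - rewrite Rminus_0_r, cos_PI. left. lra.
  - destruct (Req_dec t PI) as [->|H1].
    + rewrite Rminus_diag, cos_0. right; left. lra.
    + right; right. apply Rmult_lt_0_compat; [lra|]. apply sin_gt_0; lra. }
replace (RtoC rho) with (Upsilon rho PI).
2: { rewrite Upsilon_pair, Rminus_diag, cos_0, sin_0. unfold RtoC. f_equal; ring. }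
replace (RtoC (- rho)) with (Upsilon rho 0).
2: { rewrite Upsilon_pair, Rminus_0_r, cos_PI, sin_PI. unfold RtoC. f_equal; ring. }
apply CInt_unique. apply (is_CInt_derive (fun t => F (Upsilon rho t)));
  rewrite Rmin_left, Rmax_right by lra; intros t Ht.
- apply is_Rderive_comp; [auto|]. rewrite Hpd. apply Hd.
- apply Rcontinuous_mult.
  + apply (Rcontinuous_comp f (Upsilon rho)); [auto|].
    apply (is_Rderive_continuous _ _ _ (Hd t)).
  + apply (continuous_ext (T := R_UniformSpace) (U := C_UniformSpace)
      (fun t => (rho * sin (PI - t), - (rho * cos (PI - t))))).
    { intros s. now rewrite Hpd. }
    apply Rcontinuous_pair; simpl;
      apply (ex_derive_continuous (V := R_NormedModule)); now auto_derive.
Qed.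

(** A primitive on the slit domain gives the contour from [-X] to [X] the
    value [F X - F (-X)], and the segment of the line of the same width
    [F (X + i/2) - F (-X + i/2)]; the difference is small by [Cmod_vertical]. *)
Theorem faddeev_integral_line (rho gam : R) (zeta : C) :
  0 < rho < 1 -> 0 < gam <= PI -> strip (PI + gam) zeta ->
  faddeev_integral rho gam zeta = line_transform (faddeev_kernel gam) zeta.
Proof.
intros Hr Hg Hz.
set (f := faddeev_integrand gam zeta).
assert (Hf : holomorphic slit f) by now apply holomorphic_faddeev_integrand.
destruct (holomorphic_primitive slit f _ open_slit star_slit Hf) as [F HF].
assert (Hc : forall z, slit z -> continuous f z).
{ intros z. now apply holomorphic_continuous. }
destruct (faddeev_integrand_decay rho gam zeta) as (A & d & Hd & HA); [lra|lra|trivial|].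
fold f in HA.
assert (H0 : forall x, horizontal 0 x = RtoC x).
{ intros x. apply injective_projections; simpl; ring. }
assert (Hh : forall x y, 0 <= y < 1 -> rho <= Rabs x -> slit (horizontal y x)).
{ intros x y Hy Hx. unfold slit. rewrite Re_horizontal, Im_horizontal.
  split; [lra|]. unfold Rabs in Hx. destruct (Rcase_abs x); [left|right; left]; lra. }
assert (Hh0 : forall x, rho <= Rabs x -> slit (RtoC x)).
{ intros x Hx. rewrite <- H0. apply Hh; lra. }
assert (Hreal : forall x, rho <= Rabs x -> Rcontinuous (fun x => f (RtoC x)) x).
{ intros x Hx. apply (Rcontinuous_comp f RtoC); [auto|].
  apply (Rcontinuous_RtoC (fun x => x)), continuous_id. }
assert (Hint : forall a b, (forall x, Rmin a b <= x <= Rmax a b -> rho <= Rabs x) ->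
  CInt (fun x => f (RtoC x)) a b = (F (RtoC b) - F (RtoC a))%C).
{ intros a b Hab. rewrite <- !H0. apply CInt_unique.
  apply (is_CInt_ext (fun x => f (horizontal 0 x))).
  - intros x _. now rewrite H0.
  - apply is_CInt_horizontal; intros x Hx; rewrite H0; auto. }
destruct (is_RInt_gen_exp_right (fun x => f (RtoC x)) A rho d) as (l2 & G2 & B2); trivial.
{ intros x Hx. apply Hreal. rewrite Rabs_pos_eq; lra. }
{ intros x Hx. rewrite <- H0. assert (E : Rabs x = x) by (apply Rabs_pos_eq; lra).
  rewrite <- E at 2. apply HA; lra. }
destruct (is_RInt_gen_exp_left (fun x => f (RtoC x)) A rho d) as (l1 & G1 & B1); trivial.
{ intros x Hx. apply Hreal. rewrite Rabs_left1; lra. }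
{ intros x Hx. rewrite <- H0. assert (E : Rabs (- x) = x) by (rewrite Rabs_Ropp; apply Rabs_pos_eq; lra).
  rewrite <- E at 2. apply HA; lra. }
assert (E : faddeev_integral rho gam zeta = (l1 + (F (RtoC rho) - F (RtoC (- rho))) + l2)%C).
{ unfold faddeev_integral. fold f. f_equal; [f_equal|].
  - apply (is_RInt_gen_unique (V := C_R_CompleteNormedModule) _ _ G1).
  - now apply faddeev_arc.
  - apply (is_RInt_gen_unique (V := C_R_CompleteNormedModule) _ _ G2). }
rewrite E.
apply is_SInt_unique with (fun x => f (horizontal (/ 2) x)).
2: { apply (is_SInt_ext (fun x => Cexp (zeta * horizontal (/ 2) x) * faddeev_kernel gam x)%C).
  - intros x. unfold f, faddeev_integrand, faddeev_kernel, recip_sinh.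
    assert (N := fun a Ha => Csinh_band_neq_0 a _ Ha (horizontal_half_band x)).
    assert (N3 := horizontal_half_neq_0 x). assert (Hpi := PI_RGT_0).
    field. repeat split; trivial; apply N; lra.
  - apply (is_SInt_line_transform (PI + gam)); trivial. now apply decays_faddeev_kernel. }
intros eps Heps.
destruct (exp_decay_small (A / d) d (eps / 4) Hd) as (M1 & _ & HM1); [lra|].
destruct (exp_decay_small A d (eps / 4) Hd) as (M2 & _ & HM2); [lra|].
exists (Rmax rho (Rmax M1 M2)). intros X HX.
assert (HX0 := Rle_trans _ _ _ (Rmax_l _ _) HX).
assert (HX' := Rle_trans _ _ _ (Rmax_r _ _) HX).
assert (HX1 := Rle_trans _ _ _ (Rmax_l _ _) HX').
assert (HX2 := Rle_trans _ _ _ (Rmax_r _ _) HX').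
specialize (B1 X HX0). specialize (B2 X HX0). specialize (HM1 X HX1). specialize (HM2 X HX2).
rewrite Hint in B1, B2.
2: { intros x Hx. rewrite Rmin_left in Hx by lra. rewrite Rabs_pos_eq; lra. }
2: { intros x Hx. rewrite Rmax_right in Hx by lra. rewrite Rabs_left1; lra. }
assert (HsX : forall x, slit (horizontal (/ 2) x)).
{ intros x. unfold slit. rewrite Re_horizontal, Im_horizontal. lra. }
assert (EL : CInt (fun x => f (horizontal (/ 2) x)) (- X) X =
             (F (horizontal (/ 2) X) - F (horizontal (/ 2) (- X)))%C).
{ apply CInt_unique, is_CInt_horizontal; auto. }
rewrite EL.
assert (V : forall x, Rabs x = X -> Cmod (F (horizontal (/ 2) x) - F (RtoC x))%C <= eps / 4).
{ intros x Hx. rewrite <- H0.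
  apply Rle_trans with (eps / 4 * (/ 2 - 0)); [|lra].
  apply Cmod_vertical with f; [lra| | |]; intros y Hy.
  - apply HF, Hh; lra.
  - apply Hc, Hh; lra.
  - apply Rle_trans with (A * exp (- (d * Rabs x))); [apply HA; lra|rewrite Hx; lra]. }
assert (V1 := V X (Rabs_pos_eq X ltac:(lra))).
assert (V2 := V (- X) ltac:(rewrite Rabs_Ropp; apply Rabs_pos_eq; lra)).
set (u1 := F (horizontal (/ 2) X)) in *. set (u2 := F (horizontal (/ 2) (- X))) in *.
set (v1 := F (RtoC X)) in *. set (v2 := F (RtoC (- X))) in *.
set (r1 := F (RtoC rho)) in *. set (r2 := F (RtoC (- rho))) in *.
replace (u1 - u2 - (l1 + (r1 - r2) + l2))%C
  with (((u1 - v1) + - (u2 - v2)) + ((r2 - v2 - l1) + (v1 - r1 - l2)))%C by ring.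
apply Rle_trans with (1 := Cmod_triangle _ _).
assert (T1 := Cmod_triangle (u1 - v1) (- (u2 - v2))). rewrite Cmod_opp in T1.
assert (T2 := Cmod_triangle (r2 - v2 - l1) (v1 - r1 - l2)).
lra.
Qed.

(** * The functional equation in the strip *)

Definition log_kernel (x : R) : C := (recip_sinh x * / horizontal (/ 2) x)%C.

Lemma decays_log_kernel : decays PI log_kernel.
Proof.
rewrite <- (Rplus_0_r PI).
apply decays_mult; [apply decays_recip_sinh|apply decays_inv_horizontal].
Qed.

Lemma Rcontinuous_line_integrand (b : R) (K : R -> C) (zeta : C) (x : R) :
  decays b K -> Rcontinuous (fun x => Cexp (zeta * horizontal (/ 2) x) * K x)%C x.
Proof.
intros HK. apply Rcontinuous_mult; [|apply HK].
apply (Rcontinuous_horizontal (fun z => Cexp (zeta * z))).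
apply (holomorphic_continuous (fun _ => True)); trivial.
apply holomorphic_Cexp_comp, holomorphic_linear; apply open_True.
Qed.

(** Since [e^(- gam w) - e^(gam w) = - 2 sinh (gam w)], the shift cancels one
    hyperbolic sine of the kernel. *)
Lemma line_transform_shift (gam : R) (zeta : C) :
  0 < gam <= PI -> strip PI zeta ->
  (line_transform (faddeev_kernel gam) (zeta - gam)
   - line_transform (faddeev_kernel gam) (zeta + gam)
   = RtoC (-2) * line_transform log_kernel zeta)%C.
Proof.
intros Hg Hz. assert (Hpi := PI_RGT_0). unfold strip in Hz.
assert (HK := decays_faddeev_kernel gam Hg). assert (HL := decays_log_kernel).
assert (S1 : strip (PI + gam) (zeta - gam)%C).
{ unfold strip. unfold Cminus. rewrite re_plus, re_opp. simpl. lra. }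
assert (S2 : strip (PI + gam) (zeta + gam)%C).
{ unfold strip. rewrite re_plus. simpl. lra. }
apply is_SInt_unique with
  (fun x => Cexp ((zeta - gam) * horizontal (/ 2) x) * faddeev_kernel gam x
          - Cexp ((zeta + gam) * horizontal (/ 2) x) * faddeev_kernel gam x)%C.
- apply is_SInt_minus; try (intros x; now apply (Rcontinuous_line_integrand (PI + gam)));
    now apply (is_SInt_line_transform (PI + gam)).
- apply (is_SInt_ext (fun x => RtoC (-2) * (Cexp (zeta * horizontal (/ 2) x) * log_kernel x))%C).
  2: { apply is_SInt_Cmult.
    - intros x. now apply (Rcontinuous_line_integrand PI).
    - now apply (is_SInt_line_transform PI). }
  intros x. unfold faddeev_kernel, log_kernel. set (w := horizontal (/ 2) x).
  assert (N2 := Csinh_band_neq_0 gam w Hg (horizontal_half_band x)).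
  assert (N3 : w <> RtoC 0) by apply horizontal_half_neq_0.
  replace ((zeta - gam) * w)%C with (zeta * w + - (gam * w))%C by ring.
  replace ((zeta + gam) * w)%C with (zeta * w + gam * w)%C by ring.
  rewrite !Cexp_plus.
  assert (E : (Cexp (gam * w) = Cexp (- (gam * w)) + 2 * Csinh (gam * w))%C).
  { unfold Csinh. field. }
  rewrite E. change (RtoC (-2)) with (RtoC (- (2))). rewrite RtoC_opp.
  field. auto.
Qed.

(** Under the integral sign [d/d zeta] multiplies by [z = x + i/2]. *)
Lemma is_Cderive_line_transform (b : R) (K K1 : R -> C) (zeta : C) :
  decays b K -> decays b K1 -> (forall x, K1 x = horizontal (/ 2) x * K x)%C ->
  strip b zeta ->
  is_Cderive (line_transform K) zeta (line_transform K1 zeta).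
Proof.
intros HK HK1 EK Hz. set (c := (Ci * RtoC (/ 2))%C).
assert (HKx := decays_mult_x b K HK).
assert (E : line_transform K1 zeta =
  (Cexp (c * zeta) * c * laplace K zeta +
   Cexp (c * zeta) * laplace (fun x => RtoC x * K x)%C zeta)%C).
{ assert (EL : laplace K1 zeta =
    (laplace (fun x => RtoC x * K x)%C zeta - - c * laplace K zeta)%C).
  2: { unfold line_transform. fold c. rewrite EL. ring. }
  assert (Hc : forall K', decays b K' ->
    forall x, Rcontinuous (fun x => Cexp (zeta * RtoC x) * K' x)%C x).
  { intros K' HK' x. apply continuous_laplace_integrand, HK'. }
  apply is_SInt_unique with (fun x => Cexp (zeta * RtoC x) * K1 x)%C;
    [now apply (is_SInt_laplace b)|].
  apply (is_SInt_ext (fun x => Cexp (zeta * RtoC x) * (RtoC x * K x) -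
                          - c * (Cexp (zeta * RtoC x) * K x))%C).
  - intros x. rewrite EK. unfold horizontal, c. ring.
  - apply is_SInt_minus; [now apply Hc| | |].
    + intros x. apply Rcontinuous_mult; [apply Rcontinuous_const|now apply Hc].
    + now apply (is_SInt_laplace b).
    + apply is_SInt_Cmult; [now apply Hc|now apply (is_SInt_laplace b)]. }
rewrite E. apply (is_Cderive_mult (fun z => Cexp (c * z)) (laplace K)).
- apply is_Cderive_comp_linear, is_Cderive_Cexp.
- now apply (is_Cderive_laplace b).
Qed.

(** A logarithm of [S (zeta - gam) / S (zeta + gam)]: a quarter of the
    difference in [line_transform_shift]. *)
Definition strip_log (zeta : C) : C := (RtoC (- / 2) * line_transform log_kernel zeta)%C.

Lemma is_Cderive_strip_log (zeta : C) :
  strip PI zeta ->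
  exists l, is_Cderive strip_log zeta l /\
    (l * (RtoC 1 + Cexp (Ci * zeta)) = Ci * Cexp (Ci * zeta))%C.
Proof.
intros Hz. assert (Hpi := PI_RGT_0).
exists (RtoC (- / 2) * line_transform recip_sinh zeta)%C. split.
- apply is_Cderive_scal, (is_Cderive_line_transform PI); trivial.
  + apply decays_log_kernel.
  + apply decays_recip_sinh.
  + intros x. unfold log_kernel. field. apply horizontal_half_neq_0.
- assert (H := laplace_recip_sinh zeta Hz). fold (line_transform recip_sinh zeta) in H.
  rewrite <- Cmult_assoc, H.
  rewrite RtoC_opp, RtoC_inv by lra. field.
Qed.

Lemma Cderive_0_const (U : C -> Prop) (Q : C -> C) (a z : C) :
  star_shaped a U -> (forall w, U w -> is_Cderive Q w (RtoC 0)) -> U z -> Q z = Q a.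
Proof.
intros Hs HQ Hz.
assert (H := is_CInt_segment Q (fun _ => RtoC 0) a (z - a)).
rewrite Cplus_minus_r in H.
specialize (H (fun s Hs' => HQ _ (Hs z s Hz Hs')) (fun s _ => continuous_const _ _)).
assert (H0 := is_CInt_Cmult (RtoC 0) _ _ _ _ H).
apply (is_CInt_ext _ (fun _ => RtoC 0 * (z - a))%C) in H; [|reflexivity].
apply CInt_unique in H.
assert (E : CInt (fun _ => RtoC 0 * (z - a))%C 0 1 = RtoC 0).
{ rewrite (CInt_unique _ _ _ _ (is_CInt_const _ 0 1)). ring. }
rewrite E in H. replace (Q z) with ((Q z - Q a) + Q a)%C by ring. rewrite <- H. ring.
Qed.

(** At [i T] the factor [e^(i zeta / 2)] is [e^(- T / 2)], while the Laplace
    transform is bounded on the imaginary axis. *)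
Lemma strip_log_bound : exists B, 0 <= B /\ forall T, 0 <= T ->
  Cmod (strip_log (Ci * RtoC T)) <= B * exp (- (/ 2 * T)).
Proof.
assert (HK := decays_log_kernel). assert (Hpi := PI_RGT_0).
assert (H0 : strip PI (RtoC 0)) by (unfold strip; simpl; lra).
destruct (laplace_bound PI log_kernel (RtoC 0) HK H0) as (C0 & d & Hd & HB).
assert (HC0 := exp_bound_nonneg _ _ _ HB).
exists (/ 2 * (2 * C0 / d)). split.
{ assert (0 <= 2 * C0 / d) by (apply Rdiv_le_0_compat; lra). lra. }
intros T HT. unfold strip_log, line_transform.
rewrite !Cmod_mult, Cmod_R, Rabs_Ropp, Rabs_pos_eq, Cmod_Cexp by lra.
replace (Re (Ci * (/ 2)%R * (Ci * T))) with (- (/ 2 * T)) by (simpl; ring).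
rewrite (Rmult_comm (exp _)), <- Rmult_assoc.
apply Rmult_le_compat_r; [apply Rlt_le, exp_pos|].
apply Rmult_le_compat_l; [lra|].
apply Cmod_LInt_le; trivial.
- intros x. apply continuous_laplace_integrand, HK.
- intros x. specialize (HB x). rewrite Cmult_0_l, Cexp_0, Cmult_1_l in HB.
  rewrite Cmod_mult. replace (Ci * RtoC T * RtoC x)%C with (Ci * RtoC (T * x))%C
    by (rewrite RtoC_mult; ring).
  rewrite Cmod_Cexp. replace (Re (Ci * RtoC (T * x))) with 0 by (simpl; ring).
  now rewrite exp_0, Rmult_1_l.
Qed.

Theorem Cexp_strip_log (zeta : C) :
  strip PI zeta -> Cexp (strip_log zeta) = (RtoC 1 + Cexp (Ci * zeta))%C.
Proof.
intros Hz. assert (Hpi := PI_RGT_0).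
set (Q z := (Cexp (RtoC (-1) * strip_log z) * (RtoC 1 + Cexp (Ci * z)))%C).
assert (HQ : forall z, strip PI z -> is_Cderive Q z (RtoC 0)).
{ intros z H. destruct (is_Cderive_strip_log z H) as (l & Hl & El).
  replace (RtoC 0) with
    (Cexp (RtoC (-1) * strip_log z) * (RtoC (-1) * l) * (RtoC 1 + Cexp (Ci * z)) +
     Cexp (RtoC (-1) * strip_log z) * (RtoC 0 + Cexp (Ci * z) * Ci))%C.
  - apply (is_Cderive_mult (fun z => Cexp (RtoC (-1) * strip_log z))
             (fun z => RtoC 1 + Cexp (Ci * z))%C).
    + apply (is_Cderive_comp Cexp); [apply is_Cderive_Cexp|now apply is_Cderive_scal].
    + apply is_Cderive_plus; [apply is_Cderive_const|].
      apply is_Cderive_comp_linear, is_Cderive_Cexp.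
  - rewrite (RtoC_m1_mult l).
    transitivity (Cexp (RtoC (-1) * strip_log z) *
      (- (l * (RtoC 1 + Cexp (Ci * z))) + Ci * Cexp (Ci * z)))%C; [ring|].
    rewrite El. ring. }
assert (Q1 : Q zeta = RtoC 1).
{ destruct strip_log_bound as (B & HB0 & HB).
  apply Ceq_epsilon. intros eps Heps.
  (* [zeta] may be replaced by [i T]; there [Q - 1] is at most [K e^(- T / 2)]. *)
  set (K := 2 * B * exp B + 1).
  assert (HK : 0 < / 2) by lra.
  destruct (exp_decay_small K (/ 2) eps HK Heps) as (T & HT & HE).
  specialize (HE T (Rle_refl T)).
  assert (Hs : strip PI (Ci * RtoC T)%C) by (unfold strip; simpl; lra).
  rewrite (Cderive_0_const (strip PI) Q (Ci * RtoC T) zeta) by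
    (trivial; now apply convex_strip).
  specialize (HB T HT). set (u := strip_log (Ci * RtoC T)) in *.
  set (e := exp (- (/ 2 * T))) in *.
  assert (He : 0 < e) by apply exp_pos.
  assert (He1 : e <= 1).
  { unfold e. rewrite <- exp_0. apply exp_le. lra. }
  assert (Ev : Cexp (Ci * (Ci * RtoC T)) = RtoC (e * e)).
  { replace (Ci * (Ci * RtoC T))%C with (RtoC (- T)).
    - rewrite Cexp_RtoC. f_equal. unfold e. rewrite <- exp_plus. f_equal. field.
    - apply injective_projections; simpl; ring. }
  unfold Q. rewrite Ev. fold u.
  rewrite RtoC_m1_mult.
  replace (Cexp (- u) * (RtoC 1 + RtoC (e * e)) - RtoC 1)%C
    with ((Cexp (- u) - RtoC 1) * (RtoC 1 + RtoC (e * e)) + RtoC (e * e))%C by ring.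
  apply Rle_trans with (1 := Cmod_triangle _ _).
  rewrite Cmod_mult, <- RtoC_plus, !Cmod_R, !Rabs_pos_eq by nra.
  assert (H1 := Cmod_Cexp_minus_1 (- u)%C). rewrite Cmod_opp in H1.
  assert (Hu0 := Cmod_ge_0 u).
  assert (HuB : Cmod u <= B) by nra.
  assert (H2 : Cmod u * exp (Cmod u) <= B * e * exp B).
  { apply Rmult_le_compat; trivial; [apply Rlt_le, exp_pos|now apply exp_le]. }
  assert (H3 : 0 <= B * e * exp B).
  { apply Rmult_le_pos; [nra|apply Rlt_le, exp_pos]. }
  apply Rle_trans with (B * e * exp B * 2 + e).
  - apply Rplus_le_compat; [|nra].
    apply Rmult_le_compat; [apply Cmod_ge_0|nra|lra|nra].
  - unfold K in HE. nra. }
unfold Q in Q1.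
rewrite RtoC_m1_mult, Cexp_opp in Q1.
replace (RtoC 1 + Cexp (Ci * zeta))%C with
  (Cexp (strip_log zeta) * (/ Cexp (strip_log zeta) * (RtoC 1 + Cexp (Ci * zeta))))%C
  by (field; apply Cexp_neq_0).
rewrite Q1. ring.
Qed.

Theorem S_strip_shift (rho gam : R) (zeta : C) :
  0 < rho < 1 -> 0 < gam <= PI -> strip PI zeta ->
  S_strip rho gam (zeta - gam) =
  ((RtoC 1 + Cexp (Ci * zeta)) * S_strip rho gam (zeta + gam))%C.
Proof.
intros Hr Hg Hz. assert (Hs := Hz). unfold strip in Hs.
unfold S_strip. rewrite !faddeev_integral_line; trivial.
2: { unfold strip. rewrite re_plus. simpl. lra. }
2: { unfold strip, Cminus. rewrite re_plus, re_opp. simpl. lra. }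
rewrite <- Cexp_strip_log, <- Cexp_plus by trivial. f_equal.
unfold strip_log. assert (H := line_transform_shift gam zeta Hg Hz).
match type of H with (?a - ?b = _)%C => replace a with (a - b + b)%C by ring; rewrite H end.
rewrite RtoC_opp, RtoC_inv by lra.
change (RtoC (-2)) with (RtoC (- (2))). rewrite RtoC_opp.
field.
Qed.

Lemma holomorphic_S_strip (rho gam : R) :
  0 < rho < 1 -> 0 < gam <= PI -> holomorphic (strip (PI + gam)) (S_strip rho gam).
Proof.
intros Hr Hg. assert (HU := open_strip (PI + gam)).
apply (holomorphic_ext _ (fun z => Cexp (/ 4 * line_transform (faddeev_kernel gam) z))%C); trivial.
- intros z Hz. unfold S_strip. now rewrite faddeev_integral_line.
- apply holomorphic_Cexp_comp; trivial.
  apply holomorphic_mult; trivial; [now apply holomorphic_const|].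
  apply holomorphic_mult; trivial.
  + apply holomorphic_Cexp_comp; trivial.
    now apply holomorphic_linear.
  + now apply holomorphic_laplace, decays_faddeev_kernel.
Qed.

Lemma S_strip_neq_0 (rho gam : R) (zeta : C) : S_strip rho gam zeta <> RtoC 0.
Proof. apply Cexp_neq_0. Qed.

(** * The meromorphic extension of the quantum dilogarithm *)

Lemma S_extend_strip (rho gam : R) (n : nat) (zeta : C) :
  strip (PI + gam) zeta -> S_extend rho gam n zeta = S_strip rho gam zeta.
Proof.
intros Hz. unfold strip in Hz. destruct n as [|n]; simpl; trivial.
destruct (Rle_dec (PI + gam) (Re zeta)); [lra|].
destruct (Rle_dec (Re zeta) (- (PI + gam))); [lra|]. reflexivity.
Qed.

Lemma S_extend_left (rho gam : R) (n : nat) (zeta : C) :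
  0 < gam -> Re zeta <= - (PI + gam) ->
  S_extend rho gam (S n) zeta =
  ((1 + Cexp (Ci * (zeta + gam))) * S_extend rho gam n (zeta + 2 * gam))%C.
Proof.
intros Hg Hz. assert (Hpi := PI_RGT_0). simpl.
destruct (Rle_dec (PI + gam) (Re zeta)); [lra|].
destruct (Rle_dec (Re zeta) (- (PI + gam))); [reflexivity|lra].
Qed.

Lemma S_extend_right (rho gam : R) (n : nat) (zeta : C) :
  PI + gam <= Re zeta ->
  S_extend rho gam (S n) zeta =
  (S_extend rho gam n (zeta - 2 * gam) / (1 + Cexp (Ci * (zeta - gam))))%C.
Proof.
intros Hz. simpl. destruct (Rle_dec (PI + gam) (Re zeta)); [reflexivity|lra].
Qed.

Lemma Re_shift_right (zeta : C) (gam : R) : Re (zeta + 2 * gam) = Re zeta + 2 * gam.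
Proof. destruct zeta. simpl. ring. Qed.

Lemma Re_shift_left (zeta : C) (gam : R) : Re (zeta - 2 * gam) = Re zeta - 2 * gam.
Proof. destruct zeta. simpl. ring. Qed.

(** The recursion stops by itself once it is in the strip. *)
Lemma S_extend_stable (rho gam : R) (n m : nat) (zeta : C) :
  0 < gam ->
  Rabs (Re zeta) < PI + gam + 2 * gam * INR n ->
  Rabs (Re zeta) < PI + gam + 2 * gam * INR m ->
  S_extend rho gam n zeta = S_extend rho gam m zeta.
Proof.
intros Hg. assert (Hpi := PI_RGT_0).
revert m zeta. induction n as [|n IH]; intros m zeta Hn Hm.
- simpl INR in Hn. apply Rabs_def2 in Hn.
  rewrite !S_extend_strip; trivial; unfold strip; lra.
- destruct (Rlt_dec (Rabs (Re zeta)) (PI + gam)) as [Hz|Hz].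
  { apply Rabs_def2 in Hz. rewrite !S_extend_strip; trivial; unfold strip; lra. }
  destruct m as [|m]; [simpl INR in Hm; lra|].
  rewrite S_INR in Hn, Hm. assert (Hpn := pos_INR n). assert (Hpm := pos_INR m).
  destruct (Rle_dec 0 (Re zeta)) as [H0|H0].
  + rewrite Rabs_pos_eq in Hn, Hm, Hz by trivial.
    rewrite !S_extend_right by lra. f_equal.
    apply IH; rewrite Re_shift_left; apply Rabs_def1; nra.
  + rewrite Rabs_left in Hn, Hm, Hz by lra.
    rewrite !S_extend_left by lra. f_equal.
    apply IH; rewrite Re_shift_right; apply Rabs_def1; nra.
Qed.

Lemma S_gamma_extend (rho gam : R) (n : nat) (zeta : C) :
  0 < gam -> Rabs (Re zeta) < PI + gam + 2 * gam * INR n ->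
  S_gamma rho gam zeta = S_extend rho gam n zeta.
Proof.
intros Hg Hn. unfold S_gamma. apply S_extend_stable; trivial.
assert (Hpi := PI_RGT_0). assert (Ha := Rabs_pos (Re zeta)).
destruct (archimed (Rabs (Re zeta) / (2 * gam))) as [Hup _].
assert (H0 : 0 <= Rabs (Re zeta) / (2 * gam)) by (apply Rdiv_le_0_compat; lra).
assert (Hz : (0 <= up (Rabs (Re zeta) / (2 * gam)))%Z) by (apply le_IZR; lra).
rewrite Zabs2Nat.abs_nat_nonneg by trivial.
rewrite INR_IZR_INZ, Z2Nat.id by trivial.
apply Rmult_gt_compat_l with (r := 2 * gam) in Hup; [|lra].
replace (2 * gam * (Rabs (Re zeta) / (2 * gam))) with (Rabs (Re zeta)) in Hup by (field; lra).
lra.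
Qed.

Lemma enough_steps (gam x : R) : 0 < gam -> exists n, x < 2 * gam * INR n.
Proof.
intros Hg. destruct (INR_unbounded (x / (2 * gam))) as [n Hn]. exists n.
apply Rmult_lt_compat_l with (r := 2 * gam) in Hn; [|lra].
now replace (2 * gam * (x / (2 * gam))) with x in Hn by (field; lra).
Qed.

Lemma S_gamma_strip (rho gam : R) (zeta : C) :
  0 < gam -> strip (PI + gam) zeta -> S_gamma rho gam zeta = S_strip rho gam zeta.
Proof.
intros Hg Hz. rewrite (S_gamma_extend rho gam 0); trivial.
simpl INR. unfold strip in Hz. apply Rabs_def1; lra.
Qed.

Lemma S_gamma_shift (rho gam : R) (zeta : C) :
  0 < rho < 1 -> 0 < gam <= PI -> Re zeta < PI ->
  S_gamma rho gam (zeta - gam) =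
  ((1 + Cexp (Ci * zeta)) * S_gamma rho gam (zeta + gam))%C.
Proof.
intros Hr Hg Hz. assert (Hpi := PI_RGT_0).
assert (E1 : Re (zeta - gam) = Re zeta - gam) by (destruct zeta; simpl; ring).
assert (E2 : Re (zeta + gam) = Re zeta + gam) by (destruct zeta; simpl; ring).
destruct (Rlt_dec (- PI) (Re zeta)) as [H|H].
- rewrite !S_gamma_strip by (unfold strip; lra).
  now apply S_strip_shift.
- destruct (enough_steps gam (Rabs (Re zeta))) as [n Hn]; [lra|].
  rewrite Rabs_left in Hn by lra.
  rewrite (S_gamma_extend rho gam (S n)), (S_gamma_extend rho gam n (zeta + gam)).
  + rewrite S_extend_left by lra. f_equal; [f_equal; f_equal; ring|f_equal; ring].
  + lra.
  + rewrite E2. apply Rabs_def1; lra.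
  + lra.
  + rewrite E1, S_INR, Rabs_left; lra.
Qed.

(** With [/ 0 = 0] this holds without exception. *)
Lemma Cinv_div (a c : C) : (/ (a / c) = c * / a)%C.
Proof.
destruct (classic (a = RtoC 0)) as [->|Ha].
- unfold Cdiv. now rewrite Cmult_0_l, Cinv_0, Cmult_0_r.
- destruct (classic (c = RtoC 0)) as [->|Hc].
  + unfold Cdiv. now rewrite Cinv_0, Cmult_0_r, Cinv_0, Cmult_0_l.
  + field. auto.
Qed.

(** Valid at the poles of [S] as well, where the convention [/ 0 = 0] gives
    [/ S] its true value 0. *)
Lemma inv_S_gamma_shift (rho gam : R) (zeta : C) :
  0 < rho < 1 -> 0 < gam <= PI -> - PI < Re zeta ->
  (/ S_gamma rho gam (zeta + gam) =
   (1 + Cexp (Ci * zeta)) * / S_gamma rho gam (zeta - gam))%C.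
Proof.
intros Hr Hg Hz. assert (Hpi := PI_RGT_0).
assert (E1 : Re (zeta - gam) = Re zeta - gam) by (destruct zeta; simpl; ring).
assert (E2 : Re (zeta + gam) = Re zeta + gam) by (destruct zeta; simpl; ring).
destruct (Rlt_dec (Re zeta) PI) as [H|H].
- rewrite S_gamma_shift by trivial.
  rewrite !S_gamma_strip by (unfold strip; lra).
  assert (H0 := S_strip_neq_0 rho gam (zeta + gam)).
  assert (H1 : (1 + Cexp (Ci * zeta))%C <> RtoC 0).
  { rewrite <- Cexp_strip_log by (unfold strip; lra). apply Cexp_neq_0. }
  field. auto.
- destruct (enough_steps gam (Rabs (Re zeta))) as [n Hn]; [lra|].
  rewrite Rabs_pos_eq in Hn by lra.
  rewrite (S_gamma_extend rho gam (S n)), (S_gamma_extend rho gam n (zeta - gam)).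
  + rewrite S_extend_right, Cinv_div by lra.
    f_equal; [f_equal; f_equal; ring|f_equal; f_equal; ring].
  + lra.
  + rewrite E1. apply Rabs_def1; lra.
  + lra.
  + rewrite E2, S_INR, Rabs_pos_eq; lra.
Qed.

(** Both half-planes at once: [s = 1] for [S] and [s = -1] for [/ S]. The
    half-plane is the union of the translates [V n] of the strip, and
    the functional equation expresses [f] on [V (n + 1)] by its values on [V n]. *)
Lemma holomorphic_extension (gam s : R) (f : C -> C) :
  0 < gam -> s = 1 \/ s = -1 ->
  holomorphic (strip (PI + gam)) f ->
  (forall z, s * Re z + 2 * gam < PI + gam ->
     f z = (1 + Cexp (Ci * (z + s * gam))) * f (z + 2 * (s * gam)))%C ->
  holomorphic (fun z => s * Re z < PI + gam) f.
Proof.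
intros Hg Hs Hf Hshift. assert (Hpi := PI_RGT_0).
set (b := PI + gam) in *.
set (V n z := strip b (z + RtoC (2 * (s * gam) * INR n))%C).
assert (ReV : forall n z, Re (z + RtoC (2 * (s * gam) * INR n)) = Re z + 2 * (s * gam) * INR n).
{ intros n [x y]. simpl. ring. }
assert (HV : forall n, open (V n)).
{ intros n. apply Copen_iff. intros z Hz.
  destruct (proj1 (Copen_iff _) (open_strip b) _ Hz) as (d & Hd & H).
  exists d. split; trivial. intros h Hh. unfold V.
  replace (z + h + RtoC (2 * (s * gam) * INR n))%C
    with (z + RtoC (2 * (s * gam) * INR n) + h)%C by ring. auto. }
apply holomorphic_subset with (fun z => exists n, V n z).
- intros z Hz.
  destruct (enough_steps gam (Rabs (Re z))) as [n Hn]; trivial.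
  assert (Hn' : - b < s * Re z + 2 * gam * INR n).
  { generalize (Rle_abs (Re z)) (Rle_abs (- Re z)). rewrite Rabs_Ropp.
    unfold b. destruct Hs as [-> | ->]; lra. }
  clear Hn. unfold V, strip.
  assert (HN : exists N, - b < s * Re z + 2 * gam * INR N < b).
  { induction n as [|n IH].
    - exists 0%nat. simpl INR in *. lra.
    - destruct (Rlt_dec (- b) (s * Re z + 2 * gam * INR n)) as [H|H]; auto.
      exists (S n). rewrite S_INR in Hn' |- *. unfold b in *. lra. }
  destruct HN as [N HN]. exists N. rewrite ReV.
  destruct Hs as [-> | ->]; lra.
- apply holomorphic_Union. intros n. induction n as [|n IH].
  + apply holomorphic_subset with (2 := Hf). intros z. unfold V, strip. rewrite ReV.
    simpl INR. rewrite Rmult_0_r, Rplus_0_r. trivial.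
  + apply holomorphic_ext with
      (fun z => (1 + Cexp (Ci * (z + s * gam))) * f (z + 2 * (s * gam)))%C; trivial.
    * intros z Hz. symmetry. apply Hshift. unfold V, strip in Hz.
      rewrite ReV, S_INR in Hz. assert (Hp := pos_INR n).
      assert (0 <= gam * INR n) by nra.
      destruct Hs as [-> | ->]; nra.
    * assert (Hid := fun c => holomorphic_plus (V (S n)) _ _ (HV _)
               (holomorphic_id _ (HV _)) (holomorphic_const _ c (HV _))).
      apply holomorphic_mult; trivial.
      -- apply holomorphic_plus; trivial; [now apply holomorphic_const|].
         apply holomorphic_Cexp_comp; trivial.
         apply holomorphic_mult; trivial; now apply holomorphic_const.
      -- apply (holomorphic_comp (V (S n)) (V n) f); trivial.
         intros z Hz. unfold V in *. rewrite S_INR in Hz.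
         replace (z + 2 * (s * gam) + RtoC (2 * (s * gam) * INR n))%C
           with (z + RtoC (2 * (s * gam) * (INR n + 1)))%C; trivial.
         rewrite !RtoC_mult, RtoC_plus. ring.
Qed.

Lemma holomorphic_S_gamma (rho gam : R) :
  0 < rho < 1 -> 0 < gam <= PI ->
  holomorphic (fun z => Re z < PI + gam) (S_gamma rho gam).
Proof.
intros Hr Hg.
apply holomorphic_subset with (fun z => 1 * Re z < PI + gam); [intros z Hz; lra|].
apply holomorphic_extension; [lra|now left| |].
- apply (holomorphic_ext _ (S_strip rho gam)); [apply open_strip| |now apply holomorphic_S_strip].
  intros z Hz. symmetry. apply S_gamma_strip; trivial. lra.
- intros z Hz.
  replace (z + 2 * (1 * gam))%C with ((z + gam) + gam)%C by ring.
  replace (z + 1 * gam)%C with (z + gam)%C by ring.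
  rewrite <- S_gamma_shift; trivial; [f_equal; ring|].
  rewrite re_plus, re_RtoC. lra.
Qed.

Lemma holomorphic_inv_S_gamma (rho gam : R) :
  0 < rho < 1 -> 0 < gam <= PI ->
  holomorphic (fun z => - (PI + gam) < Re z) (fun z => / S_gamma rho gam z)%C.
Proof.
intros Hr Hg.
apply holomorphic_subset with (fun z => -1 * Re z < PI + gam); [intros z Hz; lra|].
apply holomorphic_extension; [lra|now right| |].
- apply (holomorphic_ext _ (fun z => / S_strip rho gam z)%C); [apply open_strip| |].
  + intros z Hz. rewrite S_gamma_strip; trivial. lra.
  + apply holomorphic_inv; [apply open_strip| |now apply holomorphic_S_strip].
    intros z _. apply S_strip_neq_0.
- intros z Hz. rewrite RtoC_m1.
  replace (z + 2 * (- (1) * gam))%C with ((z - gam) - gam)%C by ring.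
  replace (z + - (1) * gam)%C with (z - gam)%C by ring.
  rewrite <- inv_S_gamma_shift; trivial; [f_equal; f_equal; ring|].
  unfold Cminus. rewrite re_plus, re_opp, re_RtoC. lra.
Qed.

(** Each step of the induction uses the functional equation once at either end.
    At [Re eta = - PI] and [Re eta = PI] one of the two arguments leaves the strip
    already for [m = 0], but then the other equation applies. *)
Theorem S_gamma_ratio (rho gam : R) (eta : C) (m : nat) :
  0 < rho < 1 -> 0 < gam <= PI -> - PI <= Re eta <= PI ->
  (S_gamma rho gam (eta - RtoC ((2 * INR m + 1) * gam)) /
   S_gamma rho gam (eta + RtoC ((2 * INR m + 1) * gam)) =
   (1 + Cexp (Ci * eta)) *
   Cprod (fun l => (1 + Cexp (Ci * (eta - RtoC (2 * INR l * gam)))) *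
                   (1 + Cexp (Ci * (eta + RtoC (2 * INR l * gam))))) m)%C.
Proof.
intros Hr Hg He. assert (Hpi := PI_RGT_0).
induction m as [|m IH].
- simpl. rewrite Rmult_0_r, Rplus_0_l, Rmult_1_l, Cmult_1_r. unfold Cdiv.
  destruct (Rlt_dec (Re eta) PI) as [H|H].
  + rewrite S_gamma_shift by trivial.
    rewrite S_gamma_strip.
    * field. apply S_strip_neq_0.
    * lra.
    * unfold strip. rewrite re_plus, re_RtoC. lra.
  + rewrite inv_S_gamma_shift by (trivial; lra).
    rewrite S_gamma_strip.
    * field. apply S_strip_neq_0.
    * lra.
    * unfold strip, Cminus. rewrite re_plus, re_opp, re_RtoC. lra.
- assert (Hm := pos_INR m). assert (Hgm : 0 <= gam * INR m) by nra.
  assert (ES : INR (S m) = INR m + 1) by apply S_INR.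
  assert (L := S_gamma_shift rho gam (eta - RtoC (2 * INR (S m) * gam)) Hr Hg).
  assert (R' := inv_S_gamma_shift rho gam (eta + RtoC (2 * INR (S m) * gam)) Hr Hg).
  replace (eta - RtoC (2 * INR (S m) * gam) - gam)%C
    with (eta - RtoC ((2 * INR (S m) + 1) * gam))%C in L
    by (rewrite ES, !RtoC_mult, !RtoC_plus, !RtoC_mult, !RtoC_plus; ring).
  replace (eta - RtoC (2 * INR (S m) * gam) + gam)%C
    with (eta - RtoC ((2 * INR m + 1) * gam))%C in L
    by (rewrite ES, !RtoC_mult, !RtoC_plus, !RtoC_mult; ring).
  replace (eta + RtoC (2 * INR (S m) * gam) + gam)%C
    with (eta + RtoC ((2 * INR (S m) + 1) * gam))%C in R'
    by (rewrite ES, !RtoC_mult, !RtoC_plus, !RtoC_mult, !RtoC_plus; ring).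
  replace (eta + RtoC (2 * INR (S m) * gam) - gam)%C
    with (eta + RtoC ((2 * INR m + 1) * gam))%C in R'
    by (rewrite ES, !RtoC_mult, !RtoC_plus, !RtoC_mult; ring).
  unfold Cdiv in *. rewrite L, R'.
  + change (Cprod ?a (S m)) with (Cprod a m * a (S m))%C.
    match goal with |- (?u * ?a * (?v * ?b) = _)%C =>
      transitivity (u * v * (a * b))%C; [ring|] end.
    rewrite IH. ring.
  + rewrite re_plus, re_RtoC, ES. nra.
  + unfold Cminus. rewrite re_plus, re_opp, re_RtoC, ES. nra.
Qed.

Lemma Ci_Ci : (Ci * Ci = - RtoC 1)%C.
Proof. apply injective_projections; simpl; ring. Qed.

(** * Sine and cosine *)

Lemma Csin_Csinh (z : C) : Csin z = (- Ci * Csinh (Ci * z))%C.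
Proof.
unfold Csin, Csinh. rewrite <- Ci_inv. field. apply Ci_nz.
Qed.

Lemma Csin_RtoC (x : R) : Csin (RtoC x) = RtoC (sin x).
Proof.
rewrite Csin_Csinh, Csinh_pair.
replace (Re (Ci * x)) with 0 by (simpl; ring).
replace (Im (Ci * x)) with x by (simpl; ring).
rewrite sinh_0, cosh_0. apply injective_projections; simpl; ring.
Qed.

Lemma Csin_plus_PI2 (z : C) : Csin (z + RtoC (PI / 2)) = Ccos z.
Proof.
unfold Csin, Ccos.
assert (E : Cexp (Ci * RtoC (PI / 2)) = Ci).
{ rewrite Cexp_Ci, cos_PI2, sin_PI2. reflexivity. }
rewrite Cmult_plus_distr_l.
replace (- (Ci * z + Ci * RtoC (PI / 2)))%C with (- (Ci * z) + - (Ci * RtoC (PI / 2)))%C by ring.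
rewrite !Cexp_plus, (Cexp_opp (Ci * RtoC (PI / 2))), E, Ci_inv.
field. apply Ci_nz.
Qed.

Lemma Ccos_plus_PI2 (z : C) : Ccos (z + RtoC (PI / 2)) = (- Csin z)%C.
Proof.
unfold Csin, Ccos.
assert (E : Cexp (Ci * RtoC (PI / 2)) = Ci).
{ rewrite Cexp_Ci, cos_PI2, sin_PI2. reflexivity. }
rewrite Cmult_plus_distr_l.
replace (- (Ci * z + Ci * RtoC (PI / 2)))%C with (- (Ci * z) + - (Ci * RtoC (PI / 2)))%C by ring.
rewrite !Cexp_plus, (Cexp_opp (Ci * RtoC (PI / 2))), E.
replace Ci with (- / Ci)%C at 2 by (rewrite Ci_inv; ring).
field. apply Ci_nz.
Qed.

Lemma Ccos_RtoC (x : R) : Ccos (RtoC x) = RtoC (cos x).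
Proof. now rewrite <- Csin_plus_PI2, <- RtoC_plus, Csin_RtoC, Rplus_comm, <- cos_sin. Qed.

Lemma is_Cderive_Csin (z : C) : is_Cderive Csin z (Ccos z).
Proof.
apply (is_Cderive_ext_on (fun _ => True) (fun w => - Ci * Csinh (Ci * w))%C).
- apply open_True.
- intros w _. symmetry. apply Csin_Csinh.
- trivial.
- replace (Ccos z) with
    (- Ci * ((Cexp (Ci * z) + Cexp (- (Ci * z))) / 2 * Ci))%C.
  + apply is_Cderive_scal, is_Cderive_comp_linear, is_Cderive_Csinh.
  + unfold Ccos.
    transitivity (- (Ci * Ci) * ((Cexp (Ci * z) + Cexp (- (Ci * z))) / 2))%C; [ring|].
    rewrite Ci_Ci. ring.
Qed.

Lemma holomorphic_Csin (U : C -> Prop) (f : C -> C) :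
  open U -> holomorphic U f -> holomorphic U (fun z => Csin (f z)).
Proof.
intros HU Hf. apply (holomorphic_ext _ (fun z => - Ci * Csinh (Ci * f z))%C); trivial.
- intros z _. symmetry. apply Csin_Csinh.
- apply holomorphic_mult; trivial; [now apply holomorphic_const|].
  apply holomorphic_Csinh; trivial.
  apply holomorphic_mult; trivial. now apply holomorphic_const.
Qed.

Lemma holomorphic_Ccos (U : C -> Prop) (f : C -> C) :
  open U -> holomorphic U f -> holomorphic U (fun z => Ccos (f z)).
Proof.
intros HU Hf. apply (holomorphic_ext _ (fun z => Csin (f z + RtoC (PI / 2)))); trivial.
- intros z _. apply Csin_plus_PI2.
- apply holomorphic_Csin; trivial.
  apply holomorphic_plus; trivial. now apply holomorphic_const.
Qed.

Lemma Csin_eq_0 (z : C) : Csin z = RtoC 0 -> exists n : Z, z = RtoC (PI * IZR n).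
Proof.
intros H. rewrite Csin_Csinh in H.
destruct (Csinh_eq_0 (Ci * z)) as [n Hn].
{ apply NNPP. intros N. apply (Cmult_neq_0 (- Ci) (Csinh (Ci * z))); trivial.
  intros E. apply Ci_nz. replace Ci with (- - Ci)%C by ring. rewrite E. ring. }
exists n. replace z with (/ Ci * (Ci * z))%C by (field; apply Ci_nz).
rewrite Hn. field. apply Ci_nz.
Qed.

(** * Residues of the tangent and of the cotangent *)

Lemma Clist_sum_scal (A : Type) (k : C) (F : A -> C) (l : list A) :
  Clist_sum (map (fun a => k * F a)%C l) = (k * Clist_sum (map F l))%C.
Proof.
induction l as [|a l IH]; simpl.
- unfold Clist_sum; simpl. ring.
- change (k * F a + Clist_sum (map (fun a => k * F a)%C l) =
          k * (F a + Clist_sum (map F l)))%C. rewrite IH. ring.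
Qed.

Lemma Clist_sum_app (l m : list C) :
  Clist_sum (l ++ m) = (Clist_sum l + Clist_sum m)%C.
Proof.
induction l as [|a l IH].
- unfold Clist_sum at 2. simpl. ring.
- change (a + Clist_sum (l ++ m) = a + Clist_sum l + Clist_sum m)%C. rewrite IH. ring.
Qed.

Lemma Clist_sum_zero (l : list C) :
  (forall z, In z l -> z = RtoC 0) -> Clist_sum l = RtoC 0.
Proof.
induction l as [|a l IH]; intros H; [reflexivity|].
change (a + Clist_sum l = RtoC 0)%C.
rewrite IH, (H a); [ring|now left|]. intros z Hz. apply H. now right.
Qed.

Lemma holomorphic_Clist_sum (U : C -> Prop) (A : Type) (F : A -> C -> C) (l : list A) :
  open U -> (forall a, In a l -> holomorphic U (F a)) ->
  holomorphic U (fun z => Clist_sum (map (fun a => F a z) l)).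
Proof.
intros HU. induction l as [|a l IH]; intros H.
- now apply (holomorphic_const U (RtoC 0)).
- apply (holomorphic_plus U (F a)); trivial; [apply H; now left|].
  apply IH. intros b Hb. apply H. now right.
Qed.

Lemma open_Omega (r : nat) : open (Omega r).
Proof. apply (open_and (T := C_UniformSpace)); [apply open_Re_gt|apply open_Re_lt]. Qed.

Lemma convex_Omega (r : nat) : Cconvex (Omega r).
Proof.
intros p Hp z t Hz Ht. unfold Omega. rewrite Re_segment. now apply convex_between.
Qed.

Lemma Omega_div (r : nat) (t : R) :
  (0 < r)%nat -> Omega r (RtoC (t / INR r)) <-> - / 4 < t < INR r + / 4.
Proof.
intros Hr. assert (Hr' := lt_0_INR r Hr). unfold Omega. rewrite re_RtoC.
replace (- (1 / (4 * INR r))) with ((- / 4) / INR r) by (field; lra).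
replace (1 + 1 / (4 * INR r)) with ((INR r + / 4) / INR r) by (field; lra).
assert (Hi := Rinv_0_lt_compat _ Hr').
split; intros [H1 H2]; split; unfold Rdiv in *;
  (now apply Rmult_lt_compat_r) || now apply Rmult_lt_reg_r with (/ INR r).
Qed.

(** The only place where the orientation of the curve enters. *)
Lemma contour_int_inside (c : R -> C) (a : C) :
  anticlockwise c -> inside c a ->
  contour_int (fun z => / (z - a))%C c 0 1 = (2 * PI * Ci)%C.
Proof.
intros Hc Ha. specialize (Hc a Ha). unfold winding_number in Hc.
assert (Hpi := RtoC_neq_0 PI PI_neq0). assert (H2 := RtoC_neq_0 2 ltac:(lra)).
assert (HCi := Ci_nz).
match type of Hc with (_ * ?I)%C = _ =>
  replace I with (2 * PI * Ci * (/ (2 * PI * Ci) * I))%C by (field; auto) end.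
rewrite Hc. ring.
Qed.

Definition tan_pole (r m : nat) : C := RtoC ((INR m + / 2) / INR r).
Definition cot_pole (r k : nat) : C := RtoC (INR k / INR r).

Lemma Omega_tan_pole (r m : nat) : (m < r)%nat -> Omega r (tan_pole r m).
Proof.
intros Hm. apply Omega_div; [lia|]. assert (H0 := pos_INR m).
assert (H1 : INR m + 1 <= INR r) by (rewrite <- S_INR; apply le_INR; lia). lra.
Qed.

(** The zeros of sine, given as multiples of [PI], in the variable of the
    contour. *)
Lemma trig_arg (r : nat) (z : C) (t : R) :
  (0 < r)%nat -> (RtoC PI * RtoC (INR r) * z)%C = RtoC (PI * t) -> z = RtoC (t / INR r).
Proof.
intros Hr H. assert (Hr' := lt_0_INR r Hr).
assert (Hpi := RtoC_neq_0 PI PI_neq0). assert (H0 := RtoC_neq_0 (INR r) ltac:(lra)).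
replace z with (/ (RtoC PI * RtoC (INR r)) * (RtoC PI * RtoC (INR r) * z))%C by (field; auto).
rewrite H, RtoC_mult. unfold Rdiv. rewrite RtoC_mult, RtoC_inv by lra. field. auto.
Qed.

Lemma trig_arg_inv (r : nat) (t : R) :
  (0 < r)%nat -> (RtoC PI * RtoC (INR r) * RtoC (t / INR r))%C = RtoC (PI * t).
Proof.
intros Hr. assert (Hr' := lt_0_INR r Hr). rewrite <- !RtoC_mult. f_equal. field. lra.
Qed.

(** The tangent is minus the cotangent of the argument shifted by [PI / 2], so both
    contour integrals are instances, with [s = 1/2] and [s = 0]. The
    list [l] enumerates the poles in [Omega r]. *)
Lemma contour_int_cot_shifted (r : nat) (s : R) (c : R -> C) (F : C -> C) (l : list nat) :
  (0 < r)%nat -> closed_curve c -> (forall t, 0 <= t <= 1 -> Omega r (c t)) ->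
  holomorphic (Omega r) F -> NoDup l ->
  (forall n : Z, - / 4 < IZR n + s < INR r + / 4 <-> exists k, In k l /\ n = Z.of_nat k) ->
  (forall k, In k l -> ~ on_curve c (RtoC ((INR k + s) / INR r))) ->
  contour_int (fun z => Ccos (PI * INR r * z - PI * s) /
                        Csin (PI * INR r * z - PI * s) * F z)%C c 0 1 =
  Clist_sum (map (fun k => F (RtoC ((INR k + s) / INR r)) / (PI * INR r) *
    contour_int (fun z => / (z - RtoC ((INR k + s) / INR r))) c 0 1)%C l).
Proof.
intros Hr Hc Hin HF Hnd Hl Hoff.
assert (HU := open_Omega r). assert (Hr' := lt_0_INR r Hr). assert (Hpi := PI_RGT_0).
set (a := (RtoC PI * RtoC (INR r))%C).
assert (Ha : a <> RtoC 0) by (apply Cmult_neq_0; apply RtoC_neq_0; lra).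
set (arg z := (a * z - PI * s)%C).
assert (Harg : holomorphic (Omega r) arg).
{ apply holomorphic_minus; trivial; [now apply holomorphic_linear|now apply holomorphic_const]. }
set (pole k := RtoC ((INR k + s) / INR r)).
assert (Hpole : forall k, arg (pole k) = RtoC (PI * INR k)).
{ intros k. unfold arg, a, pole.
  rewrite trig_arg_inv, <- RtoC_mult, <- RtoC_minus by trivial. f_equal. ring. }
assert (Hsin : forall k, sin (PI * INR k) = 0).
{ intros k. apply sin_eq_0_1. exists (Z.of_nat k). rewrite <- INR_IZR_INZ. ring. }
assert (Hcos : forall k, Ccos (arg (pole k)) <> RtoC 0).
{ intros k. rewrite Hpole, Ccos_RtoC. apply RtoC_neq_0. intros H.
  assert (H1 := sin2_cos2 (PI * INR k)). rewrite Hsin, H in H1. unfold Rsqr in H1. lra. }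
assert (Hd : forall z, C_derive (fun z => Csin (arg z)) z = (a * Ccos (arg z))%C).
{ intros z. apply is_C_derive_unique.
  replace (a * Ccos (arg z))%C
    with (Ccos (arg z) * (a + RtoC 0))%C by ring.
  apply (is_Cderive_comp Csin arg); [apply is_Cderive_Csin|].
  apply (is_Cderive_plus (fun z => a * z)%C (fun _ => - (PI * s))%C);
    [apply is_Cderive_linear|apply is_Cderive_const]. }
rewrite (contour_int_ext _ (fun z => (Ccos (arg z) * F z) / Csin (arg z))%C).
2: { intros t _. unfold arg, Cdiv. ring. }
rewrite (residues_simple_zeros (Omega r) _ _ (map pole l)); trivial.
- rewrite map_map. f_equal. apply map_ext. intros k. rewrite Hd.
  specialize (Hcos k). fold (pole k). unfold a in *. f_equal. field.
  repeat split; try apply RtoC_neq_0; trivial; lra.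
- apply convex_Omega.
- apply holomorphic_mult; trivial. now apply holomorphic_Ccos.
- now apply holomorphic_Csin.
- apply Injective_map_NoDup; trivial. intros k k' H.
  apply (f_equal Re) in H. unfold pole in H. rewrite !re_RtoC in H.
  apply INR_eq, (Rplus_eq_reg_r s), (Rmult_eq_reg_r (/ INR r)); [exact H|].
  apply Rgt_not_eq, Rinv_0_lt_compat. lra.
- intros z. split.
  + intros [Hz H]. destruct (Csin_eq_0 _ H) as [n Hn].
    assert (Ez : z = RtoC ((IZR n + s) / INR r)).
    { apply trig_arg; trivial. fold a.
      replace (a * z)%C with (arg z + RtoC PI * RtoC s)%C by (unfold arg; ring).
      rewrite Hn, <- RtoC_mult, <- RtoC_plus. f_equal. ring. }
    rewrite Ez in Hz. apply Omega_div in Hz; [|trivial].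
    apply Hl in Hz as (k & Hk & ->). rewrite Ez. apply in_map_iff.
    exists k. unfold pole. now rewrite INR_IZR_INZ.
  + intros Hz. apply in_map_iff in Hz as (k & <- & Hk). split.
    * apply Omega_div; trivial. rewrite INR_IZR_INZ. apply Hl. now exists k.
    * rewrite Hpole, Csin_RtoC. now f_equal.
- intros z Hz. apply in_map_iff in Hz as (k & <- & Hk). rewrite Hd.
  now apply Cmult_neq_0.
- intros z Hz. apply in_map_iff in Hz as (k & <- & Hk). now apply Hoff.
Qed.

Lemma contour_int_tan (r : nat) (c : R -> C) (F : C -> C) :
  (0 < r)%nat -> contour_y r c -> holomorphic (Omega r) F ->
  contour_int (fun y => Ctan (PI * INR r * y) * F y)%C c 0 1 =
  (- (2 * Ci / INR r) * Clist_sum (map (fun m => F (tan_pole r m)) (seq 0 r)))%C.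
Proof.
intros Hr (Hc & Hac & Hin & Hins) HF. assert (Hr' := lt_0_INR r Hr).
assert (Hpi := PI_RGT_0).
rewrite (contour_int_ext _ (fun y => Ccos (PI * INR r * y - PI * (/ 2)%R) /
           Csin (PI * INR r * y - PI * (/ 2)%R) * - F y)%C).
2: { intros t _. set (w := (PI * INR r * c t)%C).
  assert (E : (w - PI * (/ 2)%R + RtoC (PI / 2))%C = w).
  { rewrite <- RtoC_mult. unfold Rdiv. ring. }
  assert (E1 := Csin_plus_PI2 (w - PI * (/ 2)%R)).
  assert (E2 := Ccos_plus_PI2 (w - PI * (/ 2)%R)). rewrite E in E1, E2.
  rewrite <- E1. unfold Ctan. rewrite E2. set (v := Csin (w - PI * (/ 2)%R)).
  destruct (classic (v = RtoC 0)) as [->|Hv].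
  - replace (- RtoC 0)%C with (RtoC 0) by ring. unfold Cdiv. rewrite Cinv_0. ring.
  - field. trivial. }
rewrite (contour_int_cot_shifted r (/ 2) c _ (seq 0 r)); trivial.
- rewrite <- Clist_sum_scal. f_equal. apply map_ext_in. intros m Hm. apply in_seq in Hm.
  rewrite contour_int_inside; trivial.
  2: { apply Hins. lia. }
  unfold tan_pole. field. split; apply RtoC_neq_0; lra.
- apply holomorphic_opp; trivial. apply open_Omega.
- apply seq_NoDup.
- intros n. rewrite INR_IZR_INZ. split.
  + intros H. exists (Z.to_nat n).
    assert (-1 < n)%Z by (apply lt_IZR; simpl; lra).
    assert (n < Z.of_nat r)%Z by (apply lt_IZR; lra).
    rewrite in_seq. lia.
  + intros (k & Hk & ->). apply in_seq in Hk.
    assert (0 <= IZR (Z.of_nat k)) by (apply IZR_le; lia).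
    assert (IZR (Z.of_nat k) + 1 <= IZR (Z.of_nat r)) by (rewrite <- plus_IZR; apply IZR_le; lia).
    lra.
- intros m Hm. apply in_seq in Hm. apply (Hins m). lia.
Qed.

(** The terms of the poles [0] and [1] vanish with [G]. *)
Lemma contour_int_cot (r : nat) (c : R -> C) (G : C -> C) :
  (0 < r)%nat -> contour_x r c -> holomorphic (Omega r) G ->
  G (cot_pole r 0) = RtoC 0 -> G (cot_pole r r) = RtoC 0 ->
  contour_int (fun x => Ccot (PI * INR r * x) * G x)%C c 0 1 =
  (2 * Ci / INR r * Clist_sum (map (fun k => G (cot_pole r k)) (seq 1 (r - 1))))%C.
Proof.
intros Hr (Hc & Hac & Hin & Hins & [Hout0 _] & [Hout1 _]) HG G0 G1.
assert (Hr' := lt_0_INR r Hr). assert (Hpi := PI_RGT_0).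
assert (Hp : forall k, RtoC ((INR k + 0) / INR r) = cot_pole r k).
{ intros k. now rewrite Rplus_0_r. }
rewrite (contour_int_ext _ (fun x => Ccos (PI * INR r * x - PI * RtoC 0) /
           Csin (PI * INR r * x - PI * RtoC 0) * G x)%C).
2: { intros t _. unfold Ccot. rewrite Cmult_0_r. unfold Cminus.
  now rewrite <- RtoC_opp, Ropp_0, Cplus_0_r. }
rewrite (contour_int_cot_shifted r 0 c _ (seq 0 (S r))); trivial.
- assert (Es : seq 0 (S r) = 0%nat :: seq 1 (r - 1) ++ (r :: nil)).
  { simpl. f_equal. replace r with (r - 1 + 1)%nat at 1 by lia.
    rewrite seq_app. do 2 f_equal. simpl. f_equal. lia. }
  rewrite Es. simpl map. rewrite map_app. simpl map.
  change (Clist_sum (?x :: ?l)) with (x + Clist_sum l)%C.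
  rewrite Clist_sum_app. change (Clist_sum (?x :: nil)) with (x + RtoC 0)%C.
  rewrite (Hp r), (Hp 0%nat : RtoC ((0 + 0) / INR r) = _), G0, G1.
  rewrite <- Clist_sum_scal. unfold Cdiv. rewrite !Cmult_0_l, !Cplus_0_r, Cplus_0_l.
  f_equal. apply map_ext_in. intros k Hk. apply in_seq in Hk.
  rewrite Hp, contour_int_inside; trivial.
  2: { apply Hins. lia. }
  field. split; apply RtoC_neq_0; lra.
- apply seq_NoDup.
- intros n. rewrite INR_IZR_INZ. split.
  + intros H. exists (Z.to_nat n).
    assert (-1 < n)%Z by (apply lt_IZR; simpl; lra).
    assert (n < Z.of_nat r + 1)%Z by (apply lt_IZR; rewrite plus_IZR; lra).
    rewrite in_seq. lia.
  + intros (k & Hk & ->). apply in_seq in Hk.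
    assert (0 <= IZR (Z.of_nat k)) by (apply IZR_le; lia).
    assert (IZR (Z.of_nat k) <= IZR (Z.of_nat r)) by (apply IZR_le; lia).
    lra.
- intros k Hk. apply in_seq in Hk. rewrite Hp.
  destruct (Nat.eq_dec k 0) as [->|H0].
  + unfold cot_pole. simpl. unfold Rdiv. now rewrite Rmult_0_l.
  + destruct (Nat.eq_dec k r) as [->|H1].
    * unfold cot_pole, Rdiv. now rewrite Rinv_r by lra.
    * apply (Hins k). lia.
Qed.

(** * Finite sums and products *)

Lemma Csum_list (a : nat -> C) (len m n : nat) :
  S n = (m + len)%nat -> Csum a m n = Clist_sum (map a (seq m len)).
Proof.
revert m. induction len as [|len IH]; intros m H.
- unfold Csum. rewrite sum_n_m_zero by lia. reflexivity.
- unfold Csum. rewrite sum_Sn_m by lia. fold (Csum a (S m) n).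
  rewrite IH by lia. reflexivity.
Qed.

Lemma Csum_ext (a b : nat -> C) (m n : nat) :
  (forall k, (m <= k <= n)%nat -> a k = b k) -> Csum a m n = Csum b m n.
Proof. intros H. now apply sum_n_m_ext_loc. Qed.

Lemma Csum_scal (k : C) (a : nat -> C) (m n : nat) :
  Csum (fun j => k * a j)%C m n = (k * Csum a m n)%C.
Proof. apply (sum_n_m_mult_l (K := C_Ring)). Qed.

Lemma Cprod_ext (a b : nat -> C) (m : nat) :
  (forall l, (1 <= l <= m)%nat -> a l = b l) -> Cprod a m = Cprod b m.
Proof.
induction m as [|m IH]; intros H; simpl; trivial.
rewrite IH, H; trivial; [lia|]. intros l Hl. apply H. lia.
Qed.

Lemma Cprod_zero (a : nat -> C) (l m : nat) :
  (1 <= l <= m)%nat -> a l = RtoC 0 -> Cprod a m = RtoC 0.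
Proof.
intros Hl H. induction m as [|m IH]; [lia|]. simpl.
destruct (Nat.eq_dec l (S m)) as [->|Hne].
- rewrite H. ring.
- rewrite IH by lia. ring.
Qed.

(** * The quotient of quantum dilogarithms at the poles *)

Lemma xi_pow (r n : nat) : (xi r ^ n)%C = Cexp (Ci * RtoC (2 * PI * INR n / INR r)).
Proof.
unfold xi. rewrite Cexp_pow. f_equal. unfold Rdiv, Cdiv. rewrite !RtoC_mult.
destruct (Nat.eq_dec r 0) as [->|Hr].
- simpl. rewrite Rinv_0, Cinv_0. ring.
- rewrite RtoC_inv by now apply not_0_INR. ring.
Qed.

Lemma xi_order (r : nat) : (0 < r)%nat -> (xi r ^ r)%C = RtoC 1.
Proof.
intros Hr. rewrite xi_pow. rewrite <- (Cexp_2PI_Z 1). do 3 f_equal.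
field. now apply not_0_INR, Nat.neq_0_lt_0.
Qed.

Lemma gam_bounds (r : nat) : (0 < r)%nat -> 0 < PI / INR r <= PI.
Proof.
intros Hr. assert (Hpi := PI_RGT_0).
assert (1 <= INR r) by (apply (le_INR 1); lia).
split; [apply Rdiv_lt_0_compat; lra|].
apply Rmult_le_reg_r with (INR r); [lra|].
unfold Rdiv. rewrite Rmult_assoc, Rinv_l by lra. nra.
Qed.

(** The midpoint of the two arguments of [S] at [x = k / r]. *)
Definition dilog_point (r k : nat) : R := - PI + 2 * (PI / INR r) * INR k.

Lemma one_plus_Cexp (r n : nat) (t : R) :
  (0 < r)%nat -> t = - PI + 2 * (PI / INR r) * INR n ->
  (1 + Cexp (Ci * RtoC t) = 1 - xi r ^ n)%C.
Proof.
intros Hr ->. rewrite xi_pow.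
replace (Ci * RtoC (- PI + 2 * (PI / INR r) * INR n))%C
  with (- (RtoC PI * Ci) + Ci * RtoC (2 * PI * INR n / INR r))%C.
- rewrite Cexp_plus, Cexp_opp, Cexp_Ci_PI, RtoC_m1. field.
- replace (2 * (PI / INR r) * INR n) with (2 * PI * INR n / INR r)
    by (field; now apply not_0_INR, Nat.neq_0_lt_0).
  rewrite RtoC_plus, RtoC_opp. ring.
Qed.

Definition dilog_quotient (rho : R) (r k m : nat) : C :=
  (S_gamma rho (PI / INR r) (- PI + 2 * PI * (cot_pole r k - tan_pole r m)) /
   S_gamma rho (PI / INR r) (- PI + 2 * PI * (cot_pole r k + tan_pole r m)))%C.

Lemma dilog_quotient_prod (rho : R) (r k m : nat) :
  0 < rho < 1 -> (1 < r)%nat -> (k <= r)%nat ->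
  dilog_quotient rho r k m =
  ((1 - xi r ^ k) *
   Cprod (fun l => (1 + Cexp (Ci * RtoC (dilog_point r k - 2 * INR l * (PI / INR r)))) *
                   (1 - xi r ^ (k + l))) m)%C.
Proof.
intros Hrho Hr Hk. assert (Hpi := PI_RGT_0).
assert (Hr1 : 1 < INR r) by (apply lt_1_INR; lia).
assert (Hk0 := pos_INR k). assert (Hkr : INR k <= INR r) by now apply le_INR.
set (gam := PI / INR r).
assert (Hg : 0 < gam <= PI) by (apply gam_bounds; lia).
assert (Hgr : gam * INR r = PI) by (unfold gam; field; lra).
assert (E := S_gamma_ratio rho gam (RtoC (dilog_point r k)) m Hrho Hg).
rewrite re_RtoC in E.
assert (Hp : - PI <= dilog_point r k <= PI).
{ unfold dilog_point. fold gam. split; nra. }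
specialize (E Hp).
unfold dilog_quotient, cot_pole, tan_pole. fold gam.
replace (- PI + 2 * PI * (RtoC (INR k / INR r) - RtoC ((INR m + / 2) / INR r)))%C
  with (RtoC (dilog_point r k) - RtoC ((2 * INR m + 1) * gam))%C.
2: { rewrite <- !RtoC_minus, <- !RtoC_mult, <- RtoC_opp, <- RtoC_plus. f_equal.
  unfold dilog_point, gam. field. lra. }
replace (- PI + 2 * PI * (RtoC (INR k / INR r) + RtoC ((INR m + / 2) / INR r)))%C
  with (RtoC (dilog_point r k) + RtoC ((2 * INR m + 1) * gam))%C.
2: { rewrite <- !RtoC_plus, <- !RtoC_mult, <- RtoC_opp, <- RtoC_plus. f_equal.
  unfold dilog_point, gam. field. lra. }
rewrite E. f_equal.
- apply one_plus_Cexp; [lia|reflexivity].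
- apply Cprod_ext. intros l _. rewrite <- RtoC_minus, <- RtoC_plus. f_equal.
  apply one_plus_Cexp; [lia|]. rewrite plus_INR. unfold dilog_point. fold gam. ring.
Qed.

Lemma dilog_quotient_lt (rho : R) (r k m : nat) :
  0 < rho < 1 -> (1 < r)%nat -> (k <= r)%nat -> (m < k)%nat ->
  dilog_quotient rho r k m =
  ((1 - xi r ^ k) *
   Cprod (fun l => (1 - xi r ^ (k - l)) * (1 - xi r ^ (k + l))) m)%C.
Proof.
intros Hrho Hr Hk Hm. rewrite dilog_quotient_prod by trivial. f_equal.
apply Cprod_ext. intros l Hl. f_equal. apply one_plus_Cexp; [lia|].
rewrite minus_INR by lia. unfold dilog_point. ring.
Qed.

(** The factor with [l = k] vanishes; for [k = 0] it is the factor in front. *)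
Lemma dilog_quotient_ge (rho : R) (r k m : nat) :
  0 < rho < 1 -> (1 < r)%nat -> (k <= r)%nat -> (k <= m)%nat ->
  dilog_quotient rho r k m = RtoC 0.
Proof.
intros Hrho Hr Hk Hm. rewrite dilog_quotient_prod by trivial.
destruct (Nat.eq_dec k 0) as [->|H0].
- simpl. ring.
- rewrite (Cprod_zero _ k); [ring|lia|].
  rewrite (one_plus_Cexp r 0); [simpl; ring|lia|].
  unfold dilog_point. simpl. ring.
Qed.

Lemma dilog_quotient_top (rho : R) (r m : nat) :
  0 < rho < 1 -> (1 < r)%nat -> dilog_quotient rho r r m = RtoC 0.
Proof.
intros Hrho Hr. rewrite dilog_quotient_prod, xi_order by (trivial; lia). ring.
Qed.

(** * The double contour integral *)

Lemma f_nr_domain (r : nat) (x y : C) :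
  (0 < r)%nat -> Omega r x -> Omega r y ->
  Re (- PI + 2 * PI * (x - y)) < PI + PI / INR r /\
  - (PI + PI / INR r) < Re (- PI + 2 * PI * (x + y)).
Proof.
intros Hr Hx Hy. assert (Hpi := PI_RGT_0). unfold Omega in *.
assert (0 < INR r) by now apply lt_0_INR.
assert (E : PI * (1 / (4 * INR r)) = PI / INR r / 4) by (field; lra).
replace (Re (- PI + 2 * PI * (x - y))) with (- PI + 2 * PI * (Re x - Re y))
  by (destruct x, y; simpl; ring).
replace (Re (- PI + 2 * PI * (x + y))) with (- PI + 2 * PI * (Re x + Re y))
  by (destruct x, y; simpl; ring).
split; nra.
Qed.

(** For [X], [Y] the identity and a constant, in either order, this is
    holomorphy in one variable. *)
Lemma holomorphic_f_nr (rho : R) (p q d : Z) (r : nat) (n : Z) (X Y : C -> C) :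
  0 < rho < 1 -> (0 < r)%nat ->
  holomorphic (Omega r) X -> holomorphic (Omega r) Y ->
  (forall z, Omega r z -> Omega r (X z) /\ Omega r (Y z)) ->
  holomorphic (Omega r) (fun z => f_nr rho p q d r n (X z) (Y z)).
Proof.
intros Hrho Hr HX HY Hdom. assert (HU := open_Omega r).
assert (Hg := gam_bounds r Hr).
assert (Hc := fun c => holomorphic_const (Omega r) c HU).
unfold f_nr. apply holomorphic_mult; trivial; [apply holomorphic_mult; trivial|].
- apply holomorphic_Csin; trivial. apply holomorphic_mult; trivial.
  now apply holomorphic_minus.
- apply holomorphic_Cexp_comp; trivial. apply holomorphic_mult; trivial.
  apply holomorphic_minus; [trivial| |now apply holomorphic_mult].
  apply holomorphic_minus; [trivial| |now apply holomorphic_mult].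
  apply holomorphic_plus; trivial. apply holomorphic_mult; trivial.
  simpl. apply holomorphic_mult; trivial. now apply holomorphic_mult.
- unfold Cdiv. apply holomorphic_mult; trivial.
  + apply (holomorphic_comp (Omega r) (fun w => Re w < PI + PI / INR r) (S_gamma rho (PI / INR r))
      (fun z => - PI + 2 * PI * (X z - Y z))%C HU (open_Re_lt _)).
    * intros z Hz. destruct (Hdom z Hz). now apply f_nr_domain.
    * now apply holomorphic_S_gamma.
    * apply holomorphic_plus; trivial. apply holomorphic_mult; trivial.
      now apply holomorphic_minus.
  + apply (holomorphic_comp (Omega r) (fun w => - (PI + PI / INR r) < Re w) (fun w => / S_gamma rho (PI / INR r) w)%C
      (fun z => - PI + 2 * PI * (X z + Y z))%C HU (open_Re_gt _)).
    * intros z Hz. destruct (Hdom z Hz). now apply f_nr_domain.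
    * now apply holomorphic_inv_S_gamma.
    * apply holomorphic_plus; trivial. apply holomorphic_mult; trivial.
      now apply holomorphic_plus.
Qed.

Lemma f_nr_zero (rho : R) (p q d : Z) (r k m : nat) (n : Z) :
  dilog_quotient rho r k m = RtoC 0 ->
  f_nr rho p q d r n (cot_pole r k) (tan_pole r m) = RtoC 0.
Proof. intros H. unfold f_nr. fold (dilog_quotient rho r k m). rewrite H. ring. Qed.

Theorem double_contour_int (p q d : Z) (r : nat) (rho : R) (n : Z) (C1 C2 : R -> C) :
  (1 < r)%nat -> 0 < rho < 1 -> contour_x r C1 -> contour_y r C2 ->
  contour_int
    (fun x => Ccot (PI * INR r * x) *
       contour_int (fun y => Ctan (PI * INR r * y) * f_nr rho p q d r n x y) C2 0 1)%C
    C1 0 1 =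
  (4 / (INR r) ^ 2 * Csum (fun k => Clist_sum
     (map (fun m => f_nr rho p q d r n (cot_pole r k) (tan_pole r m)) (seq 0 r))) 1 (r - 1))%C.
Proof.
intros Hr Hrho H1 H2. assert (HU := open_Omega r).
assert (Hr0 := RtoC_neq_0 (INR r) (not_0_INR r ltac:(lia))).
set (G x := Clist_sum (map (fun m => f_nr rho p q d r n x (tan_pole r m)) (seq 0 r))).
rewrite (contour_int_ext _
  (fun x => Ccot (PI * INR r * x) * (- (2 * Ci / INR r) * G x))%C).
2: { intros t Ht. f_equal. unfold G.
  apply (contour_int_tan r C2 (f_nr rho p q d r n (C1 t))); trivial; [lia|].
  apply holomorphic_f_nr; trivial; [lia|now apply holomorphic_const|now apply holomorphic_id|].
  intros z Hz. split; trivial. now apply H1. }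
assert (HG : holomorphic (Omega r) G).
{ apply (holomorphic_Clist_sum (Omega r) nat
    (fun m x => f_nr rho p q d r n x (tan_pole r m))); trivial.
  intros m Hm. apply in_seq in Hm.
  apply holomorphic_f_nr; trivial; [lia|now apply holomorphic_id|now apply holomorphic_const|].
  intros z Hz. split; trivial. apply Omega_tan_pole. lia. }
assert (HG0 : forall k, (forall m, dilog_quotient rho r k m = RtoC 0) -> G (cot_pole r k) = RtoC 0).
{ intros k Hk. apply Clist_sum_zero. intros z Hz.
  apply in_map_iff in Hz as (m & <- & _). now apply f_nr_zero. }
rewrite (contour_int_cot r C1 (fun x => - (2 * Ci / INR r) * G x)%C); trivial.
- rewrite (Csum_list _ (r - 1)) by lia.
  rewrite Clist_sum_scal. fold G.
  match goal with |- (?a * (?b * ?s) = ?c * ?s')%C =>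
    change s' with s; transitivity (a * b * s)%C; [ring|]; f_equal end.
  transitivity (- (Ci * Ci) * (4 / INR r ^ 2))%C.
  + simpl. field. trivial.
  + rewrite Ci_Ci. ring.
- lia.
- apply holomorphic_mult; trivial. now apply holomorphic_const.
- rewrite HG0; [ring|]. intros m. apply dilog_quotient_ge; trivial; lia.
- rewrite HG0; [ring|]. intros m. now apply dilog_quotient_top.
Qed.

Lemma sin_over_xi (r k : nat) :
  ((1 - xi r ^ k) * Cexp (- (Ci * RtoC (PI * INR k / INR r))) =
   - (2 * Ci * RtoC (sin (PI * INR k / INR r))))%C.
Proof.
rewrite xi_pow.
replace (Ci * RtoC (2 * PI * INR k / INR r))%C
  with (Ci * RtoC (PI * INR k / INR r) + Ci * RtoC (PI * INR k / INR r))%C.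
2: { rewrite <- Cmult_plus_distr_l, <- RtoC_plus. do 2 f_equal. unfold Rdiv. ring. }
rewrite <- Csin_RtoC. unfold Csin. rewrite Cexp_plus, !Cexp_opp.
field. split; [apply Cexp_neq_0|apply Ci_nz].
Qed.

Lemma f_nr_at_poles (rho : R) (p q d : Z) (r k m : nat) (n : Z) :
  0 < rho < 1 -> (1 < r)%nat -> (k <= r)%nat -> (m < k)%nat -> q <> 0%Z ->
  f_nr rho p q d r n (cot_pole r k) (tan_pole r m) =
  (2 * Ci * Cexp (2 * PI * Ci * INR r * (IZR d * IZR n ^ 2 / IZR q)) *
   (sin (PI / IZR q * (2 * IZR n * IZR d - INR k / INR r))%R
    * Cexp (PI * Ci * INR r / (2 * IZR q)
            * (IZR p * (INR k / INR r) ^ 2 - 4 * IZR n * (INR k / INR r)))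
    * sin (PI * INR k / INR r)%R) *
   (/ (xi r ^ (m * k)) *
    Cprod (fun l => (1 - xi r ^ (k - l)) * (1 - xi r ^ (k + l))) m))%C.
Proof.
intros Hrho Hr Hk Hm Hq.
assert (Hrn : INR r <> 0) by (apply not_0_INR; lia).
assert (Hr0 := RtoC_neq_0 (INR r) Hrn).
assert (Hq0 := RtoC_neq_0 (IZR q) (not_0_IZR q Hq)).
unfold f_nr. fold (dilog_quotient rho r k m).
rewrite dilog_quotient_lt by trivial.
set (P := Cprod _ m).
set (A := (2 * PI * Ci * INR r * (IZR d * IZR n ^ 2 / IZR q))%C).
set (B := (PI * Ci * INR r / (2 * IZR q) *
           (IZR p * (INR k / INR r) ^ 2 - 4 * IZR n * (INR k / INR r)))%C).
assert (E1 : Csin (PI / IZR q * (cot_pole r k - 2 * IZR n * IZR d)) =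
             (- RtoC (sin (PI / IZR q * (2 * IZR n * IZR d - INR k / INR r))))%C).
{ rewrite <- RtoC_opp, <- sin_neg, <- Csin_RtoC. f_equal. unfold cot_pole.
  rewrite RtoC_opp, RtoC_mult, RtoC_minus, !RtoC_div, !RtoC_mult by (trivial; now apply not_0_IZR). ring. }
assert (E2 : (2 * PI * Ci * INR r *
   (IZR d * IZR n ^ 2 / IZR q + IZR p / (4 * IZR q) * cot_pole r k ^ 2
    - IZR n / IZR q * cot_pole r k - cot_pole r k * tan_pole r m))%C =
   (A + B + - (Ci * RtoC (2 * PI * INR (m * k) / INR r)) + - (Ci * RtoC (PI * INR k / INR r)))%C).
{ unfold A, B, cot_pole, tan_pole.
  rewrite mult_INR, !RtoC_div, !RtoC_mult, !RtoC_plus, RtoC_inv by (trivial; lra).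
  simpl. field. auto. }
rewrite E1, E2, !Cexp_plus, (Cexp_opp (Ci * RtoC (2 * PI * INR (m * k) / INR r))), <- xi_pow.
match goal with |- (- ?s * (?a * ?b * ?x * ?e) * (?y * P) = _)%C =>
  transitivity (- s * (a * b * x) * P * (y * e))%C; [ring|] end.
rewrite sin_over_xi. ring.
Qed.

(** The terms with [m >= k] vanish, which leaves the range of [m] in [J']. *)
Lemma sum_f_nr_tau_summand (rho : R) (p q d : Z) (r : nat) (n : Z) :
  0 < rho < 1 -> (1 < r)%nat -> q <> 0%Z ->
  Csum (fun k => Clist_sum
     (map (fun m => f_nr rho p q d r n (cot_pole r k) (tan_pole r m)) (seq 0 r))) 1 (r - 1) =
  (2 * Ci * sin (PI / INR r)%R * tau_summand p q d r n)%C.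
Proof.
intros Hrho Hr Hq. unfold tau_summand.
assert (Hs : sin (PI / INR r) <> 0).
{ apply Rgt_not_eq. assert (Hpi := PI_RGT_0). assert (1 < INR r) by (apply lt_1_INR; lia).
  apply sin_gt_0; [apply Rdiv_lt_0_compat; lra|].
  apply Rmult_lt_reg_r with (INR r); [lra|].
  unfold Rdiv. rewrite Rmult_assoc, Rinv_l by lra. nra. }
rewrite Cmult_assoc, <- Csum_scal. apply Csum_ext. intros k Hk.
assert (Es : seq 0 r = seq 0 k ++ seq k (r - k)).
{ replace r with (k + (r - k))%nat at 1 by lia. apply seq_app. }
rewrite Es, map_app, Clist_sum_app.
rewrite (Clist_sum_zero (map _ (seq k (r - k)))).
2: { intros z Hz. apply in_map_iff in Hz as (m & <- & Hm). apply in_seq in Hm.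
  apply f_nr_zero, dilog_quotient_ge; trivial; lia. }
rewrite Cplus_0_r.
erewrite map_ext_in.
2: { intros m Hm. apply in_seq in Hm. apply f_nr_at_poles; trivial; lia. }
rewrite Clist_sum_scal.
unfold J'. rewrite (Csum_list _ k) by lia.
rewrite RtoC_div by trivial. field. now apply RtoC_neq_0.
Qed.

(** * Periodicity in the residue class *)

Lemma sin_period_Z (x : R) (N : Z) : sin (x + 2 * PI * IZR N) = sin x.
Proof.
assert (H := Cexp_2PI_Z N). rewrite Cexp_Ci in H. injection H as Hc Hs.
rewrite sin_plus, Hc, Hs. ring.
Qed.

(** Unlike [f_nr] itself, its values at the poles depend on [n] modulo [q] only. *)
Lemma tau_summand_periodic (p q d : Z) (r : nat) (n n' : Z) :
  (0 < r)%nat -> q <> 0%Z -> (q | n - n')%Z ->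
  tau_summand p q d r n = tau_summand p q d r n'.
Proof.
intros Hr Hq [t Ht]. assert (n = n' + t * q)%Z as -> by lia.
assert (Hqn := not_0_IZR q Hq).
assert (Hrn : INR r <> 0) by (apply not_0_INR; lia).
assert (Hr0 := RtoC_neq_0 (INR r) Hrn). assert (Hq0 := RtoC_neq_0 (IZR q) Hqn).
unfold tau_summand. f_equal.
- set (N := (Z.of_nat r * (d * (2 * n' * t + q * t * t)))%Z).
  replace (2 * PI * Ci * INR r * (IZR d * IZR (n' + t * q) ^ 2 / IZR q))%C
    with (2 * PI * Ci * INR r * (IZR d * IZR n' ^ 2 / IZR q) + Ci * RtoC (2 * PI * IZR N))%C.
  + rewrite Cexp_plus, Cexp_2PI_Z. ring.
  + unfold N. rewrite !plus_IZR, !mult_IZR, !plus_IZR, !mult_IZR, <- INR_IZR_INZ.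
    rewrite !RtoC_plus, !RtoC_mult, !RtoC_plus, !RtoC_mult. simpl. field. trivial.
- apply Csum_ext. intros k _. f_equal. f_equal. f_equal.
  + f_equal.
    replace (PI / IZR q * (2 * IZR (n' + t * q) * IZR d - INR k / INR r))
      with (PI / IZR q * (2 * IZR n' * IZR d - INR k / INR r) + 2 * PI * IZR (t * d)).
    * apply sin_period_Z.
    * rewrite plus_IZR, !mult_IZR. field. auto.
  + set (N := (- (t * Z.of_nat k))%Z).
    replace (PI * Ci * INR r / (2 * IZR q) *
      (IZR p * (INR k / INR r) ^ 2 - 4 * IZR (n' + t * q) * (INR k / INR r)))%C
      with (PI * Ci * INR r / (2 * IZR q) *
        (IZR p * (INR k / INR r) ^ 2 - 4 * IZR n' * (INR k / INR r)) +
        Ci * RtoC (2 * PI * IZR N))%C.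
    * rewrite Cexp_plus, Cexp_2PI_Z. ring.
    * unfold N. rewrite opp_IZR, plus_IZR, !mult_IZR, <- INR_IZR_INZ.
      rewrite RtoC_plus, !RtoC_mult, RtoC_opp, !RtoC_mult. simpl. field. auto.
Qed.

Theorem lemma2 :
  forall (p q d : Z) (r : nat) (rho : R) (nu : nat -> Z) (C1 C2 : R -> C),
    Z.gcd p q = 1%Z ->
    q <> 0%Z ->
    (q | p * d - 1)%Z ->
    (3 < r)%nat ->
    0 < rho < 1 ->
    residue_system q nu ->
    contour_x r C1 ->
    contour_y r C2 ->
    tau p q d r =
    (beta_coef p q r * INR r ^ 2 / 4
     * Csum
         (fun j =>
            contour_int
              (fun x =>
                 Ccot (PI * INR r * x)
                 * contour_int
                     (fun y => Ctan (PI * INR r * y)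
                               * f_nr rho p q d r (nu j) x y)
                     C2 0 1)
              C1 0 1)
         0 (Z.abs_nat q - 1))%C.
Proof.
intros p q d r rho nu C1 C2 _ Hq _ Hr Hrho Hnu H1 H2.
assert (Hrn : INR r <> 0) by (apply not_0_INR; lia).
assert (Hr0 := RtoC_neq_0 (INR r) Hrn).
rewrite (Csum_ext _ (fun j => 4 / INR r ^ 2 * (2 * Ci * sin (PI / INR r)%R) *
                              tau_summand p q d r (Z.of_nat j))%C).
2: { intros j Hj. rewrite double_contour_int by (trivial; lia).
  rewrite sum_f_nr_tau_summand by (trivial; lia).
  rewrite (tau_summand_periodic p q d r (nu j) (Z.of_nat j)); trivial; [ring|lia|].
  apply Hnu. lia. }
rewrite Csum_scal. unfold tau.
set (T := Csum _ _ _). unfold a_coef, beta_coef.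
set (phase := framing_phase p q r).
assert (Hsq : RtoC (sqrt (IZR (Z.abs q))) <> RtoC 0).
{ apply RtoC_neq_0, Rgt_not_eq, sqrt_lt_R0, IZR_lt. lia. }
set (s := RtoC (sqrt (IZR (Z.abs q)))) in *.
(* The constants agree because [- 2 = 2 i^2]. *)
transitivity (Ci * Ci * (2 * IZR (Z.sgn q) / (INR r * s)) * sin (PI / INR r)%R * phase * T)%C.
- rewrite Ci_Ci. ring.
- simpl. field. auto.
Qed.
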